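(* Let $(G,E,\varphi)$ be a self-similar graph action such that $E$ is a finite graph with no sinks or sources. Suppose further that $(G,E,\varphi)$ is pseudo-free. Then $\mathcal{O}_{G,E}$ is isomorphic (as a C*-algebra) to a partial crossed product $C(\Sigma_E)\rtimes_{\widetilde\theta}U(\mathcal{S}_{G,E})$, where $\widetilde\theta$ is the partial action of $U(\mathcal{S}_{G,E})$ on $C(\Sigma_E)$ derived from the canonical action $\theta$ of $\mathcal{S}_{G,E}$ on $\Sigma_E$ as described in the context.
   Context: **Graphs.** A directed graph is $E=(E^0,E^1,r,d)$ with vertex set $E^0$, edge set $E^1$ and maps $r,d:E^1\to E^0$. A vertex $x$ is a source if $r^{-1}(x)=\emptyset$ and a sink if $d^{-1}(x)=\emptyset$. For $n\ge 2$, $E^n=\{x_1\cdots x_n : x_i\in E^1,\ d(x_i)=r(x_{i+1})\}$, and $E^*=\bigcup_{n\ge 0}E^n$ is the set of finite paths (vertices are paths of length $0$). For $\alpha=x_1\cdots x_n$, $r(\alpha)=r(x_1)$, $d(\alpha)=d(x_n)$; for a vertex $x$, $r(x)=d(x)=x$. Paths $\alpha,\beta$ may be concatenated to $\alpha\beta$ when $d(\alpha)=r(\beta)$, with $r(\alpha)\alpha=\alpha=\alpha d(\alpha)$. $\Sigma_E=\{e_1e_2\cdots : e_i\in E^1,\ d(e_i)=r(e_{i+1})\ \forall i\ge1\}$ is the space of infinite paths with the product topology; for $x=e_1e_2\cdots$ put $r(x)=r(e_1)$. For $\alpha\in E^*$, $\alpha\Sigma_E=\{\alpha x : x\in\Sigma_E,\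 r(x)=d(\alpha)\}$. **Self-similar graph actions.** A self-similar graph action $(G,E,\varphi)$ consists of a finite directed graph $E$ with no sources or sinks, a countable discrete group $G$ acting on $E$ by graph automorphisms (bijections of $E^0\cup E^1$ preserving $E^0$, $E^1$ and commuting with $r,d$), and a map $\varphi:G\times E^1\to G$ with $\varphi(gh,e)=\varphi(g,he)\varphi(h,e)$ and $\varphi(g,e)x=gx$ for all $g,h\in G$, $e\in E^1$, $x\in E^0$. The action and $\varphi$ extend to $E^*$ (length-preservingly) by $\varphi(g,x)=g$ for $x\in E^0$, and $g(\alpha\beta)=(g\alpha)(\varphi(g,\alpha)\beta)$, $\varphi(g,\alpha\beta)=\varphi(\varphi(g,\alpha),\beta)$ when $d(\alpha)=r(\beta)$. The action extends to $\Sigma_E$ by homeomorphisms: $(gx)_1=gx_1$ and $(gx)_i=\varphi(g,x_1\cdots x_{i-1})x_i$ for $i\ge 2$. **Pseudo-free.** $(G,E,\varphi)$ is pseudo-free if whenever $g\in G$ and $e\in E^1$ satisfy $ge=e$ and $\varphi(g,e)=1$, then $g=1$. **The C*-algebra $\mathcal{O}_{G,E}$.** It is the universal C*-algebra for the set $\{p_x : x\in E^0\}\cup\{s_e : e\in E^1\}\cup\{u_g : g\in G\}$ subject to: $\{p_x : x\in E^0\}$ is a set of mutually orthogonal projections; $\{s_e : e\in E^1\}$ is a set of partial isometries; $s_e^*s_e=p_{d(e)}$ for each $e\in E^1$; $p_x=\sum_{e\in r^{-1}(x)}s_es_e^*$ for each $x\in E^0$ with $0<|r^{-1}(x)|<\infty$;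 $g\mapsto u_g$ is a unitary representation of $G$; $u_gs_e=s_{ge}u_{\varphi(g,e)}$ for all $g\in G$ and $e\in E^1$; and $u_gp_x=p_{gx}u_g$ for all $g\in G$ and $x\in E^0$. **The inverse semigroup and its universal group.** $\mathcal{S}_{G,E}=\{(\alpha,g,\beta)\in E^*\times G\times E^* : d(\alpha)=g\,d(\beta)\}\cup\{0\}$, with zero element $0$, involution $(\alpha,g,\beta)^*=(\beta,g^{-1},\alpha)$, and product $$(\alpha,g,\beta)(\gamma,h,\nu)=\begin{cases}(\alpha\, g\gamma',\ \varphi(g,\gamma')h,\ \nu) & \text{if }\gamma=\beta\gamma',\\ (\alpha,\ g\,\varphi(h^{-1},\beta')^{-1},\ \nu\, h^{-1}\beta') & \text{if }\beta=\gamma\beta',\\ 0 & \text{otherwise.}\end{cases}$$ The universal group $U(\mathcal{S})$ of an inverse semigroup $\mathcal{S}$ with zero is the group generated by the set $\mathcal{S}\setminus\{0\}$ subject to the relations $s\cdot t=st$ whenever $st\neq 0$; $\sigma:\mathcal{S}\setminus\{0\}\to U(\mathcal{S})$ denotes the natural map. **The partial action.** Each $(\alpha,k,\beta)\in\mathcal{S}_{G,E}$ acts on $\Sigma_E$ by the partial homeomorphism $\theta_{(\alpha,k,\beta)}:\beta\Sigma_E\to\alpha\Sigma_E$, $\beta x\mapsto\alpha(kx)$. The induced partial action of $U(\mathcal{S}_{G,E})$ on $\Sigma_E$ is given, for $g\in U(\mathcal{S}_{G,E})$, by the open sets $F_g=\bigcup_{(\alpha,k,\beta)\in\sigma^{-1}(g)}\alpha\Sigma_E$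 and the homeomorphisms $\theta_g:F_{g^{-1}}\to F_g$ with $\theta_g(\xi)=\theta_s(\xi)$ for any $s=(\alpha,k,\beta)\in\sigma^{-1}(g)$ with $\xi\in\beta\Sigma_E$ (in the pseudo-free case this is independent of the choice of $s$). The corresponding partial action $\widetilde\theta$ on $C(\Sigma_E)$ consists of the ideals $C_0(F_g)$ (functions in $C(\Sigma_E)$ vanishing outside $F_g$) and the $*$-isomorphisms $\widetilde\theta_g:C_0(F_{g^{-1}})\to C_0(F_g)$, $\widetilde\theta_g(f)(x)=f(\theta_g^{-1}(x))$. **Partial crossed product.** For a partial C*-dynamical system $(A,H,\{D_h\},\{\theta_h\})$ with $H$ discrete ($D_h$ closed two-sided ideals of $A$, $\theta_h:D_{h^{-1}}\to D_h$ $*$-isomorphisms, $D_1=A$, $\theta_1=\mathrm{id}$, and $\theta_{gh}$ extends $\theta_g\circ\theta_h$), the partial crossed product $A\rtimes_\theta H$ is the (full, i.e. enveloping) C*-completion of the $*$-algebra of finite formal sums $\sum_h a_h\delta_h$, $a_h\in D_h$, with $(a\delta_g)(b\delta_h)=\theta_g(\theta_{g^{-1}}(a)b)\delta_{gh}$ and $(a\delta_g)^*=\theta_{g^{-1}}(a^* )\delta_{g^{-1}}$.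
   Formalization: The relation that the sum of all p_x equals 1 (the unit for which the u_g are unitary) is added to those defining O_{G,E}; without it, one vertex with one loop and trivial G gives C(T)⊕C on one side and C(T) on the other. *)

(* Defs.v *)
From HB Require Import structures.
From mathcomp Require Import all_boot all_order all_algebra.
From mathcomp Require Import complex lra.
From mathcomp Require Import all_classical all_reals all_analysis.
Set Implicit Arguments.
Unset Strict Implicit.
Unset Printing Implicit Defensive.
Import Order.TTheory GRing.Theory Num.Theory.
Import numFieldNormedType.Exports.
Local Open Scope classical_set_scope.
Local Open Scope ring_scope.
Local Open Scope complex_scope.
Local Open Scope quotient_scope.

(* All the C*-algebras considered here are unital, and the zero algebra is
   allowed.  Hence the structure is built on pzRingType: the library's algType
   forces 1 != 0, and its hierarchy has no join of lmodType and pzRingType, so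
   that the scalar multiplication is a field of the mixin. *)
HB.mixin Record isCStarAlgebra (R : realType) A
    of GRing.PzRing A := {
  cscale : R[i] -> A -> A;
  star : A -> A;
  cnorm : A -> R;
  cscaleA : forall (k l : R[i]) (a : A), cscale k (cscale l a) = cscale (k * l) a;
  cscale1 : forall a : A, cscale 1 a = a;
  cscaleDr : forall (k : R[i]) (a b : A), cscale k (a + b) = cscale k a + cscale k b;
  cscaleDl : forall (k l : R[i]) (a : A), cscale (k + l) a = cscale k a + cscale l a;
  cscaleAl : forall (k : R[i]) (a b : A), cscale k (a * b) = cscale k a * b;
  cscaleAr : forall (k : R[i]) (a b : A), cscale k (a * b) = a * cscale k b;
  starK : forall a : A, star (star a) = a;
  starD : forall a b : A, star (a + b) = star a + star b;
  starZ : forall (k : R[i]) (a : A), star (cscale k a) = cscale k^* (star a);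
  starM : forall a b : A, star (a * b) = star b * star a;
  cnorm_eq0 : forall a : A, cnorm a = 0 -> a = 0;
  cnormD : forall a b : A, cnorm (a + b) <= cnorm a + cnorm b;
  cnormZ : forall (k : R[i]) (a : A), cnorm (cscale k a) = Normc.normc k * cnorm a;
  cnormM : forall a b : A, cnorm (a * b) <= cnorm a * cnorm b;
  cnormX : forall a : A, cnorm (star a * a) = cnorm a ^+ 2;
  cnorm_complete : forall u : nat -> A,
    (forall e : R, 0 < e -> exists N, forall m n, (N <= m)%N -> (N <= n)%N ->
       cnorm (u m - u n) <= e) ->
    exists l : A, forall e : R, 0 < e -> exists N, forall n, (N <= n)%N ->
       cnorm (u n - l) <= e
}.

#[short(type="cstarAlgType")]
HB.structure Definition CStarAlgebra (R : realType) :=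
  {A of GRing.PzRing A & isCStarAlgebra R A}.

Section StarHom.
Context (R : realType) (A B : cstarAlgType R).

Record is_star_hom (f : A -> B) : Prop := StarHom {
  sh_add : forall a b, f (a + b) = f a + f b;
  sh_scale : forall (k : R[i]) a, f (cscale k a) = cscale k (f a);
  sh_mul : forall a b, f (a * b) = f a * f b;
  sh_one : f 1 = 1;
  sh_star : forall a, f (star a) = star (f a)
}.

Definition cstar_isomorphic : Prop :=
  exists f : A -> B, is_star_hom f /\ bijective f.

End StarHom.

Section Norm.
Context (R : realType) (A : cstarAlgType R).
Implicit Types (a b : A) (u v : nat -> A).

Definition seq_cauchy u := forall e : R, 0 < e -> exists N, forall m n,
  (N <= m)%N -> (N <= n)%N -> cnorm (u m - u n) <= e.

Definition seq_cvg u (l : A) := forall e : R, 0 < e -> exists N, forall n,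
  (N <= n)%N -> cnorm (u n - l) <= e.

Definition seq_closed (D : set A) :=
  forall u l, (forall n, D (u n)) -> seq_cvg u l -> D l.

Lemma cscale0l a : cscale (0 : R[i]) a = 0.
Proof. by apply: (addrI (cscale 0 a)); rewrite -cscaleDl !addr0. Qed.

Lemma cscale0r (k : R[i]) : cscale k (0 : A) = 0.
Proof. by apply: (addrI (cscale k 0)); rewrite -cscaleDr !addr0. Qed.

Lemma cscaleN1 a : cscale (- 1 : R[i]) a = - a.
Proof.
by apply/eqP; rewrite -addr_eq0 -{2}(cscale1 a) -cscaleDl addNr cscale0l.
Qed.

Lemma star0 : star 0 = 0 :> A.
Proof. by rewrite -{1}(cscale0l 0) starZ rmorph0 cscale0l. Qed.

Lemma starN a : star (- a) = - star a.
Proof. by rewrite -!cscaleN1 starZ rmorphN rmorph1. Qed.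

Lemma star1 : star 1 = 1 :> A.
Proof. by rewrite -[star 1]mulr1 -{2}(starK (1 : A)) -starM mulr1 starK. Qed.

Lemma cnorm0 : cnorm (0 : A) = 0.
Proof. by rewrite -{1}(cscale0l 0) cnormZ Normc.normc0 mul0r. Qed.

Lemma cnormN a : cnorm (- a) = cnorm a.
Proof.
by rewrite -cscaleN1 cnormZ normcN Normc.normc1 mul1r.
Qed.

Lemma cnorm_ge0 a : 0 <= cnorm a.
Proof.
have := cnormD a (- a); rewrite subrr cnorm0 cnormN -mulr2n pmulrn_lge0 //.
Qed.

Lemma cnormB a b : cnorm (a - b) <= cnorm a + cnorm b.
Proof. by rewrite -[cnorm b]cnormN cnormD. Qed.

Lemma cnorm_dist a b : cnorm (a - b) = cnorm (b - a).
Proof. by rewrite -cnormN opprB. Qed.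

Lemma cnorm_tri b a c : cnorm (a - c) <= cnorm (a - b) + cnorm (b - c).
Proof. by have := cnormD (a - b) (b - c); rewrite addrA subrK. Qed.

Lemma cnorm_star_le a : cnorm a <= cnorm (star a).
Proof.
have [->|a0] := eqVneq a 0; first by rewrite star0.
have h : cnorm a ^+ 2 <= cnorm (star a) * cnorm a by rewrite -cnormX cnormM.
move: h; rewrite expr2 ler_pM2r // lt0r cnorm_ge0 andbT.
by apply: contra_neq a0 => /cnorm_eq0.
Qed.

Lemma cnorm_star a : cnorm (star a) = cnorm a.
Proof. by apply/le_anti; rewrite cnorm_star_le -{2}(starK a) cnorm_star_le. Qed.

Lemma seq_cvg_unique u l l' : seq_cvg u l -> seq_cvg u l' -> l = l'.
Proof.
move=> ul ul'; apply/eqP; rewrite -subr_eq0; apply/eqP/cnorm_eq0.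
apply/le_anti; rewrite cnorm_ge0 andbT.
apply/ler_addgt0Pr => e e0; rewrite add0r.
have e2 : 0 < e / 2 by rewrite divr_gt0.
have [N hN] := ul _ e2; have [M hM] := ul' _ e2.
apply: (le_trans (cnorm_tri (u (maxn N M)) _ _)).
rewrite [leRHS]splitr lerD //; last by apply: hM; rewrite leq_maxr.
by rewrite cnorm_dist; apply: hN; rewrite leq_maxl.
Qed.

Lemma seq_cvg_norm u l (M : R) :
  (exists N, forall n, (N <= n)%N -> cnorm (u n) <= M) -> seq_cvg u l ->
  cnorm l <= M.
Proof.
move=> [N1 uM] ul; apply/ler_addgt0Pr => e e0.
have [N hN] := ul _ e0; pose n := maxn N N1.
have -> : l = u n - (u n - l) by rewrite opprB addrC subrK.
by apply: (le_trans (cnormB _ _)); rewrite lerD // ?uM ?hN // ?leq_maxl ?leq_maxr.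
Qed.

Lemma seq_cvg_cst a : seq_cvg (fun=> a) a.
Proof.
by move=> e e0; exists 0%N => n _; rewrite subrr cnorm0 ltW.
Qed.

Lemma cnorm_distD a b a' b' (e e' : R) :
  cnorm (a - a') <= e -> cnorm (b - b') <= e' ->
  cnorm (a + b - (a' + b')) <= e + e'.
Proof.
by move=> h h'; rewrite opprD addrACA; apply: (le_trans (cnormD _ _)); rewrite lerD.
Qed.

Lemma cnorm_distM a b a' b' (M e e' : R) :
  cnorm b <= M -> cnorm a' <= M ->
  cnorm (a - a') <= e -> cnorm (b - b') <= e' ->
  cnorm (a * b - a' * b') <= e * M + M * e'.
Proof.
move=> bM aM h h'.
have -> : a * b - a' * b' = (a - a') * b + a' * (b - b').
  by rewrite mulrBl mulrBr addrA subrK.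
apply: (le_trans (cnormD _ _)); apply: lerD.
  by apply: (le_trans (cnormM _ _)); rewrite ler_pM // cnorm_ge0.
by apply: (le_trans (cnormM _ _)); rewrite ler_pM // cnorm_ge0.
Qed.

Lemma cscaleB (k : R[i]) a b : cscale k (a - b) = cscale k a - cscale k b.
Proof.
by rewrite cscaleDr -(cscaleN1 b) -(cscaleN1 (cscale k b)) !cscaleA mulrC.
Qed.

Lemma starB a b : star (a - b) = star a - star b.
Proof. by rewrite starD starN. Qed.

Lemma seq_cvgD u v l l' : seq_cvg u l -> seq_cvg v l' ->
  seq_cvg (fun n => u n + v n) (l + l').
Proof.
move=> ul vl e e0; have e2 : 0 < e / 2 by rewrite divr_gt0.
have [N hN] := ul _ e2; have [M hM] := vl _ e2.
exists (maxn N M) => n; rewrite geq_max => /andP[/hN h /hM h'].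
by rewrite [leRHS]splitr; apply: cnorm_distD.
Qed.

Lemma seq_cvg_star u l : seq_cvg u l -> seq_cvg (fun n => star (u n)) (star l).
Proof.
move=> ul e /ul[N hN]; exists N => n /hN.
by rewrite -starB cnorm_star.
Qed.

Lemma seq_cvgZ (k : R[i]) u l :
  seq_cvg u l -> seq_cvg (fun n => cscale k (u n)) (cscale k l).
Proof.
move=> ul e e0; have k1 : 0 < Normc.normc k + 1.
  by rewrite ltr_wpDl // /Normc.normc; case: (k) => *; rewrite sqrtr_ge0.
have [N hN] := ul _ (divr_gt0 e0 k1); exists N => n /hN h.
rewrite -cscaleB cnormZ.
rewrite -(ler_pM2l k1) in h; rewrite mulrCA divff ?gt_eqF // mulr1 in h.
apply: le_trans h; rewrite ler_wpM2r ?cnorm_ge0 // lerDl ler01 //.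
Qed.

Lemma seq_cvgM u v l l' : seq_cvg u l -> seq_cvg v l' ->
  seq_cvg (fun n => u n * v n) (l * l').
Proof.
move=> ul vl e e0.
pose M := cnorm l + cnorm l' + 1.
have M0 : 0 < M by rewrite ltr_wpDl // addr_ge0 ?cnorm_ge0.
have e2 : 0 < e / (M + M) by rewrite divr_gt0 // addr_gt0.
have [N hN] := ul _ e2; have [K hK] := vl _ e2.
have [L hL] := vl _ ltr01.
exists (maxn N (maxn K L)) => n; rewrite !geq_max => /and3P[/hN h /hK h' /hL h1].
have -> : e = e / (M + M) * M + M * (e / (M + M)).
  by rewrite [M * _]mulrC -mulrDr divfK // gt_eqF // addr_gt0.
apply: cnorm_distM => //.
  rewrite -(subrK l' (v n)); apply: (le_trans (cnormD _ _)).
  rewrite /M addrC lerD // lerDr cnorm_ge0 //.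
by rewrite /M -addrA lerDl addr_ge0 // cnorm_ge0.
Qed.

Lemma seq_cvg_cauchy u l : seq_cvg u l -> seq_cauchy u.
Proof.
move=> ul e e0; have e2 : 0 < e / 2 by rewrite divr_gt0.
have [N hN] := ul _ e2; exists N => m n /hN hm /hN hn.
apply: (le_trans (cnorm_tri l _ _)); rewrite [leRHS]splitr lerD //.
by rewrite cnorm_dist.
Qed.

End Norm.

Section UniversalTerms.
Context (R : realType) (X : Type).

Inductive cterm :=
  | CGen of X
  | COne
  | CAdd of cterm & cterm
  | CMul of cterm & cterm
  | CScale of R[i] & cterm
  | CStar of cterm.

Fixpoint ceval (B : cstarAlgType R) (rho : X -> B) (t : cterm) : B :=
  match t with
  | CGen x => rho x
  | COne => 1
  | CAdd s t => ceval rho s + ceval rho t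
  | CMul s t => ceval rho s * ceval rho t
  | CScale k t => cscale k (ceval rho t)
  | CStar t => star (ceval rho t)
  end.

End UniversalTerms.
Arguments COne {R X}.
Arguments CGen {R X} _.

(* [rel B rho] says that the family [rho] of elements of the C*-algebra [B]
   satisfies the given relations.  The universal C*-algebra for these relations
   is the separated completion of the *-algebra of terms in the generators for
   the seminorm  t |-> sup_rho |ceval rho t|.  A term for which this supremum is
   infinite is left out: this makes the construction total, and when the
   universal C*-algebra exists, i.e. when all the generators are bounded, all
   the terms are. *)
Section Universal.
Context (R : realType) (X : Type).
Variable rel : forall B : cstarAlgType R, (X -> B) -> Prop.
Local Notation cterm := (cterm R X).

Definition cbounded (t : cterm) : Prop :=
  exists M : R, forall (B : cstarAlgType R) (rho : X -> B),
    rel rho -> cnorm (ceval rho t) <= M.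

Definition ucauchy (u : nat -> cterm) : Prop :=
  forall e : R, 0 < e -> exists N, forall m n, (N <= m)%N -> (N <= n)%N ->
    forall (B : cstarAlgType R) (rho : X -> B), rel rho ->
      cnorm (ceval rho (u m) - ceval rho (u n)) <= e.

Record cseq := CSeq {
  cseq_term :> nat -> cterm;
  cseq_bounded : forall n, cbounded (cseq_term n);
  cseq_cauchy : ucauchy cseq_term
}.

HB.instance Definition _ := gen_eqMixin cseq.
HB.instance Definition _ := gen_choiceMixin cseq.

Definition clim (B : cstarAlgType R) (rho : X -> B) (u : cseq) : B :=
  xget 0 [set l | seq_cvg (fun n => ceval rho (u n)) l].

Lemma clim_cvg (B : cstarAlgType R) (rho : X -> B) (u : cseq) :
  rel rho -> seq_cvg (fun n => ceval rho (u n)) (clim rho u).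
Proof.
move=> rr; have [l hl] : exists l, seq_cvg (fun n => ceval rho (u n)) l.
  apply: cnorm_complete => e e0; have [N hN] := cseq_cauchy u e0.
  by exists N => m n Nm Nn; apply: hN.
by rewrite /clim; case: xgetP => [//|/(_ l)].
Qed.

Lemma clim_eq (B : cstarAlgType R) (rho : X -> B) (u : cseq) l :
  rel rho -> seq_cvg (fun n => ceval rho (u n)) l -> clim rho u = l.
Proof. by move=> rr; apply: seq_cvg_unique; apply: clim_cvg. Qed.

Lemma cseq_ubounded (u : cseq) : exists M : R, exists N, 0 <= M /\
  forall n, (N <= n)%N -> forall (B : cstarAlgType R) (rho : X -> B),
    rel rho -> cnorm (ceval rho (u n)) <= M.
Proof.
have [N hN] := cseq_cauchy u ltr01; have [M hM] := cseq_bounded u N.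
exists (1 + `|M|), N; split; first by rewrite addr_ge0.
move=> n Nn B rho rr; rewrite -(subrK (ceval rho (u N)) (ceval rho (u n))).
apply: (le_trans (cnormD _ _)); rewrite lerD ?hN //.
by apply: (le_trans (hM _ _ rr)); rewrite ler_norm.
Qed.

Lemma cbounded_one : cbounded COne.
Proof.
exists 1 => B rho rr /=; have := cnormX (1 : B); rewrite star1 mul1r => h.
have [->|n0] := eqVneq (cnorm (1 : B)) 0; first exact: ler01.
by rewrite -(ler_pM2r (_ : 0 < cnorm (1 : B))) ?mul1r -?expr2 -?h // lt0r n0 cnorm_ge0.
Qed.

Lemma cbounded_add s t : cbounded s -> cbounded t -> cbounded (CAdd s t).
Proof.
move=> [M hM] [K hK]; exists (M + K) => B rho rr /=.
by apply: (le_trans (cnormD _ _)); rewrite lerD ?hM ?hK.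
Qed.

Lemma cbounded_mul s t : cbounded s -> cbounded t -> cbounded (CMul s t).
Proof.
move=> [M hM] [K hK]; exists (M * K) => B rho rr /=.
by apply: (le_trans (cnormM _ _)); rewrite ler_pM ?cnorm_ge0 ?hM ?hK.
Qed.

Lemma normc_ge0 (k : R[i]) : 0 <= Normc.normc k.
Proof. by case: k => a b; rewrite sqrtr_ge0. Qed.

Lemma cbounded_scale k t : cbounded t -> cbounded (CScale k t).
Proof.
move=> [M hM]; exists (Normc.normc k * M) => B rho rr /=.
by rewrite cnormZ ler_wpM2l ?hM // normc_ge0.
Qed.

Lemma cbounded_star t : cbounded t -> cbounded (CStar t).
Proof. by move=> [M hM]; exists M => B rho rr /=; rewrite cnorm_star hM. Qed.

Lemma ucauchy_cst t : ucauchy (fun=> t).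
Proof. by move=> e e0; exists 0%N => *; rewrite subrr cnorm0 ltW. Qed.

Lemma ucauchy_add (u v : cseq) : ucauchy (fun n => CAdd (u n) (v n)).
Proof.
move=> e e0; have e2 : 0 < e / 2 by rewrite divr_gt0.
have [N hN] := cseq_cauchy u e2; have [M hM] := cseq_cauchy v e2.
exists (maxn N M) => m n; rewrite !geq_max => /andP[m1 m2] /andP[n1 n2] B rho rr.
by rewrite [leRHS]splitr; apply: cnorm_distD; [apply: hN|apply: hM].
Qed.

Lemma ucauchy_mul (u v : cseq) : ucauchy (fun n => CMul (u n) (v n)).
Proof.
move=> e e0.
have [M1 [N1 [M1p h1]]] := cseq_ubounded u.
have [M2 [N2 [M2p h2]]] := cseq_ubounded v.
pose M := M1 + M2 + 1.
have M0 : 0 < M by rewrite ltr_wpDl // addr_ge0.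
have e2 : 0 < e / (M + M) by rewrite divr_gt0 // addr_gt0.
have [N hN] := cseq_cauchy u e2; have [K hK] := cseq_cauchy v e2.
exists (maxn (maxn N N1) (maxn K N2)) => m n; rewrite !geq_max.
move=> /andP[/andP[m1 m2] /andP[m3 m4]] /andP[/andP[n1 n2] /andP[n3 n4]] B rho rr.
have -> : e = e / (M + M) * M + M * (e / (M + M)).
  by rewrite [M * _]mulrC -mulrDr divfK // gt_eqF // addr_gt0.
apply: cnorm_distM; [|  |exact: hN|exact: hK].
  apply: (le_trans (h2 _ m4 _ _ rr)).
  by rewrite /M addrAC -[leLHS]add0r lerD // addr_ge0.
by apply: (le_trans (h1 _ n2 _ _ rr)); rewrite /M -addrA lerDl addr_ge0.
Qed.

Lemma ucauchy_scale k (u : cseq) : ucauchy (fun n => CScale k (u n)).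
Proof.
move=> e e0; have k1 : 0 < Normc.normc k + 1 by rewrite ltr_wpDl // normc_ge0.
have [N hN] := cseq_cauchy u (divr_gt0 e0 k1).
exists N => m n Nm Nn B rho rr; rewrite /= -cscaleB cnormZ.
have := hN m n Nm Nn _ _ rr.
rewrite -(ler_pM2l k1) mulrCA divff ?gt_eqF // mulr1; apply: le_trans.
by rewrite ler_wpM2r ?cnorm_ge0 // lerDl.
Qed.

Lemma ucauchy_star (u : cseq) : ucauchy (fun n => CStar (u n)).
Proof.
move=> e /(cseq_cauchy u)[N hN]; exists N => m n Nm Nn B rho rr.
by rewrite /= -starB cnorm_star; apply: hN.
Qed.

Definition cseq_cst t (bt : cbounded t) := @CSeq (fun=> t) (fun=> bt) (@ucauchy_cst t).
Definition cseq_add (u v : cseq) := CSeq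
  (fun n => cbounded_add (cseq_bounded u n) (cseq_bounded v n)) (@ucauchy_add u v).
Definition cseq_mul (u v : cseq) := CSeq
  (fun n => cbounded_mul (cseq_bounded u n) (cseq_bounded v n)) (@ucauchy_mul u v).
Definition cseq_scale k (u : cseq) := CSeq
  (fun n => cbounded_scale k (cseq_bounded u n)) (@ucauchy_scale k u).
Definition cseq_star (u : cseq) := CSeq
  (fun n => cbounded_star (cseq_bounded u n)) (@ucauchy_star u).

Definition cseq_eq (u v : cseq) : bool := `[< forall (B : cstarAlgType R)
  (rho : X -> B), rel rho -> clim rho u = clim rho v >].

Lemma cseq_eq_refl : reflexive cseq_eq.
Proof. by move=> u; apply/asboolP. Qed.

Lemma cseq_eq_sym : symmetric cseq_eq.
Proof.
by move=> u v; apply/asboolP/asboolP => h B rho rr; rewrite (h B rho).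
Qed.

Lemma cseq_eq_trans : transitive cseq_eq.
Proof.
move=> v u w /asboolP uv /asboolP vw; apply/asboolP => B rho rr.
by rewrite uv // vw.
Qed.

Canonical cseq_equiv := EquivRel cseq_eq cseq_eq_refl cseq_eq_sym cseq_eq_trans.

Definition univ_cstar : Type := {eq_quot cseq_equiv}.

HB.instance Definition _ := Choice.copy univ_cstar {eq_quot cseq_equiv}.
HB.instance Definition _ := EqQuotient.copy univ_cstar {eq_quot cseq_equiv}.

Definition univ_hom (B : cstarAlgType R) (rho : X -> B) (a : univ_cstar) : B :=
  clim rho (repr a).

Lemma univ_hom_pi (B : cstarAlgType R) (rho : X -> B) (u : cseq) : rel rho ->
  univ_hom rho (\pi_univ_cstar u)%qT = clim rho u.
Proof.
move=> rr; rewrite /univ_hom; case: piP => v /eqquotP/asboolP h.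
by rewrite h.
Qed.

Lemma univ_ext (a b : univ_cstar) : (forall (B : cstarAlgType R) (rho : X -> B),
  rel rho -> univ_hom rho a = univ_hom rho b) -> a = b.
Proof.
by move=> h; rewrite -(reprK a) -(reprK b); apply/eqquotP/asboolP.
Qed.

Definition univ_one : univ_cstar := (\pi_univ_cstar (cseq_cst cbounded_one))%qT.
Definition univ_add (a b : univ_cstar) : univ_cstar :=
  (\pi_univ_cstar (cseq_add (repr a) (repr b)))%qT.
Definition univ_mul (a b : univ_cstar) : univ_cstar :=
  (\pi_univ_cstar (cseq_mul (repr a) (repr b)))%qT.
Definition univ_scale k (a : univ_cstar) : univ_cstar :=
  (\pi_univ_cstar (cseq_scale k (repr a)))%qT.
Definition univ_star (a : univ_cstar) : univ_cstar :=
  (\pi_univ_cstar (cseq_star (repr a)))%qT.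
Definition univ_zero : univ_cstar := univ_scale 0 univ_one.
Definition univ_opp : univ_cstar -> univ_cstar := univ_scale (- 1).
Definition univ_norm (a : univ_cstar) : R :=
  sup [set r | exists (B : cstarAlgType R) (rho : X -> B),
    rel rho /\ r = cnorm (univ_hom rho a)].

Section Hom.
Context (B : cstarAlgType R) (rho : X -> B) (rr : rel rho).

Lemma univ_hom1 : univ_hom rho univ_one = 1.
Proof. by rewrite univ_hom_pi //; apply: clim_eq => //; apply: seq_cvg_cst. Qed.

Lemma univ_homD a b :
  univ_hom rho (univ_add a b) = univ_hom rho a + univ_hom rho b.
Proof.
by rewrite univ_hom_pi //; apply: clim_eq => //; apply: seq_cvgD; apply: clim_cvg.
Qed.

Lemma univ_homM a b :
  univ_hom rho (univ_mul a b) = univ_hom rho a * univ_hom rho b.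
Proof.
by rewrite univ_hom_pi //; apply: clim_eq => //; apply: seq_cvgM; apply: clim_cvg.
Qed.

Lemma univ_homZ k a : univ_hom rho (univ_scale k a) = cscale k (univ_hom rho a).
Proof.
by rewrite univ_hom_pi //; apply: clim_eq => //; apply: seq_cvgZ; apply: clim_cvg.
Qed.

Lemma univ_hom_star a : univ_hom rho (univ_star a) = star (univ_hom rho a).
Proof.
by rewrite univ_hom_pi //; apply: clim_eq => //; apply: seq_cvg_star; apply: clim_cvg.
Qed.

Lemma univ_hom0 : univ_hom rho univ_zero = 0.
Proof. by rewrite univ_homZ cscale0l. Qed.

Lemma univ_homN a : univ_hom rho (univ_opp a) = - univ_hom rho a.
Proof. by rewrite univ_homZ cscaleN1. Qed.

End Hom.

Lemma univ_hom_bounded a : exists M : R, forall (B : cstarAlgType R)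
  (rho : X -> B), rel rho -> cnorm (univ_hom rho a) <= M.
Proof.
have [M [N [_ h]]] := cseq_ubounded (repr a).
exists M => B rho rr; apply: (seq_cvg_norm _ (clim_cvg (repr a) rr)).
by exists N => n Nn; apply: h.
Qed.

Lemma univ_norm_ub (B : cstarAlgType R) (rho : X -> B) a :
  rel rho -> cnorm (univ_hom rho a) <= univ_norm a.
Proof.
move=> rr; apply: ub_le_sup; last by exists B, rho.
have [M h] := univ_hom_bounded a.
by exists M => _ [B' [rho' [rr' ->]]]; apply: h.
Qed.

Lemma univ_norm_le a (M : R) : 0 <= M ->
  (forall (B : cstarAlgType R) (rho : X -> B), rel rho ->
     cnorm (univ_hom rho a) <= M) -> univ_norm a <= M.
Proof.
move=> M0 h; rewrite /univ_norm; set S := (X in sup X).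
have [->|/set0P S0] := eqVneq S set0; first by rewrite sup0.
by apply: ge_sup => // _ [B' [rho' [rr' ->]]]; apply: h.
Qed.

Lemma univ_norm_ge0 a : 0 <= univ_norm a.
Proof.
rewrite /univ_norm; set S := (X in sup X).
have [->|/set0P[_ [B [rho [rr _]]]]] := eqVneq S set0; first by rewrite sup0.
by apply: (le_trans (cnorm_ge0 (univ_hom rho a))); apply: univ_norm_ub.
Qed.

Local Ltac univ := move=> *; apply: univ_ext => B rho rr;
  rewrite ?(univ_homD, univ_homM, univ_homZ, univ_hom_star, univ_hom0,
            univ_homN, univ_hom1) //.

Lemma univ_addA : associative univ_add. Proof. by univ; rewrite addrA. Qed.
Lemma univ_addC : commutative univ_add. Proof. by univ; rewrite addrC. Qed.
Lemma univ_add0 : left_id univ_zero univ_add. Proof. by univ; rewrite add0r. Qed.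
Lemma univ_addN : left_inverse univ_zero univ_opp univ_add.
Proof. by univ; rewrite addNr. Qed.

HB.instance Definition _ :=
  GRing.isZmodule.Build univ_cstar univ_addA univ_addC univ_add0 univ_addN.

Lemma univ_mulA : associative univ_mul. Proof. by univ; rewrite mulrA. Qed.
Lemma univ_mul1 : left_id univ_one univ_mul. Proof. by univ; rewrite mul1r. Qed.
Lemma univ_mulr1 : right_id univ_one univ_mul. Proof. by univ; rewrite mulr1. Qed.
Lemma univ_mulDl : left_distributive univ_mul +%R.
Proof. by rewrite /GRing.add /=; univ; rewrite mulrDl. Qed.
Lemma univ_mulDr : right_distributive univ_mul +%R.
Proof. by rewrite /GRing.add /=; univ; rewrite mulrDr. Qed.

HB.instance Definition _ := GRing.Zmodule_isPzRing.Build univ_cstar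
  univ_mulA univ_mul1 univ_mulr1 univ_mulDl univ_mulDr.

Lemma univ_scaleA k l a : univ_scale k (univ_scale l a) = univ_scale (k * l) a.
Proof. by univ; rewrite cscaleA. Qed.
Lemma univ_scale1 a : univ_scale 1 a = a.
Proof. by univ; rewrite cscale1. Qed.
Lemma univ_scaleDr k (a b : univ_cstar) :
  univ_scale k (a + b) = univ_scale k a + univ_scale k b.
Proof. by rewrite /GRing.add /=; univ; rewrite cscaleDr. Qed.
Lemma univ_scaleDl k l a :
  univ_scale (k + l) a = univ_scale k a + univ_scale l a.
Proof. by rewrite [RHS]/GRing.add /=; univ; rewrite cscaleDl. Qed.
Lemma univ_scaleAl k (a b : univ_cstar) :
  univ_scale k (a * b) = univ_scale k a * b.
Proof. by rewrite /GRing.mul /=; univ; rewrite cscaleAl. Qed.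
Lemma univ_scaleAr k (a b : univ_cstar) :
  univ_scale k (a * b) = a * univ_scale k b.
Proof. by rewrite /GRing.mul /=; univ; rewrite cscaleAr. Qed.
Lemma univ_starK a : univ_star (univ_star a) = a.
Proof. by univ; rewrite starK. Qed.
Lemma univ_starD (a b : univ_cstar) :
  univ_star (a + b) = univ_star a + univ_star b.
Proof. by rewrite /GRing.add /=; univ; rewrite starD. Qed.
Lemma univ_starZ k a : univ_star (univ_scale k a) = univ_scale k^* (univ_star a).
Proof. by univ; rewrite starZ. Qed.
Lemma univ_starM (a b : univ_cstar) :
  univ_star (a * b) = univ_star b * univ_star a.
Proof. by rewrite /GRing.mul /=; univ; rewrite starM. Qed.

Lemma univ_norm_eq0 (a : univ_cstar) : univ_norm a = 0 -> a = 0.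
Proof.
move=> a0; rewrite /GRing.zero /=; univ; apply: cnorm_eq0; apply/le_anti.
by rewrite cnorm_ge0 andbT -a0 univ_norm_ub.
Qed.

Lemma univ_normD (a b : univ_cstar) :
  univ_norm (a + b) <= univ_norm a + univ_norm b.
Proof.
apply: univ_norm_le => [|B rho rr]; first by rewrite addr_ge0 ?univ_norm_ge0.
by rewrite univ_homD // (le_trans (cnormD _ _)) // lerD ?univ_norm_ub.
Qed.

Lemma univ_normM (a b : univ_cstar) :
  univ_norm (a * b) <= univ_norm a * univ_norm b.
Proof.
apply: univ_norm_le => [|B rho rr]; first by rewrite mulr_ge0 ?univ_norm_ge0.
rewrite univ_homM // (le_trans (cnormM _ _)) // ler_pM ?univ_norm_ub //;
  exact: cnorm_ge0.
Qed.

Lemma univ_normZ_le k a : univ_norm (univ_scale k a) <= Normc.normc k * univ_norm a.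
Proof.
apply: univ_norm_le => [|B rho rr]; first by rewrite mulr_ge0 ?univ_norm_ge0 ?normc_ge0.
by rewrite univ_homZ // cnormZ ler_wpM2l ?univ_norm_ub // normc_ge0.
Qed.

Lemma univ_normZ k a : univ_norm (univ_scale k a) = Normc.normc k * univ_norm a.
Proof.
apply/le_anti; rewrite univ_normZ_le /=.
have [->|k0] := eqVneq k 0; first by rewrite Normc.normc0 mul0r univ_norm_ge0.
have n0 : 0 < Normc.normc k.
  by rewrite lt0r normc_ge0 andbT; apply: contra_neq k0 => /Normc.eq0_normc.
rewrite -[a in leLHS]univ_scale1 -(mulVf k0) -univ_scaleA.
rewrite -ler_pdivlMl // -Normc.normcV; exact: univ_normZ_le.
Qed.

Lemma univ_normX (a : univ_cstar) : univ_norm (univ_star a * a) = univ_norm a ^+ 2.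
Proof.
apply/le_anti/andP; split.
  apply: univ_norm_le => [|B rho rr]; first by rewrite exprn_ge0 ?univ_norm_ge0.
  rewrite univ_homM // univ_hom_star // cnormX lerXn2r ?univ_norm_ub //;
  by rewrite nnegrE ?cnorm_ge0 ?univ_norm_ge0.
rewrite -[leRHS]sqr_sqrtr ?univ_norm_ge0 // lerXn2r ?nnegrE ?univ_norm_ge0 //.
apply: univ_norm_le => [|B rho rr]; first by rewrite sqrtr_ge0.
rewrite -(ler_pXn2r (_ : 0 < 2)%N) ?nnegrE ?cnorm_ge0 ?sqrtr_ge0 //.
rewrite sqr_sqrtr ?univ_norm_ge0 // -cnormX -univ_hom_star // -univ_homM //.
exact: univ_norm_ub.
Qed.

Lemma univ_hom_approx (a : univ_cstar) (e : R) : 0 < e -> exists t, cbounded t /\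
  forall (B : cstarAlgType R) (rho : X -> B), rel rho ->
    cnorm (univ_hom rho a - ceval rho t) <= e.
Proof.
move=> e0; have [N hN] := cseq_cauchy (repr a) e0.
exists (repr a N); split=> [|B rho rr]; first exact: cseq_bounded.
have h := seq_cvgD (clim_cvg (repr a) rr) (seq_cvg_cst (- ceval rho (repr a N))).
by apply: (seq_cvg_norm _ h); exists N => n Nn; apply: hN.
Qed.

Lemma univ_complete (u : nat -> univ_cstar) :
  (forall e : R, 0 < e -> exists N, forall m n, (N <= m)%N -> (N <= n)%N ->
     univ_norm (u m - u n) <= e) ->
  exists l : univ_cstar, forall e : R, 0 < e -> exists N, forall n, (N <= n)%N ->
     univ_norm (u n - l) <= e.
Proof.
move=> uc.
have homB (B : cstarAlgType R) (rho : X -> B) a b : rel rho ->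
    univ_hom rho (a - b) = univ_hom rho a - univ_hom rho b.
  by move=> rr; rewrite univ_homD // univ_homN.
have archi (e : R) : 0 < e -> exists N, forall n, (N <= n)%N -> n.+1%:R^-1 <= e.
  move=> e0; exists (Num.truncn e^-1) => n Nn.
  rewrite invf_ple ?posrE ?ltr0n //; apply/ltW/(lt_le_trans (truncnS_gt _)).
  by rewrite ler_nat.
have /choice[t ht] : forall n : nat, exists t, cbounded t /\
    forall (B : cstarAlgType R) (rho : X -> B), rel rho ->
      cnorm (univ_hom rho (u n) - ceval rho t) <= n.+1%:R^-1.
  by move=> n; apply: univ_hom_approx; rewrite invr_gt0 ltr0n.
have tc : ucauchy t.
  move=> e e0; have e3 : 0 < e / 3 by rewrite divr_gt0.
  have [N hN] := uc _ e3; have [M hM] := archi _ e3.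
  exists (maxn N M) => m n; rewrite !geq_max => /andP[Nm Mm] /andP[Nn Mn] B rho rr.
  have -> : e = e / 3 + (e / 3 + e / 3) by lra.
  apply: (le_trans (cnorm_tri (univ_hom rho (u m)) _ _)); apply: lerD.
    by rewrite cnorm_dist; apply: (le_trans ((ht m).2 _ _ rr)); apply: hM.
  apply: (le_trans (cnorm_tri (univ_hom rho (u n)) _ _)); apply: lerD.
    by rewrite -homB //; apply: (le_trans (univ_norm_ub _ rr)); apply: hN.
  by apply: (le_trans ((ht n).2 _ _ rr)); apply: hM.
exists (\pi_univ_cstar (CSeq (fun n => (ht n).1) tc)) => e e0.
have e2 : 0 < e / 2 by rewrite divr_gt0.
have [N hN] := tc _ e2; have [M hM] := archi _ e2.
exists (maxn N M) => n; rewrite geq_max => /andP[Nn Mn].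
apply: univ_norm_le => [|B rho rr]; first exact: ltW.
rewrite homB // univ_hom_pi //.
apply: (le_trans (cnorm_tri (ceval rho (t n)) _ _)); rewrite [leRHS]splitr.
apply: lerD; first by apply: (le_trans ((ht n).2 _ _ rr)); apply: hM.
rewrite cnorm_dist.
have h := seq_cvgD (clim_cvg (CSeq (fun n => (ht n).1) tc) rr)
  (seq_cvg_cst (- ceval rho (t n))).
by apply: (seq_cvg_norm _ h); exists N => m Nm; apply: hN.
Qed.

HB.instance Definition _ := isCStarAlgebra.Build R univ_cstar
  univ_scaleA univ_scale1 univ_scaleDr univ_scaleDl univ_scaleAl univ_scaleAr
  univ_starK univ_starD univ_starZ univ_starM univ_norm_eq0 univ_normD
  univ_normZ univ_normM univ_normX univ_complete.

Definition univ_gen (x : X) : univ_cstar :=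
  match pselect (cbounded (CGen x)) with
  | left bx => \pi_univ_cstar (cseq_cst bx)
  | right _ => 0
  end.

Lemma univ_hom_gen (B : cstarAlgType R) (rho : X -> B) x :
  rel rho -> cbounded (CGen x) -> univ_hom rho (univ_gen x) = rho x.
Proof.
move=> rr bx; rewrite /univ_gen; case: pselect => // bx'.
by rewrite univ_hom_pi //; apply: clim_eq => //; apply: seq_cvg_cst.
Qed.

Lemma univ_hom_is_star_hom (B : cstarAlgType R) (rho : X -> B) :
  rel rho -> is_star_hom (univ_hom rho : univ_cstar -> B).
Proof.
move=> rr; split=> *; [exact: univ_homD|exact: univ_homZ|exact: univ_homM|
  exact: univ_hom1|exact: univ_hom_star].
Qed.

End Universal.

Section ContFun.
Context (R : realType) (X : topologicalType) (cX : compact [set: X]).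
Local Notation normc := Normc.normc.

Record cfun (cX : compact [set: X]) := CFun {
  cfun_val :> X -> R[i];
  cfun_cont : continuous (cfun_val : X -> R[i]^o)
}.

Lemma cfunP (f g : cfun cX) : (forall x, f x = g x) -> f = g.
Proof.
case: f g => [f cf] [g cg] /= /funext fg; rewrite fg in cf *.
by congr CFun; exact: Prop_irrelevance.
Qed.

Lemma cont_normcP (f : X -> R[i]) : continuous (f : X -> R[i]^o) <->
  forall x (e : R), 0 < e -> \forall y \near x, normc (f x - f y) < e.
Proof.
have nE (z : R[i]) : `|z : R[i]^o| = (normc z)%:C by [].
split=> [cf x e e0|h x].
  have e0' : 0 < e%:C by rewrite ltcR.
  have /cvgrPdist_lt/(_ _ e0') := cf x.
  by apply: filterS => y; rewrite nE ltcR.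
apply/cvgrPdist_lt => -[a b]; rewrite ltcE /= => /andP[/eqP -> a0].
by apply: filterS (h x a a0) => y; rewrite nE -ltcR.
Qed.

Lemma cfun_near (f : cfun cX) x (e : R) : 0 < e ->
  \forall y \near x, normc (f x - f y) < e.
Proof. exact: (cont_normcP f).1 (@cfun_cont _ f) x e. Qed.

Lemma cfun_cst_cont (k : R[i]) : continuous (cst k : X -> R[i]^o).
Proof. exact: cst_continuous. Qed.

Lemma cfun_add_cont (f g : cfun cX) : continuous ((fun x => f x + g x) : X -> R[i]^o).
Proof.
apply/cont_normcP => x e e0; have e2 : 0 < e / 2 by rewrite divr_gt0.
near=> y; rewrite opprD addrACA (le_lt_trans (le_normcD _ _)) //.
by rewrite [ltRHS]splitr ltrD //; near: y; apply: cfun_near.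
Unshelve. all: by end_near. Qed.

Lemma cfun_scale_cont k (f : cfun cX) : continuous ((fun x => k * f x) : X -> R[i]^o).
Proof.
apply/cont_normcP => x e e0.
have k1 : 0 < normc k + 1 by rewrite ltr_wpDl // normc_ge0.
near=> y; rewrite -mulrBr Normc.normcM.
apply: (@le_lt_trans _ _ ((normc k + 1) * normc (f x - f y))).
  by rewrite ler_wpM2r ?normc_ge0 // lerDl.
by rewrite mulrC -ltr_pdivlMr //; near: y; apply: cfun_near; rewrite divr_gt0.
Unshelve. all: by end_near. Qed.

Lemma cfun_mul_cont (f g : cfun cX) : continuous ((fun x => f x * g x) : X -> R[i]^o).
Proof.
apply/cont_normcP => x e e0.
pose M := normc (f x) + normc (g x) + 1.
have M0 : 0 < M by rewrite ltr_wpDl // addr_ge0 // normc_ge0.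
have e2 : 0 < e / (M + M) by rewrite divr_gt0 // addr_gt0.
near=> y.
have hf : normc (f x - f y) < e / (M + M) by near: y; apply: cfun_near.
have hg : normc (g x - g y) < e / (M + M) by near: y; apply: cfun_near.
have hg1 : normc (g x - g y) < 1 by near: y; apply: cfun_near.
have gM : normc (g y) <= M.
  have -> : g y = g x - (g x - g y) by rewrite opprB addrC subrK.
  rewrite (le_trans (le_normcD _ _)) // normcN /M -addrA.
  by rewrite (le_trans (lerD (lexx _) (ltW hg1))) // lerDr normc_ge0.
have fM : normc (f x) <= M by rewrite /M -addrA lerDl addr_ge0 // normc_ge0.
have -> : f x * g x - f y * g y = (f x - f y) * g y + f x * (g x - g y).
  by rewrite mulrBl mulrBr [RHS]addrC addrA subrK.
rewrite (le_lt_trans (le_normcD _ _)) // !Normc.normcM.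
have -> : e = e / (M + M) * M + M * (e / (M + M)).
  by rewrite [M * _]mulrC -mulrDr divfK // gt_eqF // addr_gt0.
rewrite ltr_leD //.
  rewrite (le_lt_trans (ler_wpM2l (normc_ge0 _) gM)) // ltr_pM2r //.
by rewrite ler_pM ?normc_ge0 // ltW.
Unshelve. all: by end_near. Qed.

Lemma normc_conj (z : R[i]) : normc z^* = normc z.
Proof. by case: z => a b /=; rewrite sqrrN. Qed.

Lemma cfun_star_cont (f : cfun cX) : continuous ((fun x => (f x)^*) : X -> R[i]^o).
Proof.
apply/cont_normcP => x e e0; apply: filterS (cfun_near f x e0) => y.
by rewrite -rmorphB normc_conj.
Qed.

Definition cfun_cst k : cfun cX := CFun cX (@cfun_cst_cont k).
Definition cfun_add f g : cfun cX := CFun cX (@cfun_add_cont f g).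
Definition cfun_mul f g : cfun cX := CFun cX (@cfun_mul_cont f g).
Definition cfun_scale k f : cfun cX := CFun cX (@cfun_scale_cont k f).
Definition cfun_star f : cfun cX := CFun cX (@cfun_star_cont f).
Definition cfun_opp f : cfun cX := cfun_scale (- 1) f.
Definition cfun_norm (f : cfun cX) : R := sup [set normc (f x) | x in [set: X]].

Local Ltac cf := move=> *; apply: cfunP => x /=.

Lemma cfun_addA : associative cfun_add. Proof. by cf; rewrite addrA. Qed.
Lemma cfun_addC : commutative cfun_add. Proof. by cf; rewrite addrC. Qed.
Lemma cfun_add0 : left_id (cfun_cst 0) cfun_add. Proof. by cf; rewrite add0r. Qed.
Lemma cfun_addN : left_inverse (cfun_cst 0) cfun_opp cfun_add.
Proof. by cf; rewrite mulN1r addNr. Qed.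

HB.instance Definition _ := gen_eqMixin (cfun cX).
HB.instance Definition _ := gen_choiceMixin (cfun cX).
HB.instance Definition _ :=
  GRing.isZmodule.Build (cfun cX) cfun_addA cfun_addC cfun_add0 cfun_addN.

Lemma cfun_mulA : associative cfun_mul. Proof. by cf; rewrite mulrA. Qed.
Lemma cfun_mul1 : left_id (cfun_cst 1) cfun_mul. Proof. by cf; rewrite mul1r. Qed.
Lemma cfun_mulr1 : right_id (cfun_cst 1) cfun_mul. Proof. by cf; rewrite mulr1. Qed.
Lemma cfun_mulDl : left_distributive cfun_mul +%R.
Proof. by cf; rewrite mulrDl. Qed.
Lemma cfun_mulDr : right_distributive cfun_mul +%R.
Proof. by cf; rewrite mulrDr. Qed.

HB.instance Definition _ := GRing.Zmodule_isPzRing.Build (cfun cX)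
  cfun_mulA cfun_mul1 cfun_mulr1 cfun_mulDl cfun_mulDr.

Implicit Types f g : cfun cX.

Lemma cfun_scaleA k l f : cfun_scale k (cfun_scale l f) = cfun_scale (k * l) f.
Proof. by cf; rewrite mulrA. Qed.
Lemma cfun_scale1 f : cfun_scale 1 f = f.
Proof. by cf; rewrite mul1r. Qed.
Lemma cfun_scaleDr k f g : cfun_scale k (f + g) = cfun_scale k f + cfun_scale k g.
Proof. by cf; rewrite mulrDr. Qed.
Lemma cfun_scaleDl k l f : cfun_scale (k + l) f = cfun_scale k f + cfun_scale l f.
Proof. by cf; rewrite mulrDl. Qed.
Lemma cfun_scaleAl k f g : cfun_scale k (f * g) = cfun_scale k f * g.
Proof. by cf; rewrite mulrA. Qed.
Lemma cfun_scaleAr k f g : cfun_scale k (f * g) = f * cfun_scale k g.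
Proof. by cf; rewrite mulrCA. Qed.
Lemma cfun_starK f : cfun_star (cfun_star f) = f.
Proof. by cf; rewrite conjcK. Qed.
Lemma cfun_starD f g : cfun_star (f + g) = cfun_star f + cfun_star g.
Proof. by cf; rewrite rmorphD. Qed.
Lemma cfun_starZ k f : cfun_star (cfun_scale k f) = cfun_scale k^* (cfun_star f).
Proof. by cf; rewrite rmorphM. Qed.
Lemma cfun_starM f g : cfun_star (f * g) = cfun_star g * cfun_star f.
Proof. by cf; rewrite rmorphM mulrC. Qed.

Lemma cfun_bounded f : exists M : R, forall x, normc (f x) <= M.
Proof.
have ct : continuous (fun x => normc (f x)).
  move=> x; apply/cvgrPdist_lt => e e0; apply: filterS (cfun_near f x e0) => y.
  apply: le_lt_trans.
  have tri (a b : R[i]) : normc a - normc b <= normc (a - b).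
    by rewrite lerBlDr -[in leLHS](subrK b a) le_normcD.
  rewrite ler_norml tri andbT lerNl opprB (le_trans (tri _ _)) //.
  by rewrite -normcN opprB.
have : compact [set normc (f x) | x in [set: X]].
  by apply: continuous_compact cX; apply: continuous_subspaceT.
move=> /compact_bounded[M [_ /(_ (M + 1))]]; rewrite ltrDl ltr01 => /(_ isT) h.
exists (M + 1) => x; apply: le_trans (h (normc (f x)) _); last by exists x.
by rewrite ler_norm.
Qed.

Lemma cfun_norm_ub f x : normc (f x) <= cfun_norm f.
Proof.
have [M h] := cfun_bounded f.
by apply: ub_le_sup; [exists M => _ [y _ <-]|exists x].
Qed.

Lemma cfun_norm_le f (M : R) : 0 <= M -> (forall x, normc (f x) <= M) ->
  cfun_norm f <= M.
Proof.
move=> M0 h; rewrite /cfun_norm; set S := (X in sup X).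
have [->|/set0P S0] := eqVneq S set0; first by rewrite sup0.
by apply: ge_sup => // _ [x _ <-].
Qed.

Lemma cfun_norm_ge0 f : 0 <= cfun_norm f.
Proof.
rewrite /cfun_norm; set S := (X in sup X).
have [->|/set0P[_ [x _ _]]] := eqVneq S set0; first by rewrite sup0.
by apply: (le_trans (normc_ge0 (f x))); apply: cfun_norm_ub.
Qed.

Lemma cfun_norm_eq0 f : cfun_norm f = 0 -> f = 0.
Proof.
move=> f0; cf; apply/Normc.eq0_normc/le_anti.
by rewrite normc_ge0 andbT -f0 cfun_norm_ub.
Qed.

Lemma cfun_normD f g : cfun_norm (f + g) <= cfun_norm f + cfun_norm g.
Proof.
apply: cfun_norm_le => [|x]; first by rewrite addr_ge0 ?cfun_norm_ge0.
by rewrite (le_trans (le_normcD _ _)) // lerD ?cfun_norm_ub.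
Qed.

Lemma cfun_normM f g : cfun_norm (f * g) <= cfun_norm f * cfun_norm g.
Proof.
apply: cfun_norm_le => [|x]; first by rewrite mulr_ge0 ?cfun_norm_ge0.
by rewrite Normc.normcM ler_pM ?cfun_norm_ub // normc_ge0.
Qed.

Lemma cfun_normZ_le k f : cfun_norm (cfun_scale k f) <= normc k * cfun_norm f.
Proof.
apply: cfun_norm_le => [|x]; first by rewrite mulr_ge0 ?cfun_norm_ge0 ?normc_ge0.
by rewrite Normc.normcM ler_wpM2l ?cfun_norm_ub // normc_ge0.
Qed.

Lemma cfun_normZ k f : cfun_norm (cfun_scale k f) = normc k * cfun_norm f.
Proof.
apply/le_anti; rewrite cfun_normZ_le /=.
have [->|k0] := eqVneq k 0; first by rewrite Normc.normc0 mul0r cfun_norm_ge0.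
have n0 : 0 < normc k.
  by rewrite lt0r normc_ge0 andbT; apply: contra_neq k0 => /Normc.eq0_normc.
rewrite -[f in leLHS]cfun_scale1 -(mulVf k0) -cfun_scaleA.
by rewrite -ler_pdivlMl // -Normc.normcV; exact: cfun_normZ_le.
Qed.

Lemma cfun_normX f : cfun_norm (cfun_star f * f) = cfun_norm f ^+ 2.
Proof.
apply/le_anti/andP; split.
  rewrite (le_trans (cfun_normM _ _)) // expr2 ler_wpM2r ?cfun_norm_ge0 //.
  apply: cfun_norm_le => [|x]; first exact: cfun_norm_ge0.
  by rewrite normc_conj cfun_norm_ub.
rewrite -[leRHS]sqr_sqrtr ?cfun_norm_ge0 // lerXn2r ?nnegrE ?cfun_norm_ge0 //.
apply: cfun_norm_le => [|x]; first by rewrite sqrtr_ge0.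
rewrite -(ler_pXn2r (_ : 0 < 2)%N) ?nnegrE ?normc_ge0 ?sqrtr_ge0 //.
rewrite sqr_sqrtr ?cfun_norm_ge0 // (le_trans _ (cfun_norm_ub _ x)) //=.
by rewrite Normc.normcM normc_conj expr2.
Qed.

Lemma real_complete (u : nat -> R) :
  (forall e : R, 0 < e -> exists N, forall m n, (N <= m)%N -> (N <= n)%N ->
     `|u m - u n| <= e) ->
  exists l : R, forall e : R, 0 < e -> exists N, forall n, (N <= n)%N ->
     `|u n - l| <= e.
Proof.
move=> uc; have /cauchy_cvgP/cvg_ex[/= l /cvgrPdist_le ul] : cauchy (u @ \oo).
  apply: cauchy_exP => e e0; have e2 : 0 < e / 2 by rewrite divr_gt0.
  have [N hN] := uc _ e2.
  exists (u N), N => // n /= Nn; rewrite -ball_normE /=.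
  by rewrite (le_lt_trans (hN _ _ _ _)) // ltr_pdivrMr // ltr_pMr // ltr1n.
exists l => e /ul[N _ hN]; exists N => n Nn; rewrite distrC; exact: hN.
Qed.

Lemma complex_complete (u : nat -> R[i]) :
  (forall e : R, 0 < e -> exists N, forall m n, (N <= m)%N -> (N <= n)%N ->
     normc (u m - u n) <= e) ->
  exists l : R[i], forall e : R, 0 < e -> exists N, forall n, (N <= n)%N ->
     normc (u n - l) <= e.
Proof.
move=> uc.
have ReB (a b : R[i]) : `|complex.Re a - complex.Re b| <= normc (a - b).
  case: a b => [a1 a2] [b1 b2] /=; rewrite -sqrtr_sqr ler_wsqrtr //.
  by rewrite lerDl sqr_ge0.
have ImB (a b : R[i]) : `|complex.Im a - complex.Im b| <= normc (a - b).
  case: a b => [a1 a2] [b1 b2] /=; rewrite -sqrtr_sqr ler_wsqrtr //.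
  by rewrite lerDr sqr_ge0.
have [|lr hr] := @real_complete (fun n => complex.Re (u n)).
  move=> e /uc[N hN]; exists N => m n Nm Nn.
  exact: le_trans (ReB _ _) (hN _ _ Nm Nn).
have [|li hi] := @real_complete (fun n => complex.Im (u n)).
  move=> e /uc[N hN]; exists N => m n Nm Nn.
  exact: le_trans (ImB _ _) (hN _ _ Nm Nn).
exists (lr +i* li) => e e0; have e2 : 0 < e / 2 by rewrite divr_gt0.
have [N hN] := hr _ e2; have [M hM] := hi _ e2.
exists (maxn N M) => n; rewrite geq_max => /andP[/hN h1 /hM h2].
have nRI (z : R[i]) : normc z <= `|complex.Re z| + `|complex.Im z|.
  case: z => a b; have -> : a +i* b = (a +i* 0) + (0 +i* b) by simpc.
  rewrite (le_trans (le_normcD _ _)) //= expr0n /= !addr0 !add0r.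
  by rewrite !sqrtr_sqr.
apply: (le_trans (nRI _)); rewrite [leRHS]splitr.
by case: (u n) h1 h2 => [a b] /= h1 h2; rewrite lerD.
Qed.

Lemma cfun_complete (u : nat -> cfun cX) :
  (forall e : R, 0 < e -> exists N, forall m n, (N <= m)%N -> (N <= n)%N ->
     cfun_norm (u m - u n) <= e) ->
  exists l : cfun cX, forall e : R, 0 < e -> exists N, forall n, (N <= n)%N ->
     cfun_norm (u n - l) <= e.
Proof.
move=> uc.
have uxc x (e : R) : 0 < e -> exists N, forall m n, (N <= m)%N -> (N <= n)%N ->
    normc (u m x - u n x) <= e.
  move=> /uc[N hN]; exists N => m n Nm Nn; apply: le_trans (hN m n Nm Nn).
  by apply: (le_trans _ (cfun_norm_ub (u m - u n) x)); rewrite /= mulN1r.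
have /choice[l hl] : forall x, exists l : R[i], forall e : R, 0 < e ->
    exists N, forall n, (N <= n)%N -> normc (u n x - l) <= e.
  by move=> x; apply: (@complex_complete (fun n => u n x)); exact: uxc.
have unif (e : R) : 0 < e -> exists N, forall n, (N <= n)%N ->
    forall x, normc (u n x - l x) <= e.
  move=> e0; have e2 : 0 < e / 2 by rewrite divr_gt0.
  have [N hN] := uc _ e2; exists N => n Nn x.
  have [K hK] := hl x _ e2; pose m := maxn N K.
  have -> : u n x - l x = (u n x - u m x) + (u m x - l x) by rewrite addrA subrK.
  rewrite (le_trans (le_normcD _ _)) // [leRHS]splitr lerD //.
    apply: le_trans (hN n m Nn (leq_maxl _ _)).
    by apply: (le_trans _ (cfun_norm_ub (u n - u m) x)); rewrite /= mulN1r.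
  by apply: hK; rewrite leq_maxr.
have lc : continuous (l : X -> R[i]^o).
  apply/cont_normcP => x e e0; have e3 : 0 < e / 3 by rewrite divr_gt0.
  have [N /(_ N (leqnn N)) hN] := unif _ e3.
  apply: filterS (cfun_near (u N) x e3) => y hy.
  have -> : l x - l y = (l x - u N x) + ((u N x - u N y) + (u N y - l y)).
    by rewrite !subrKA.
  have -> : e = e / 3 + (e / 3 + e / 3) by lra.
  rewrite (le_lt_trans (le_normcD _ _)) // ler_ltD //; first by rewrite -normcN opprB.
  by rewrite (le_lt_trans (le_normcD _ _)) // ltr_leD.
exists (CFun cX lc) => e e0; have [N hN] := unif e e0.
exists N => n Nn; apply: cfun_norm_le => [|x]; first exact: ltW.
by rewrite /= mulN1r hN.
Qed.

HB.instance Definition _ := isCStarAlgebra.Build R (cfun cX)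
  cfun_scaleA cfun_scale1 cfun_scaleDr cfun_scaleDl cfun_scaleAl cfun_scaleAr
  cfun_starK cfun_starD cfun_starZ cfun_starM cfun_norm_eq0 cfun_normD
  cfun_normZ cfun_normM cfun_normX cfun_complete.

End ContFun.
Arguments cfun R {X} cX.

Record partial_system (R : realType) (A : cstarAlgType R) (H : groupType) :=
PartialSystem {
  pdom : H -> set A;
  pact : H -> A -> A;
  pdom0 : forall h, pdom h 0;
  pdomD : forall h a b, pdom h a -> pdom h b -> pdom h (a + b);
  pdomZ : forall h (k : R[i]) a, pdom h a -> pdom h (cscale k a);
  pdomMl : forall h a b, pdom h b -> pdom h (a * b);
  pdomMr : forall h a b, pdom h a -> pdom h (a * b);
  pdom_closed : forall h, seq_closed (pdom h);
  (* Automatic for closed two-sided ideals. *)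
  pdom_star : forall h a, pdom h a -> pdom h (star a);
  pact_in : forall h a, pdom h^-1%g a -> pdom h (pact h a);
  pact_inj : forall h a b, pdom h^-1%g a -> pdom h^-1%g b ->
    pact h a = pact h b -> a = b;
  pact_surj : forall h b, pdom h b -> exists2 a, pdom h^-1%g a & pact h a = b;
  pactD : forall h a b, pdom h^-1%g a -> pdom h^-1%g b ->
    pact h (a + b) = pact h a + pact h b;
  pactZ : forall h (k : R[i]) a, pdom h^-1%g a ->
    pact h (cscale k a) = cscale k (pact h a);
  pactM : forall h a b, pdom h^-1%g a -> pdom h^-1%g b ->
    pact h (a * b) = pact h a * pact h b;
  pact_star : forall h a, pdom h^-1%g a -> pact h (star a) = star (pact h a);
  pdom1 : pdom 1%g = setT;
  pact1 : forall a, pact 1%g a = a;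
  pact_comp : forall g h a, pdom h^-1%g a -> pdom g^-1%g (pact h a) ->
    pdom (g * h)^-1%g a /\ pact (g * h)%g a = pact g (pact h a)
}.

Section CrossedProduct.
Context (R : realType) (A : cstarAlgType R) (H : groupType).
Variable P : partial_system A H.
Local Notation D := (pdom P).
Local Notation theta := (pact P).

(* The formal sum  \sum_h (f h) delta_h. *)
Record fsum := FSum {
  fsum_coef :> H -> A;
  fsum_in : forall h, D h (fsum_coef h);
  fsum_finite : finite_set [set h | fsum_coef h != 0]
}.

Lemma fsumP (f g : fsum) : (forall h, f h = g h) -> f = g.
Proof.
case: f g => [f fi ff] [g gi gf] /= /funext fg; rewrite fg in fi ff *.
by congr FSum; exact: Prop_irrelevance.
Qed.

Lemma pact0 h : theta h 0 = 0.
Proof.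
apply: (addrI (theta h 0)); rewrite -pactD ?addr0 //; exact: pdom0.
Qed.

Lemma pact_mul_in g k a b : D g a -> D (g^-1 * k)%g b ->
  D k (theta g (theta g^-1%g a * b)).
Proof.
move=> Da Db.
have Dg : D g^-1%g (theta g^-1%g a * b).
  by apply: pdomMr; apply: pact_in; rewrite invgK.
have Dh : D (g^-1 * k)%g (theta g^-1%g a * b) by apply: pdomMl.
have [c Dc Ec] := pact_surj Dh.
have := @pact_comp _ _ _ P g _ _ Dc; rewrite Ec => /(_ Dg).
by rewrite mulVKg => -[D1 <-]; apply: pact_in.
Qed.

Lemma fsum_zero_in h : D h 0. Proof. exact: pdom0. Qed.

Lemma fsum_delta_in (g : H) a : D g a -> forall h : H, D h (if h == g then a else 0).
Proof. by move=> Da h; case: eqP => [->//|_]; exact: pdom0. Qed.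

Lemma fsum_delta_finite (g : H) (a : A) :
  finite_set [set h : H | (if h == g then a else 0) != 0].
Proof.
apply: (@sub_finite_set _ _ [set g]) => // h /=.
by case: (h =P g) => [->//|_]; rewrite eqxx.
Qed.

Definition fsum_delta g a (Da : D g a) : fsum :=
  FSum (fsum_delta_in Da) (fsum_delta_finite g a).

Lemma fsum_one_in : D 1%g 1. Proof. by rewrite pdom1. Qed.

Definition fsum_one : fsum := fsum_delta fsum_one_in.

Lemma fsum_add_finite (f f' : fsum) : finite_set [set h | f h + f' h != 0].
Proof.
apply: (@sub_finite_set _ _ ([set h | f h != 0] `|` [set h | f' h != 0])).
  move=> h /=; have [->|f0 _] := eqVneq (f h) 0; last by left.
  by rewrite add0r => ?; right.
by rewrite finite_setU; split; exact: fsum_finite.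
Qed.

Definition fsum_add (f f' : fsum) : fsum :=
  FSum (fun h => pdomD (fsum_in f h) (fsum_in f' h)) (fsum_add_finite f f').

Lemma fsum_scale_finite k (f : fsum) : finite_set [set h | cscale k (f h) != 0].
Proof.
apply: sub_finite_set (fsum_finite f) => h /=.
by apply: contra_neq => ->; rewrite cscale0r.
Qed.

Definition fsum_scale k (f : fsum) : fsum :=
  FSum (fun h => pdomZ k (fsum_in f h)) (fsum_scale_finite k f).

(* Linear extension of  (a delta_g)^* = theta_{g^-1} (a^* ) delta_{g^-1}. *)
Lemma fsum_star_in (f : fsum) h : D h (theta h (star (f h^-1%g))).
Proof. by apply/pact_in/pdom_star/fsum_in. Qed.

Lemma fsum_star_finite (f : fsum) :
  finite_set [set h | theta h (star (f h^-1%g)) != 0].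
Proof.
apply: (@sub_finite_set _ _ ((fun h : H => h^-1%g) @` [set h | f h != 0])).
  move=> h /= h0; exists h^-1%g; last exact: invgK.
  by apply: contra_neq h0 => ->; rewrite star0 pact0.
exact/finite_image/fsum_finite.
Qed.

Definition fsum_star (f : fsum) : fsum :=
  FSum (fsum_star_in f) (fsum_star_finite f).

(* Bilinear extension of
   (a delta_g) (b delta_h) = theta_g (theta_{g^-1} (a) b) delta_{gh}. *)
Definition fsum_mul_term (f f' : fsum) (k g : H) : A :=
  theta g (theta g^-1%g (f g) * f' (g^-1 * k)%g).

Lemma fsum_mul_term_in (f f' : fsum) k g : D k (fsum_mul_term f f' k g).
Proof. by apply: pact_mul_in; exact: fsum_in. Qed.

Lemma fsum_mul_term_neq0 (f f' : fsum) k g :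
  fsum_mul_term f f' k g != 0 -> f g != 0 /\ f' (g^-1 * k)%g != 0.
Proof.
move=> h0; split; apply: contra_neq h0; rewrite /fsum_mul_term => ->.
  by rewrite pact0 mul0r pact0.
by rewrite mulr0 pact0.
Qed.

Definition fsum_mul_coef (f f' : fsum) (k : H) : A :=
  \sum_(g \in [set: H]) fsum_mul_term f f' k g.

Lemma fsum_mul_in (f f' : fsum) k : D k (fsum_mul_coef f f' k).
Proof.
rewrite /fsum_mul_coef; elim/big_ind: _ => [|a b|g _].
- exact: pdom0.
- exact: pdomD.
- exact: fsum_mul_term_in.
Qed.

Lemma fsum_mul_finite (f f' : fsum) :
  finite_set [set k | fsum_mul_coef f f' k != 0].
Proof.
pose S := [set h | f h != 0]; pose S' := [set h | f' h != 0].
apply: (@sub_finite_set _ _ ((fun p : H * H => (p.1 * p.2)%g) @` (S `*` S'))).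
  move=> k /= k0.
  have [g g0] : exists g, fsum_mul_term f f' k g != 0.
    apply: contrapT => /forallNP h; move/eqP: k0; apply.
    by apply: fsbig1 => g _; apply/eqP/negPn/negP/h.
  have [f0 f'0] := fsum_mul_term_neq0 g0.
  by exists (g, (g^-1 * k)%g) => //=; rewrite mulVKg.
by apply/finite_image/finite_setX; exact: fsum_finite.
Qed.

Definition fsum_mul (f f' : fsum) : fsum :=
  FSum (fsum_mul_in f f') (fsum_mul_finite f f').

Lemma fsum_mul_delta g h a b (Da : D g a) (Db : D h b)
    (Dab : D (g * h)%g (theta g (theta g^-1%g a * b))) :
  fsum_mul (fsum_delta Da) (fsum_delta Db) = fsum_delta Dab.
Proof.
apply: fsumP => k /=; rewrite /fsum_mul_coef.
rewrite -(@fsbig_widen _ _ _ _ [set g]) //; last first.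
  move=> x /= [_ /eqP xg]; rewrite /fsum_mul_term /= (negbTE xg).
  by rewrite pact0 mul0r pact0.
rewrite fsbig_set1 /fsum_mul_term /= eqxx.
have -> : ((g^-1 * k)%g == h) = (k == (g * h)%g).
  by apply/eqP/eqP => [<-|->]; rewrite ?mulVKg ?mulKg.
by case: ifP => // _; rewrite mulr0 pact0.
Qed.

Lemma fsum_star_delta g a (Da : D g a)
    (Da' : D g^-1%g (theta g^-1%g (star a))) :
  fsum_star (fsum_delta Da) = fsum_delta Da'.
Proof.
apply: fsumP => k /=; rewrite (can2_eq invgK invgK).
by case: eqP => [->//|_]; rewrite star0 pact0.
Qed.

Record is_fsum_hom (B : cstarAlgType R) (pi : fsum -> B) : Prop := FSumHom {
  fh_add : forall f f', pi (fsum_add f f') = pi f + pi f';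
  fh_scale : forall (k : R[i]) f, pi (fsum_scale k f) = cscale k (pi f);
  fh_mul : forall f f', pi (fsum_mul f f') = pi f * pi f';
  fh_one : pi fsum_one = 1;
  fh_star : forall f, pi (fsum_star f) = star (pi f)
}.

(* The full crossed product: the enveloping C*-algebra of the *-algebra of
   formal sums. *)
Definition crossed_product : cstarAlgType R := univ_cstar is_fsum_hom.

End CrossedProduct.

(* A word is a sequence of letters; (x, true) stands for the generator x and
   (x, false) for its inverse. *)
Section PresentedGroup.
Variable X : Type.

Definition word : Type := seq (X * bool).
HB.instance Definition _ := gen_eqMixin word.
HB.instance Definition _ := gen_choiceMixin word.

Variable rels : word -> word -> Prop.

Inductive word_cong : word -> word -> Prop :=
  | WCrefl w : word_cong w w
  | WCsym u v : word_cong u v -> word_cong v u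
  | WCtrans v u w : word_cong u v -> word_cong v w -> word_cong u w
  | WCcat u u' v v' : word_cong u u' -> word_cong v v' ->
      word_cong (u ++ v) (u' ++ v')
  | WCinv x b : word_cong [:: (x, b); (x, ~~ b)] [::]
  | WCrel u v : rels u v -> word_cong u v.

Definition word_eq (u v : word) : bool := `[< word_cong u v >].

Lemma word_eq_refl : reflexive word_eq.
Proof. by move=> u; apply/asboolP; exact: WCrefl. Qed.
Lemma word_eq_sym : symmetric word_eq.
Proof. by move=> u v; apply/asboolP/asboolP; exact: WCsym. Qed.
Lemma word_eq_trans : transitive word_eq.
Proof. by move=> v u w /asboolP uv /asboolP vw; apply/asboolP; exact: WCtrans vw. Qed.

Canonical word_equiv := EquivRel word_eq word_eq_refl word_eq_sym word_eq_trans.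

Definition pres_group : Type := {eq_quot word_equiv}.
HB.instance Definition _ := Choice.copy pres_group {eq_quot word_equiv}.
HB.instance Definition _ := EqQuotient.copy pres_group {eq_quot word_equiv}.

Definition winv (w : word) : word := rev [seq (l.1, ~~ l.2) | l <- w].

Lemma winv_cat u v : winv (u ++ v) = winv v ++ winv u.
Proof. by rewrite /winv map_cat rev_cat. Qed.

Lemma winvr w : word_cong (w ++ winv w) [::].
Proof.
elim: w => [|[x b] w IH]; first exact: WCrefl.
rewrite -cat1s winv_cat catA -(catA _ w).
apply: (WCtrans (v := ([:: (x, b)] ++ [::]) ++ winv [:: (x, b)])).
  apply: WCcat; last exact: WCrefl.
  by apply: WCcat; [exact: WCrefl|].
exact: WCinv.
Qed.

Lemma winvK w : winv (winv w) = w.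
Proof.
rewrite /winv map_rev revK -map_comp -[RHS]map_id; apply: eq_map => -[x b] /=.
by rewrite negbK.
Qed.

Lemma winvl w : word_cong (winv w ++ w) [::].
Proof. by rewrite -{2}(winvK w); exact: winvr. Qed.

Lemma winv_cong u v : word_cong u v -> word_cong (winv u) (winv v).
Proof.
move=> uv; apply: (WCtrans (v := winv u ++ (v ++ winv v))).
  rewrite -[X in word_cong X _]cats0; apply: WCcat; first exact: WCrefl.
  by apply: WCsym; exact: winvr.
apply: (WCtrans (v := (winv u ++ u) ++ winv v)).
  rewrite catA; apply: WCcat; last exact: WCrefl.
  by apply: WCcat; [exact: WCrefl|exact: WCsym].
by apply: (WCcat (u' := [::])); [exact: winvl|exact: WCrefl].
Qed.

Definition pg_one : pres_group := \pi_pres_group ([::] : word).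
Definition pg_mul (g h : pres_group) : pres_group :=
  \pi_pres_group (repr g ++ repr h : word).
Definition pg_inv (g : pres_group) : pres_group := \pi_pres_group (winv (repr g)).

Lemma pg_piE (u v : word) :
  word_cong u v -> \pi_pres_group u = \pi_pres_group v.
Proof. by move=> uv; apply/eqquotP/asboolP. Qed.

Lemma pg_reprK (u : word) : word_cong (repr (\pi_pres_group u)) u.
Proof. by apply/asboolP; have /eqquotP := reprK (\pi_pres_group u). Qed.

Lemma pg_mulA : associative pg_mul.
Proof.
move=> a b c; apply: pg_piE.
apply: (WCtrans (v := repr a ++ (repr b ++ repr c))).
  by apply: WCcat; [exact: WCrefl|exact: pg_reprK].
by rewrite catA; apply: WCcat; [apply: WCsym; exact: pg_reprK|exact: WCrefl].
Qed.

Lemma pg_mul1 : left_id pg_one pg_mul.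
Proof.
move=> a; rewrite -[RHS]reprK; apply: pg_piE.
by apply: (WCcat (u' := [::])); [exact: pg_reprK|exact: WCrefl].
Qed.

Lemma pg_mulr1 : right_id pg_one pg_mul.
Proof.
move=> a; rewrite -[RHS]reprK; apply: pg_piE; rewrite -[X in word_cong _ X]cats0.
by apply: WCcat; [exact: WCrefl|exact: pg_reprK].
Qed.

Lemma pg_mulV : left_inverse pg_one pg_inv pg_mul.
Proof.
move=> a; apply: pg_piE; apply: (WCtrans (v := winv (repr a) ++ repr a)).
  by apply: WCcat; [exact: pg_reprK|exact: WCrefl].
exact: winvl.
Qed.

Lemma pg_mulVr : right_inverse pg_one pg_inv pg_mul.
Proof.
move=> a; apply: pg_piE; apply: (WCtrans (v := repr a ++ winv (repr a))).
  by apply: WCcat; [exact: WCrefl|exact: pg_reprK].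
exact: winvr.
Qed.

HB.instance Definition _ := isGroup.Build pres_group
  pg_mulA pg_mul1 pg_mulr1 pg_mulV pg_mulVr.

Definition pg_gen (x : X) : pres_group := \pi_pres_group ([:: (x, true)] : word).

End PresentedGroup.

Section UniversalGroup.
Context (S : Type) (mul : S -> S -> S) (zero : S).

Definition nonzero : Type := {s : S | s <> zero}.

Definition ugroup_rel (u v : word nonzero) : Prop :=
  exists s t st : nonzero, sval st = mul (sval s) (sval t) /\
    u = [:: (s, true); (t, true)] /\ v = [:: (st, true)].

Definition ugroup : groupType := pres_group ugroup_rel.

Definition ugroup_sigma (s : nonzero) : ugroup := pg_gen ugroup_rel s.

End UniversalGroup.

Record digraph := Digraph {
  vert : finType;
  edge : finType;
  rng : edge -> vert;
  dom : edge -> vert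
}.

Definition no_sources (E : digraph) : Prop := forall x : vert E, exists e, rng e = x.
Definition no_sinks (E : digraph) : Prop := forall x : vert E, exists e, dom e = x.

Record self_similar_action (G : groupType) (E : digraph) := SelfSimilarAction {
  actV : G -> vert E -> vert E;
  actE : G -> edge E -> edge E;
  cocycle : G -> edge E -> G;
  actV1 : forall x, actV 1%g x = x;
  actVM : forall g h x, actV (g * h)%g x = actV g (actV h x);
  actE1 : forall e, actE 1%g e = e;
  actEM : forall g h e, actE (g * h)%g e = actE g (actE h e);
  act_rng : forall g e, rng (actE g e) = actV g (rng e);
  act_dom : forall g e, dom (actE g e) = actV g (dom e);
  cocycleM : forall g h e,
    cocycle (g * h)%g e = (cocycle g (actE h e) * cocycle h e)%g;
  cocycle_act : forall g e x, actV (cocycle g e) x = actV g x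
}.

Definition pseudo_free (G : groupType) (E : digraph) (phi : self_similar_action G E)
  : Prop :=
  forall (g : G) (e : edge E), actE phi g e = e -> cocycle phi g e = 1%g -> g = 1%g.

Section Paths.
Variable E : digraph.

(* The finite path  e1 ... en  is encoded as (r(e1), [:: e1; ...; en]), and the
   vertex x, as a path of length 0, as (x, [::]). *)
Definition prepath : Type := (vert E * seq (edge E))%type.

Fixpoint is_path (x : vert E) (s : seq (edge E)) : bool :=
  if s is e :: s' then (rng e == x) && is_path (dom e) s' else true.

Definition path_rng (p : prepath) : vert E := p.1.
Definition path_dom (p : prepath) : vert E := last p.1 [seq dom e | e <- p.2].

Definition path_cat (p q : prepath) : prepath := (p.1, p.2 ++ q.2).

Lemma is_path_cat x s t :
  is_path x (s ++ t) = is_path x s && is_path (path_dom (x, s)) t.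
Proof. by elim: s x => //= e s IH x; rewrite IH andbA. Qed.

Definition inf_path_set : set {ptws nat -> discrete_topology (edge E)} :=
  [set x | forall i, dom (x i) = rng (x i.+1)].

Definition inf_path : Type := set_type inf_path_set.
HB.instance Definition _ := Topological.copy inf_path (set_type inf_path_set).

Definition inf_edge (x : inf_path) : nat -> edge E := sval x.

Definition inf_rng (x : inf_path) : vert E := rng (inf_edge x 0).

Definition cat_inf (p : prepath) (x : nat -> edge E) : nat -> edge E :=
  fun n => if (n < size p.2)%N then nth (x 0) p.2 n else x (n - size p.2)%N.

Definition cylinder (p : prepath) : set inf_path :=
  [set xi | exists x : inf_path,
     inf_rng x = path_dom p /\ inf_edge xi =1 cat_inf p (inf_edge x)].

End Paths.

Lemma compact_inf_path (E : digraph) : compact [set: inf_path E].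
Proof.
pose K := fun _ : nat => discrete_topology (edge E).
have cK : compact [set: prod_topology K].
  have -> : [set: prod_topology K] = [set f | forall i, [set: K i] (f i)].
    by apply/seteqP; split.
  apply: (@tychonoff nat K (fun=> setT)) => i.
  exact/finite_compact/(@finite_finset (edge E)).
have clS : closed (@inf_path_set E : set (prod_topology K)).
  move=> x xS i; have cvx j : \forall y \near x, y j = x j.
    exact: (@proj_continuous nat K j x _ (discrete_set1 (x j))).
  have [y [Sy [<- <-]]] := xS _ (filterI (cvx i) (cvx i.+1)).
  exact: Sy.
have cS : compact (@inf_path_set E : set (prod_topology K)).
  exact: subclosed_compact clS cK (fun _ _ => I).
move=> F FF _.
have FS : (sval @ F) (@inf_path_set E).
  by apply: (@filterS _ F _ setT) filterT => y _; exact/set_mem/(svalP y).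
have [x [Sx clx]] := cS (sval @ F) _ FS.
exists (exist _ x (mem_set Sx)); split=> // A B FA.
move=> /= [B' [[U oU <-] Ux UB]].
have FA' : (sval @ F) (sval @` A) by apply: (@filterS _ F _ A) FA => y Ay; exists y.
have [_ [[y Ay <-] Uy]] := clx _ U FA' (open_nbhs_nbhs (conj oU Ux)).
by exists y; split=> //; apply: UB.
Qed.

Section SelfSimilar.
Context (G : groupType) (E : digraph) (phi : self_similar_action G E).
Local Notation prepath := (prepath E).
Local Notation inf_path := (inf_path E).

Fixpoint act_seq (g : G) (s : seq (edge E)) : seq (edge E) :=
  if s is e :: s' then actE phi g e :: act_seq (cocycle phi g e) s' else [::].

Fixpoint cocycle_seq (g : G) (s : seq (edge E)) : G :=
  if s is e :: s' then cocycle_seq (cocycle phi g e) s' else g.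

Definition act_path (g : G) (p : prepath) : prepath :=
  (actV phi g p.1, act_seq g p.2).

Definition cocycle_path (g : G) (p : prepath) : G := cocycle_seq g p.2.

Lemma cocycle_seq_act g s x : actV phi (cocycle_seq g s) x = actV phi g x.
Proof. by elim: s g => //= e s IH g; rewrite IH cocycle_act. Qed.

Lemma is_path_act g h x s : actV phi g =1 actV phi h -> is_path x s ->
  is_path (actV phi h x) (act_seq g s).
Proof.
elim: s g h x => //= e s IH g h x gh /andP[/eqP <- es].
rewrite act_rng gh eqxx act_dom gh /=; apply: IH => // y.
by rewrite cocycle_act gh.
Qed.

Lemma path_dom_act g p : path_dom (act_path g p) = actV phi g (path_dom p).
Proof.
case: p => x s; rewrite /path_dom /=.
suff h k : actV phi g =1 actV phi k -> last (actV phi k x) [seq dom e | e <- act_seq g s] =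
  actV phi k (last x [seq dom e | e <- s]) by exact: h.
elim: s g k x => //= e s IH g k x gk.
rewrite act_dom gk; apply: IH => y; by rewrite cocycle_act gk.
Qed.

Definition pretriple : Type := (prepath * G * prepath)%type.

Definition triple_ok (t : pretriple) : bool :=
  let: (a, g, b) := t in
  [&& is_path a.1 a.2, is_path b.1 b.2 & path_dom a == actV phi g (path_dom b)].

Record triple := Triple { triple_val :> pretriple; _ : triple_ok triple_val }.
HB.instance Definition _ := [isSub for triple_val].

Definition tleft (s : triple) : prepath := (val s).1.1.
Definition tmid (s : triple) : G := (val s).1.2.
Definition tright (s : triple) : prepath := (val s).2.

(* [path_divide b c] is Some c' when c = b c', and None when c is not of this
   form. *)
Definition path_divide (b c : prepath) : option prepath :=
  if (b.1 == c.1) && prefix b.2 c.2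
  then Some (path_dom b, drop (size b.2) c.2) else None.

Definition triple_mul_val (s t : pretriple) : option pretriple :=
  let: (a, g, b) := s in let: (c, h, n) := t in
  if path_divide b c is Some c' then
    Some (path_cat a (act_path g c'), cocycle_path g c' * h, n)%g
  else if path_divide c b is Some b' then
    Some (a, g * (cocycle_path h^-1 b')^-1, path_cat n (act_path h^-1 b'))%g
  else None.

(* None is the zero element. *)
Definition sge : Type := option triple.

Definition sge_mul (s t : sge) : sge :=
  if s is Some s then if t is Some t then
    obind insub (triple_mul_val (val s) (val t)) else None else None.

Lemma triple_mul_ok (s t : triple) :
  if triple_mul_val (val s) (val t) is Some u then triple_ok u else true.
Proof.
have divP b c c' : is_path c.1 c.2 -> path_divide b c = Some c' ->
    [/\ c'.1 = path_dom b, is_path c'.1 c'.2 & path_dom c' = path_dom c].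
  case: b c => [x s1] [y s2]; rewrite /path_divide /= => s2ok.
  case: andP => // -[/eqP xy /prefixP[s3 s23]] [<-] /=.
  rewrite s23 drop_size_cat //; split=> //.
    by move: s2ok; rewrite -xy s23 is_path_cat => /andP[].
  by rewrite -xy /path_dom /= map_cat last_cat.
move: (valP s) (valP t); move: (val s) (val t) => [[a g] b] [[c h] n].
move=> /and3P[aok bok /eqP ab] /and3P[cok nok /eqP cn]; rewrite /triple_mul_val.
have catok (p q : prepath) : is_path p.1 p.2 -> is_path (path_dom p) q.2 ->
    is_path (path_cat p q).1 (path_cat p q).2.
  by case: p => x w; rewrite /= is_path_cat => -> ->.
have catdom (p q : prepath) : q.1 = path_dom p -> path_dom (path_cat p q) = path_dom q.
  by rewrite /path_dom /= map_cat last_cat => ->.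
case cb: (path_divide b c) => [c'|].
  have [c'1 c'ok c'd] := divP _ _ _ cok cb.
  rewrite /triple_ok nok catdom /=; last by rewrite c'1.
  rewrite path_dom_act c'd cn actVM cocycle_seq_act eqxx andbT.
  by apply: (catok a (act_path g c')) => //; rewrite ab -c'1; apply: is_path_act.
case bc: (path_divide c b) => [b'|//].
have [b'1 b'ok b'd] := divP _ _ _ bok bc.
have nE : path_dom n = actV phi h^-1%g (path_dom c).
  by rewrite cn -actVM mulVg actV1.
rewrite /triple_ok aok catdom /=; last by rewrite b'1.
apply/andP; split.
  by apply: (catok n (act_path h^-1%g b')) => //; rewrite nE -b'1; apply: is_path_act.
rewrite path_dom_act b'd ab actVM -(cocycle_seq_act h^-1%g b'.2).
by rewrite -(actVM phi (cocycle_path h^-1 b')^-1%g) mulVg actV1.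
Qed.

(* [insub] never rejects a product. *)
Lemma sge_mulE (s t : triple) :
  omap val (sge_mul (Some s) (Some t)) = triple_mul_val (val s) (val t).
Proof.
rewrite /sge_mul; have := triple_mul_ok s t.
by case: triple_mul_val => //= u uok; rewrite insubT.
Qed.

Definition sge_group : groupType := ugroup sge_mul None.

Lemma triple_neq0 (s : triple) : Some s <> None. Proof. by []. Qed.

Definition sge_sigma (s : triple) : sge_group :=
  ugroup_sigma sge_mul (exist _ (Some s) (@triple_neq0 s)).

Definition act_inf (g : G) (x : nat -> edge E) : nat -> edge E :=
  fun n => actE phi (cocycle_seq g (mkseq x n)) (x n).

(* The graph of theta_s : beta Sigma -> alpha Sigma,  beta x |-> alpha (k x),
   for s = (alpha, k, beta). *)
Definition theta_graph (s : triple) (xi eta : inf_path) : Prop :=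
  exists x : inf_path, [/\ inf_rng x = path_dom (tright s),
    inf_edge xi =1 cat_inf (tright s) (inf_edge x) &
    inf_edge eta =1 cat_inf (tleft s) (act_inf (tmid s) (inf_edge x))].

Definition Fset (g : sge_group) : set inf_path :=
  \bigcup_(s in [set s | sge_sigma s = g]) cylinder (tleft s).

(* The values outside F_{g^-1} are irrelevant. *)
Definition theta (g : sge_group) (xi : inf_path) : inf_path :=
  xget xi [set eta | exists s, sge_sigma s = g /\ theta_graph s xi eta].

Definition theta_inv (g : sge_group) (eta : inf_path) : inf_path :=
  xget eta [set xi | Fset g^-1%g xi /\ theta g xi = eta].

Definition theta_tilde (R : realType) (g : sge_group) (f : inf_path -> R[i])
    (x : inf_path) : R[i] :=
  if `[< Fset g x >] then f (theta_inv g x) else 0.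

(* [P] is the partial action of the universal group on the C*-algebra of
   continuous functions: D_g = C_0(F_g) and theta~_g(f) = f o theta_g^-1, on
   C_0(F_{g^-1}).  Outside its domain [pact P g] is arbitrary. *)
Definition is_canonical_partial_action (R : realType)
    (P : partial_system (cfun R (compact_inf_path (E := E))) sge_group) : Prop :=
  (forall g, pdom P g = [set f | forall x, ~ Fset g x -> f x = 0]) /\
  (forall g f, pdom P g^-1%g f -> pact P g f =1 theta_tilde g f).

Inductive oge_gen := GenP of vert E | GenS of edge E | GenU of G.

(* Since the graph is finite, the graph C*-algebra has the unit \sum_x p_x, and
   the unitarity of u refers to this unit: hence the relation [oge_unit].
   It must be stated, as the other relations are also satisfied by p = 0, s = 0
   and any unitary representation u in any unital C*-algebra, so that they do
   not imply it. *)
Record oge_rel (R : realType) (B : cstarAlgType R) (rho : oge_gen -> B) : Prop :=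
OgeRel {
  oge_p_star : forall x, star (rho (GenP x)) = rho (GenP x);
  oge_p_idem : forall x, rho (GenP x) * rho (GenP x) = rho (GenP x);
  oge_p_orth : forall x y, x != y -> rho (GenP x) * rho (GenP y) = 0;
  oge_s_piso : forall e,
    rho (GenS e) * star (rho (GenS e)) * rho (GenS e) = rho (GenS e);
  oge_ss : forall e, star (rho (GenS e)) * rho (GenS e) = rho (GenP (dom e));
  oge_ck : forall x, (0 < #|[set e | rng e == x]%SET|)%N -> rho (GenP x) =
    \sum_(e | rng e == x) rho (GenS e) * star (rho (GenS e));
  oge_unit : \sum_x rho (GenP x) = 1;
  oge_u1 : rho (GenU 1%g) = 1;
  oge_uM : forall g h, rho (GenU (g * h)%g) = rho (GenU g) * rho (GenU h);
  oge_u_isom : forall g, star (rho (GenU g)) * rho (GenU g) = 1;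
  oge_u_coisom : forall g, rho (GenU g) * star (rho (GenU g)) = 1;
  oge_us : forall g e, rho (GenU g) * rho (GenS e) =
    rho (GenS (actE phi g e)) * rho (GenU (cocycle phi g e));
  oge_up : forall g x, rho (GenU g) * rho (GenP x) =
    rho (GenP (actV phi g x)) * rho (GenU g)
}.

Definition oge (R : realType) : cstarAlgType R := univ_cstar (@oge_rel R).

Section OgeGenerators.
Context (R : realType).
Local Notation rel := (@oge_rel R).
Local Notation gen := (@univ_gen R oge_gen rel).

Lemma oge_gen_bounded (t : oge_gen) : cbounded rel (CGen t).
Proof.
have le1 (B : cstarAlgType R) (p : B) : star p = p -> p * p = p -> cnorm p <= 1.
  move=> ps pp; have := cnormX p; rewrite ps pp => h.
  have [->|n0] := eqVneq (cnorm p) 0; first exact: ler01.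
  by rewrite -(ler_pM2r (_ : 0 < cnorm p)) ?mul1r -?expr2 -?h // lt0r n0 cnorm_ge0.
have sq1 (B : cstarAlgType R) (a : B) : cnorm (star a * a) <= 1 -> cnorm a <= 1.
  by rewrite cnormX expr_le1 // cnorm_ge0.
exists 1 => B rho rr /=; case: t => [x|e|g].
- exact: le1 (oge_p_star rr x) (oge_p_idem rr x).
- by apply: sq1; rewrite (oge_ss rr); exact: le1 (oge_p_star rr _) (oge_p_idem rr _).
- by apply: sq1; rewrite (oge_u_isom rr); apply: le1; rewrite ?star1 ?mulr1.
Qed.

Lemma oge_gen_rel : oge_rel (gen : oge_gen -> oge R).
Proof.
have genE (B : cstarAlgType R) (rho : oge_gen -> B) t :
    rel rho -> univ_hom rho (gen t) = rho t.
  by move=> rr; apply: univ_hom_gen => //; exact: oge_gen_bounded.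
have hS (B : cstarAlgType R) (rho : oge_gen -> B) (I : finType) (Q : pred I)
    (F : I -> oge R) : rel rho ->
    univ_hom rho (\sum_(i | Q i) F i) = \sum_(i | Q i) univ_hom rho (F i).
  move=> rr; apply: (big_morph (univ_hom rho)) => [a b|]; last exact: univ_hom0.
  exact: univ_homD.
split=> *; apply: univ_ext => B rho rr; have sh := univ_hom_is_star_hom rr;
  rewrite ?hS // ?(sh_mul sh, sh_star sh, sh_one sh, genE) //.
- exact: (oge_p_star rr).
- exact: (oge_p_idem rr).
- by rewrite (oge_p_orth rr) // univ_hom0.
- exact: (oge_s_piso rr).
- exact: (oge_ss rr).
- rewrite (oge_ck rr) //; apply: eq_bigr => e _.
  by rewrite (sh_mul sh) (sh_star sh) genE.
- by rewrite -(oge_unit rr); apply: eq_bigr => x _; rewrite genE.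
- exact: (oge_u1 rr).
- exact: (oge_uM rr).
- exact: (oge_u_isom rr).
- exact: (oge_u_coisom rr).
- exact: (oge_us rr).
- exact: (oge_up rr).
Qed.

End OgeGenerators.

End SelfSimilar.

(* Main.v *)
From mathcomp Require Import all_boot all_order all_algebra finmap.
From mathcomp Require Import complex ring lra.
From mathcomp Require Import all_classical all_reals all_analysis.
Require Import Defs.
Set Implicit Arguments.
Unset Strict Implicit.
Unset Printing Implicit Defensive.
Import Order.TTheory GRing.Theory Num.Theory.
Import numFieldNormedType.Exports.
Local Open Scope classical_set_scope.
Local Open Scope ring_scope.
Local Open Scope complex_scope.
Local Open Scope quotient_scope.

(** Both algebras are governed by the same objects, the tight representations of
    the inverse semigroup: families [w_s] with [w_s w_t = w_(st)],
    [w_(s^* ) = (w_s)^*], [\sum_x w_(x,1,x) = 1] and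
    [w_(a,1,a) = \sum_e w_(ae,1,ae)].

    The point where pseudo-freeness is used is that [sigma s = 1] only for
    idempotent [s].  The monoid of pairs (word, group element) with
    [g e = (g e) phi(g, e)] acts freely on itself; enlarging it by countably many
    copies of [G], the left multiplications by edges extend to permutations
    compatible with [G], because two free [G]-sets with countably many orbits over
    each orbit of edges are isomorphic.  These permutations give a homomorphism of
    the universal group that separates the elements of the monoid.  Hence [s] is
    determined by [sigma s] and its left path.

    A tight representation [w] extends to [C_0(F_g) delta_g] by
    [a delta_g |-> lim_n \sum_(|p| = n) a(xi_p) w_(s(g, p))], where [xi_p] is a point
    of the cylinder of [p] and [s(g, p)] the triple with image [g] and left path
    [p]; the sum is orthogonal, so that the map is contractive, and its
    multiplicativity need only be checked on indicators of cylinders.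

    No spectral theory is used.  Projections with sum [1] are orthogonal because
    the unit of a corner is an extreme point of its unit ball, and *-homomorphisms
    on [C(X)] are contractive because a real function of norm at most [1] is the
    average of two unitary functions. *)

(** * Faithfulness of the universal group *)

(** A homomorphism out of the universal group must send every triple to something invertible, while
    triples act on paths only partially. Left multiplication by an edge is injective on words but
    misses the words that start differently; the complement of its range has to be filled without
    destroying [g e = (g e) phi(g, e)], which forces the extension to be equivariant over the action
    on edges. Two further obstacles come from the universal algebras. [univ_gen] is 0 on a generator
    with no bound uniform in all representations, so every formal sum must be bounded before
    anything can be said of its image; the fibre over 1 is a copy of C(X), and the C*-identity
    reduces the other fibres to it. And [oge_rel] leaves the orthogonality of the ranges of distinct
    [s_e] implicit in the Cuntz-Krieger sums, although triples with incomparable paths must multiply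
    to 0. Finally, [F_g] is open but possibly not compact, so that elements of a fibre are only
    limits of combinations of indicators of cylinders; this is why the algebraic identities are
    accompanied by norm estimates. *)

Record ample_free_action (G : groupType) (J X : Type) (aI : G -> J -> J)
    (a : G -> X -> X) (p : X -> J) : Prop := AmpleFreeAction {
  afa1 : forall x, a 1%g x = x;
  afaM : forall g h x, a (g * h)%g x = a g (a h x);
  afa_free : forall g x, a g x = x -> g = 1%g;
  afa_over : forall g x, p (a g x) = aI g (p x);
  afa_countable : countable [set: X];
  afa_infinite : forall i, exists f : nat -> X,
    (forall n, p (f n) = i) /\ (forall m n g, a g (f m) = f n -> m = n)
}.

Section AmpleFreeAction.
Context (G : groupType) (J : choiceType) (aI : G -> J -> J).
Hypotheses (aI1 : forall i, aI 1%g i = i)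
  (aIM : forall g h i, aI (g * h)%g i = aI g (aI h i)).

Let c i := xget i [set j | exists g, aI g j = i].

Lemma orbit_rep_orbit i : exists g, aI g (c i) = i.
Proof.
by rewrite /c; case: xgetP => [_ _ //|/(_ i)[]]; exists 1%g; exact: aI1.
Qed.

(** The two defining sets coincide, and [xget] consults its default, which differs on the two sides,
    only for an empty set; an orbit never is. *)
Lemma orbit_rep_act g i : c (aI g i) = c i.
Proof.
have e : [set j | exists h, aI h j = aI g i] = [set j | exists h, aI h j = i].
  apply/seteqP; split=> j [h hj] /=; last by exists (g * h)%g; rewrite aIM hj.
  by exists (g^-1 * h)%g; rewrite aIM hj -aIM mulVg aI1.
rewrite /c e; have ex : exists j, `[<[set j | exists h, aI h j = i] j>].
  by exists i; apply/asboolP; exists 1%g; exact: aI1.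
by rewrite /xget; case: pselect.
Qed.

Lemma orbit_repK i : c (c i) = c i.
Proof. by have [g {2}<-] := orbit_rep_orbit i; rewrite orbit_rep_act. Qed.

(** Coordinates on [X]: each point is [a g (s i n)] for exactly one orbit representative [i] of [J],
    one index [n] of a [G]-orbit of [X] lying over it, and one [g]. The uniqueness of [g] is
    freeness. *)
Lemma ample_section (X : choiceType) (a : G -> X -> X) (p : X -> J) :
  ample_free_action aI a p -> exists s : J -> nat -> X,
    [/\ forall i n, c i = i -> p (s i n) = i,
        forall x, exists g n, a g (s (c (p x)) n) = x &
        forall i m n g h, c i = i -> a g (s i m) = a h (s i n) -> m = n /\ g = h].
Proof.
move=> [a1 aM afree ap acount ainf].
have aK g x y : a g x = y -> a g^-1%g y = x by move=> <-; rewrite -aM mulVg a1.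
(* [r x] is a point of the orbit of [x] chosen over the representative [c (p x)]; as [Q] is constant
   on orbits, so is [r]. *)
pose Q x := [set y | (exists g, a g y = x) /\ p y = c (p x)].
pose r x := xget x (Q x).
have Qr x : Q x (r x).
  rewrite /r; case: xgetP => // h; have [g gx] := orbit_rep_orbit (p x).
  case: (h (a g^-1%g x)); split.
    by exists g; rewrite -aM mulgV a1.
  by rewrite ap -[p x in LHS]gx -aIM mulVg aI1.
have ra g x : r (a g x) = r x.
  have e : Q (a g x) = Q x.
    rewrite /Q ap orbit_rep_act; apply/seteqP; split=> y [[h hy] py] /=; split=> //.
      by exists (g^-1 * h)%g; rewrite aM hy -aM mulVg a1.
    by exists (g * h)%g; rewrite aM hy.
  have := Qr x; rewrite /r e /xget; case: pselect => // n _; case: n.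
  by exists (r x); apply/asboolP.
have rK x : r (r x) = r x by have [[g e] _] := Qr x; have := ra g (r x); rewrite e.
pose A i := [set x | r x = x /\ p x = i].
(* [A i] holds one point of each orbit over [i]: it is countable inside [X], and infinite because
   the orbits of the points [f n] are distinct. *)
have cardA i : c i = i -> ([set: nat] #= A i)%card.
  move=> ci; rewrite card_eq_sym; apply: eq_card_nat.
    exact: sub_countable (subset_card_le (@subsetT _ _)) acount.
  apply/infiniteP; have [f [pf fi]] := ainf i.
  have h n : A i (r (f n)).
    by split; [exact: rK|have [_ ->] := Qr (f n); rewrite pf ci].
  have [F] : $|{injfun [set: nat] >-> A i}|; last exact: inj_card_le F.
  apply/injfunPex; exists (r \o f) => [n _|m n _ _ /= e]; first exact: h.
  have [[g gm] _] := Qr (f m); have [[k kn] _] := Qr (f n).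
  by apply: (fi m n (k * g^-1)%g); rewrite aM (aK _ _ _ gm) e.
have /choice[s hs] : forall i, exists s : nat -> X,
    c i = i -> set_bij [set: nat] (A i) s.
  move=> i; have [ci|] := eqVneq (c i) i; last first.
    have [f _] := ainf i; by exists f => e; move: i0; rewrite e eqxx.
  have /card_bijP[f fb] := cardA i ci.
  pose s n : X := val (f (SigSub (mem_set (I : [set: nat] n)))).
  exists s => _; split=> [n _|m n _ _ /val_inj /(bij_inj fb) []//|x Ax].
    exact: set_valP.
  have [g fK gK] := fb; exists (val (g (SigSub (mem_set Ax)))) => //.
  rewrite /s; set u := SigSub _; have -> : u = g (SigSub (mem_set Ax)) by exact: val_inj.
  by rewrite gK.
exists s; split=> [i n ci|x|i m n g h ci].
- by have [/(_ n I)[]] := hs i ci.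
- have [[g gr] pr] := Qr x; have [_ _ ss] := hs (c (p x)) (orbit_repK _).
  by have [|n _ sn] := ss (r x); [split|exists g, n; rewrite sn].
- have [sA si _] := hs i ci; move=> e.
  have [r1 _] := sA m I; have [r2 _] := sA n I.
  have smn : s i m = s i n by rewrite -r1 -r2 -(ra g) e ra.
  split; first by apply: si; rewrite ?in_setT.
  apply/eqP; rewrite eq_sym -divg_eq1 -eqg_inv invg1 invgF.
  by apply/eqP/(afree _ (a h (s i n))); rewrite -aM mulgVK -{1}smn e.
Qed.

(** Both sets are copies of orbit representatives times [nat] times [G], and points with equal
    coordinates are matched; [G] acts on the last coordinate by left multiplication, whence
    equivariance. *)
Lemma ample_free_bijection (X Y : choiceType) (aX : G -> X -> X) (p : X -> J)
    (aY : G -> Y -> Y) (q : Y -> J) :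
  ample_free_action aI aX p -> ample_free_action aI aY q ->
  exists (F : X -> Y) (F' : Y -> X), [/\ cancel F F', cancel F' F,
    forall g x, F (aX g x) = aY g (F x) & forall x, q (F x) = p x].
Proof.
move=> hX hY; have [s [ps sx si]] := ample_section hX.
have [t [qt ty ti]] := ample_section hY.
pose Rel x y := exists i n g, [/\ c i = i, x = aX g (s i n) & y = aY g (t i n)].
have pR i n g : c i = i -> c (p (aX g (s i n))) = i.
  by move=> ci; rewrite (afa_over hX) orbit_rep_act ps.
have qR i n g : c i = i -> c (q (aY g (t i n))) = i.
  by move=> ci; rewrite (afa_over hY) orbit_rep_act qt.
have /choice[F hF] : forall x, exists y, Rel x y.
  move=> x; have [g [n e]] := sx x; exists (aY g (t (c (p x)) n)).
  by exists (c (p x)), n, g; split=> //; exact: orbit_repK.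
have /choice[F' hF'] : forall y, exists x, Rel x y.
  move=> y; have [g [n e]] := ty y; exists (aX g (s (c (q y)) n)).
  by exists (c (q y)), n, g; split=> //; exact: orbit_repK.
have Rr x y y' : Rel x y -> Rel x y' -> y = y'.
  move=> [i [n [g [ci -> ->]]]] [j [m [h [cj e ->]]]].
  have ij : i = j by rewrite -(pR i n g ci) e pR.
  by subst j; have [-> ->] := si _ _ _ _ _ ci e.
have Rl x x' y : Rel x y -> Rel x' y -> x = x'.
  move=> [i [n [g [ci -> ->]]]] [j [m [h [cj -> e]]]].
  have ij : i = j by rewrite -(qR i n g ci) e qR.
  by subst j; have [-> ->] := ti _ _ _ _ _ ci e.
exists F, F'; split=> [x|y|g x|x].
- exact: Rl (hF' _) (hF _).
- exact: Rr (hF _) (hF' _).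
- apply: Rr (hF _) _; have [i [n [h [ci -> ->]]]] := hF x.
  by exists i, n, (g * h)%g; split=> //; rewrite ?(afaM hX) ?(afaM hY).
- have [i [n [h [ci -> ->]]]] := hF x.
  by rewrite (afa_over hX) (afa_over hY) ps // qt.
Qed.

End AmpleFreeAction.

(** * Triples with trivial image in the universal group *)

Section IdempotentPure.
Context (G : groupType) (E : digraph) (phi : self_similar_action G E).
Local Notation edge := (edge E).

Lemma cocycle1 e : cocycle phi 1%g e = 1%g.
Proof.
have := cocycleM phi 1%g 1%g e; rewrite mulg1 actE1 => h.
by apply: (@mulgI _ (cocycle phi 1%g e)); rewrite mulg1.
Qed.

Lemma act_seq1 w : act_seq phi 1%g w = w.
Proof. by elim: w => //= e w IH; rewrite actE1 cocycle1 IH. Qed.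

Lemma cocycle_seq1 w : cocycle_seq phi 1%g w = 1%g.
Proof. by elim: w => //= e w IH; rewrite cocycle1. Qed.

Lemma act_seqM g h w : act_seq phi (g * h)%g w = act_seq phi g (act_seq phi h w).
Proof. by elim: w g h => //= e w IH g h; rewrite actEM cocycleM IH. Qed.

Lemma cocycle_seqM g h w : cocycle_seq phi (g * h)%g w =
  (cocycle_seq phi g (act_seq phi h w) * cocycle_seq phi h w)%g.
Proof. by elim: w g h => //= e w IH g h; rewrite cocycleM IH. Qed.

Hypothesis pf : pseudo_free phi.

Lemma pseudo_free_seq g w :
  act_seq phi g w = w -> cocycle_seq phi g w = 1%g -> g = 1%g.
Proof.
by elim: w g => //= e w IH g [ge gw] /(IH _ gw); exact: pf ge.
Qed.

Hypothesis Gcount : countable [set: G].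

(* The monoid of the pairs (w, g), in which g e = (g e) phi(g, e), acts
   faithfully on its copy [inl]; the copies [inr] leave room for extending the
   left multiplications by edges to permutations. *)
Let W : choiceType := ((seq edge * G) + (G * nat))%type.

Let actW g (z : W) : W := match z with
  | inl (w, h) => inl (act_seq phi g w, cocycle_seq phi g w * h)%g
  | inr (h, n) => inr (g * h, n)%g
  end.

Lemma actW1 z : actW 1%g z = z.
Proof. by case: z => -[w h] /=; rewrite ?act_seq1 ?cocycle_seq1 mul1g. Qed.

Lemma actWM g h z : actW (g * h)%g z = actW g (actW h z).
Proof. by case: z => -[w k] /=; rewrite ?act_seqM ?cocycle_seqM mulgA. Qed.

Lemma actW_free g z : actW g z = z -> g = 1%g.
Proof.
case: z => [[w h]|[h n]] /= [].
  move=> gw /(congr1 (fun k => k * h^-1)%g); rewrite mulgK mulgV.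
  exact: pseudo_free_seq.
by move=> /(congr1 (fun k => k * h^-1)%g); rewrite mulgK mulgV.
Qed.

(** The extra points, labelled by the edge [e] whose multiplication is still to be defined on them;
    the cocycle in the action is what the rule for [g e] prescribes. *)
Let X : choiceType := (edge * (G * nat))%type.
Let actX g (x : X) : X :=
  (actE phi g x.1, (cocycle phi g x.1 * x.2.1, x.2.2)%g).

Let starts (e : edge) (z : W) : bool :=
  if z is inl (f :: _, _) then f == e else false.
(** The fibre over [e] is the complement of the words starting with [e], the room that the images of
    the extra points have to fill. *)
Let outside (y : edge * W) := ~~ starts y.1 y.2.
Let Y : choiceType := {y : edge * W | outside y}.

Lemma starts_act g e z : starts (actE phi g e) (actW g z) = starts e z.
Proof.
case: z => [[[|f w] h]|[h n]] //=.
apply/eqP/eqP => [|->//] /(congr1 (actE phi g^-1%g)).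
by rewrite -!actEM mulVg !actE1.
Qed.

Lemma actY_subproof g (y : Y) :
  outside (actE phi g (val y).1, actW g (val y).2).
Proof. by rewrite /outside starts_act; exact: (valP y). Qed.
Let actY g (y : Y) : Y := exist outside _ (actY_subproof g y).

Lemma countable_G_nat : countable [set: G * nat].
Proof.
have [f fi] := countable_injP _ Gcount.
apply: (@sub_countable _ _ _ [set: nat * nat]); last exact: countableP.
have [F] : $|{injfun [set: G * nat] >-> [set: nat * nat]}|; last exact: inj_card_le F.
apply/injfunPex; exists (fun p => (f p.1, p.2)) => //.
by move=> [g m] [h n] _ _ /= [/fi -> // ->]; rewrite ?in_setT.
Qed.

(** Freeness is pseudo-freeness itself: a fixed point gives [g e = e] and [phi(g, e) h = h]. *)
Lemma ample_X : ample_free_action (actE phi) actX fst.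
Proof.
split=> [[e [h n]]|g h [e [k n]]|g [e [h n]]|//||e].
- by rewrite /actX /= actE1 cocycle1 mul1g.
- by rewrite /actX /= actEM cocycleM mulgA.
- move=> [ge] /(congr1 (fun k => k * h^-1)%g); rewrite mulgK mulgV; exact: pf.
- have [f fi] := countable_injP _ countable_G_nat.
  apply: (@sub_countable _ _ _ [set: edge * nat]); last exact: countableP.
  have [F] : $|{injfun [set: X] >-> [set: edge * nat]}|; last exact: inj_card_le F.
  apply/injfunPex; exists (fun x => (x.1, f x.2)) => //.
  by move=> [a p] [b q] _ _ /= [-> /fi ->]; rewrite ?in_setT.
- exists (fun n => (e, (1%g, n))); split=> // m n g []. by [].
Qed.

Lemma ample_Y : ample_free_action (actE phi) actY (fun y => (val y).1).
Proof.
split=> [y|g h y|g y|//||e].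
- by apply: val_inj; case: y => -[e z] ?; rewrite /= actE1 actW1.
- by apply: val_inj; case: y => -[e z] ?; rewrite /= actEM actWM.
- by case: y => -[e z] ? /(congr1 val) [_ /actW_free].
- have [f fi] := countable_injP _ countable_G_nat.
  pose T : countType := (edge * (seq edge * nat + nat))%type.
  apply: (@sub_countable _ _ _ [set: T]); last exact: countableP.
  pose F (y : Y) : T := ((val y).1, match (val y).2 with
    inl (w, h) => inl (w, f (h, 0%N)) | inr k => inr (f k) end).
  have [F'] : $|{injfun [set: Y] >-> [set: T]}|; last exact: inj_card_le F'.
  apply/injfunPex; exists F => // y y' _ _ e; apply: val_inj; move: e.
  case: y y' => [[a [[w h]|k]] ?] [[b [[w' h']|k']] ?] /= [] //.
    by move=> -> -> /fi; rewrite !in_setT => /(_ isT isT)[->].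
  by move=> -> /fi; rewrite !in_setT => /(_ isT isT) ->.
- have i0 n : outside (e, inr (1%g, n) : W) by [].
  exists (fun n => exist outside _ (i0 n)); split=> // m n g /(congr1 val) /=.
  by case.
Qed.

(** On words [T e] prefixes [e]; on the extra points it is the equivariant bijection onto the
    complement of the words starting with [e]. In the inverse, [insub] is applied only to points of
    that complement, so its default is never returned. *)
Lemma edge_permutations : exists (T T' : edge -> W -> W),
  [/\ forall e, cancel (T e) (T' e), forall e, cancel (T' e) (T e),
      forall e w h, T e (inl (w, h)) = inl (e :: w, h) &
      forall g e z, actW g (T e z) = T (actE phi g e) (actW (cocycle phi g e) z)].
Proof.
have [F [F' [FK F'K Fa Fp]]] :=
  ample_free_bijection (actE1 phi) (actEM phi) ample_X ample_Y.
pose T e (z : W) : W := match z with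
  | inl (w, h) => inl (e :: w, h)
  | inr k => (val (F (e, k))).2 end.
pose T' e (z : W) : W := match z with
  | inl (f :: w, h) => if f == e then inl (w, h) else
      if insub (e, z) is Some y then inr (F' y).2 else z
  | _ => if insub (e, z) is Some y then inr (F' y).2 else z
  end.
have T'E e z : ~~ starts e z -> T' e z = if (insub (e, z) : option Y) is Some y
    then inr (F' y).2 else z.
  by case: z => [[[|f w] h]|k] //= /negbTE ->.
have T's e z : ~~ starts e z -> exists2 y : Y, val y = (e, z) & T' e z = inr (F' y).2.
  move=> sz; rewrite T'E //; case: insubP => [y _ ey|]; first by exists y.
  by rewrite /outside /= sz.
exists T, T'; split.
- move=> e [[w h]|k] /=; first by rewrite eqxx.
  have fe : (val (F (e, k))).1 = e by rewrite Fp.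
  have [|y ey ->] := T's e (val (F (e, k))).2.
    by rewrite -{1}fe; exact: (valP (F (e, k))).
  have -> : y = F (e, k).
    by apply: val_inj; rewrite ey -{1}fe; case: (val (F (e, k))).
  by rewrite FK.
- move=> e z; have [|sz] := boolP (starts e z).
    by case: z => [[[|f w] h]|k] //= /eqP ->; rewrite eqxx.
  have [y ey ->] := T's e z sz; rewrite /T.
  have -> : (e, (F' y).2) = F' y.
    rewrite [RHS]surjective_pairing; congr pair.
    by rewrite -(Fp (F' y)) F'K ey.
  by rewrite F'K ey.
- by [].
- move=> g e [[w h]|k] //=.
  by have := Fa g (e, k) => /(congr1 (fun y => (val y).2)) /= <-; case: (k).
Qed.

(** A triple [(alpha, g, beta)] becomes the permutation [T_alpha g T_beta^-1]. This respects nonzero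
    products and hence factors through the universal group, so that a triple over 1 acts as the
    identity. *)
Lemma sge_sigma_idem (s : triple phi) : sge_sigma s = 1%g ->
  tleft s = tright s /\ tmid s = 1%g.
Proof.
have [T [T' [TK T'K Tin Tact]]] := edge_permutations.
pose Ts w := foldr (fun e f => T e \o f) id w.
pose Ts' w := foldr (fun e f => f \o T' e) id w.
have TsK w : cancel (Ts w) (Ts' w).
  by elim: w => //= e w IH z /=; rewrite TK IH.
have Ts'K w : cancel (Ts' w) (Ts w).
  by elim: w => //= e w IH z /=; rewrite IH T'K.
have Ts_cat u v : Ts (u ++ v) =1 Ts u \o Ts v.
  by elim: u => //= e u IH z /=; rewrite IH.
have Ts'_cat u v : Ts' (u ++ v) =1 Ts' v \o Ts' u.
  by elim: u => //= e u IH z /=; rewrite IH.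
have Tsact w g z : actW g (Ts w z) = Ts (act_seq phi g w) (actW (cocycle_seq phi g w) z).
  by elim: w g z => //= e w IH g z; rewrite Tact IH.
have Ts'act w g z : Ts' (act_seq phi g w) (actW g z) = actW (cocycle_seq phi g w) (Ts' w z).
  by rewrite -{1}(Ts'K w z) Tsact TsK.
have Tsin w h : Ts w (inl ([::], h)) = inl (w, h).
  by elim: w => //= e w ->; exact: Tin.
pose f (s : triple phi) (z : W) : W :=
  Ts (tleft s).2 (actW (tmid s) (Ts' (tright s).2 z)).
pose f' (s : triple phi) (z : W) : W :=
  Ts (tright s).2 (actW (tmid s)^-1%g (Ts' (tleft s).2 z)).
have actWK g z : actW g^-1%g (actW g z) = z by rewrite -actWM mulVg actW1.
have actWVK g z : actW g (actW g^-1%g z) = z by rewrite -actWM mulgV actW1.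
have fK t : cancel (f t) (f' t).
  by move=> z; rewrite /f /f' TsK actWK Ts'K.
have f'K t : cancel (f' t) (f t).
  by move=> z; rewrite /f /f' TsK actWVK Ts'K.
have fM (t u v : triple phi) : Some v = sge_mul (Some t) (Some u) -> f v =1 f t \o f u.
  move=> e z; have : Some (val v) = triple_mul_val phi (val t) (val u).
    by rewrite -sge_mulE -e.
  rewrite /f /tleft /tmid /tright /triple_mul_val.
  move: (val t) (val u) (val v) => [[a g] b] [[c h] n] [[a' k] n'] /=.
  have divE (p q r : prepath E) : path_divide p q = Some r -> q.2 = p.2 ++ r.2.
    rewrite /path_divide; case: andP => // -[_ /prefixP[w ->]] [<-] /=.
    by rewrite drop_size_cat.
  case bc: (path_divide b c) => [c'|].
    move=> [-> -> ->]; rewrite (divE _ _ _ bc) /= !Ts_cat /=.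
    by rewrite TsK Tsact -actWM.
  case cb: (path_divide c b) => [b'|//].
  move=> [-> -> ->]; rewrite (divE _ _ _ cb) /= Ts'_cat /= Ts'_cat /= TsK.
  by rewrite -{1}(actWK h (Ts' n.2 z)) Ts'act -actWM mulgVK.
(* The value at [None] is a dummy: letters are nonzero elements. *)
pose letter (l : nonzero (None : sge phi) * bool) : W -> W :=
  match sval l.1 with
  | Some t => if l.2 then f t else f' t
  | None => id end.
pose eval w := foldr (fun l g => letter l \o g) id w.
have eval_cat u v : eval (u ++ v) = eval u \o eval v.
  by elim: u => //= l u ->.
have eval_cong u v : word_cong (@ugroup_rel _ (@sge_mul _ _ phi) None) u v ->
    eval u = eval v.
  elim=> {u v} //=.
  - by move=> u v w _ -> _ ->.
  - by move=> u u' v v' _ eu _ ev; rewrite !eval_cat eu ev.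
  - move=> [[t|] nt] b; apply/funext => z /=; last by [].
    by case: b; rewrite /letter /= ?fK ?f'K.
  - move=> u v [[[t|] nt] [[[t'|] nt'] [[[t''|] nt''] [/= e [-> ->]]]]] //.
    by apply/funext => z; exact/esym/(fM _ _ _ e).
(* Evaluation at [(beta, 1)]: the inverse of [T_beta] leaves the empty word, so that the image is
   [(alpha, g)]. *)
move=> /eqquotP/asboolP/eval_cong /(congr1 (@^~ (inl ((tright s).2, 1%g)))).
rewrite /= /letter /= /f -[X in Ts' _ X]Tsin TsK /= mulg1 Tsin => -[e g1]; split=> //.
(* The words agree; the base vertices are recovered from the first edge or, for empty words, from
   the compatibility of the domains. *)
have := valP s; rewrite /tmid in g1; rewrite /tleft /tright in e *.
move: (val s) e g1 => [[[x a] g] [y b]] /= -> ->.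
move=> /and3P[xb yb /eqP]; rewrite /path_dom /= actV1.
case: b xb yb => [|e b] /=; first by move=> _ _ ->.
by move=> /andP[/eqP -> _] /andP[/eqP -> _].
Qed.

End IdempotentPure.

(** * Infinite paths and the action of the inverse semigroup *)

Section InfinitePaths.
Context (G : groupType) (E : digraph) (phi : self_similar_action G E).
Local Notation edge := (edge E).
Implicit Types (x y : nat -> edge) (u v w : seq edge) (xi eta zeta : inf_path E).

Definition is_inf_path x := forall i, dom (x i) = rng (x i.+1).

(** [cat_inf] without the base vertex of the path, so that proofs can go by induction on the list of
    edges. *)
Definition icat w x n := if (n < size w)%N then nth (x 0%N) w n else x (n - size w)%N.

Lemma icat0 x : icat [::] x = x.
Proof. by apply/funext => n; rewrite /icat subn0. Qed.

Lemma icat_cons0 e w x : icat (e :: w) x 0 = e. Proof. by []. Qed.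

Lemma icat_consS e w x n : icat (e :: w) x n.+1 = icat w x n.
Proof. by rewrite /icat /= ltnS subSS. Qed.

Lemma icat_cat u v x : icat (u ++ v) x = icat u (icat v x).
Proof.
elim: u => [|e u IH] /=; first by rewrite icat0.
by apply/funext => -[|n]; rewrite // !icat_consS IH.
Qed.

Lemma icat_split u v x y : (size u <= size v)%N -> icat u x = icat v y ->
  exists2 w, v = u ++ w & x = icat w y.
Proof.
elim: u v x => [|e u IH] [|f v] x //=; first by rewrite !icat0; exists [::]; rewrite ?icat0.
  by rewrite icat0 => _ ->; exists (f :: v).
rewrite ltnS => uv h; have := congr1 (@^~ 0%N) h; rewrite !icat_cons0 => ef.
have [|w -> ->] := IH v x uv; last by exists w; rewrite ?ef.
by apply/funext => n; have := congr1 (@^~ n.+1) h; rewrite !icat_consS.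
Qed.

Lemma icat_inj w x y : icat w x = icat w y -> x = y.
Proof.
case/icat_split => // v; rewrite -{1}(cats0 w) => /eqP.
by rewrite eqseq_cat // eqxx /= => /eqP <-; rewrite icat0.
Qed.

Lemma act_inf0 g x : act_inf phi g x 0 = actE phi g (x 0). Proof. by []. Qed.

(** Turns the formula through prefixes into a recursion on the tail, along which the group element
    changes to its cocycle; inductions on the index therefore have to range over all [g] and [x]. *)
Lemma act_infS g x n :
  act_inf phi g x n.+1 = act_inf phi (cocycle phi g (x 0)) (fun i => x i.+1) n.
Proof. by rewrite /act_inf /mkseq /= -[1%N]add1n iotaDl -map_comp. Qed.

Lemma act_infM g h x : act_inf phi (g * h)%g x = act_inf phi g (act_inf phi h x).
Proof.
apply/funext => n; elim: n g h x => [|n IH] g h x; first by rewrite !act_inf0 actEM.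
rewrite !act_infS cocycleM IH act_inf0; congr (act_inf _ _ _ n).
by apply/funext => i; rewrite act_infS.
Qed.

Lemma act_inf1 x : act_inf phi 1%g x = x.
Proof. by apply/funext => n; rewrite /act_inf cocycle_seq1 actE1. Qed.

Lemma act_inf_icat g w x : act_inf phi g (icat w x) =
  icat (act_seq phi g w) (act_inf phi (cocycle_seq phi g w) x).
Proof.
elim: w g => [|e w IH] g /=; first by rewrite !icat0.
apply/funext => -[|n]; rewrite // act_infS icat_consS icat_cons0 -IH.
by congr (act_inf _ _ _ n); apply/funext => i; rewrite icat_consS.
Qed.

Lemma act_inf_path g x : is_inf_path x -> is_inf_path (act_inf phi g x).
Proof.
move=> xp n; elim: n g x xp => [|n IH] g x xp.
  by rewrite act_infS !act_inf0 act_dom act_rng cocycle_act xp.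
by rewrite !(act_infS g) IH // => i; exact: xp.
Qed.

Lemma inf_edge_inj : injective (@inf_edge E).
Proof. by move=> x y /val_inj. Qed.

Lemma inf_edge_path xi : is_inf_path (inf_edge xi).
Proof. exact: set_valP. Qed.

Lemma inf_path_of x : is_inf_path x -> exists xi, inf_edge xi = x.
Proof. by move=> xp; exists (SigSub (mem_set xp)). Qed.

Lemma is_inf_path_icat (p : prepath E) x : is_path p.1 p.2 -> is_inf_path x ->
  rng (x 0) = path_dom p -> is_inf_path (icat p.2 x) /\ rng (icat p.2 x 0) = p.1.
Proof.
case: p => v w /= wp xp; elim: w v wp => [|e w IH] v /=; first by rewrite icat0.
move=> /andP[/eqP ev wp] x0; have [h1 h2] := IH (dom e) wp x0; split=> // -[|n].
  by rewrite icat_consS h2.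
by rewrite !icat_consS.
Qed.

Lemma icat_is_inf_path w x : is_inf_path (icat w x) ->
  [/\ is_path (rng (icat w x 0)) w, is_inf_path x &
      rng (x 0) = path_dom (rng (icat w x 0), w)].
Proof.
rewrite /path_dom /=; elim: w => [|e w IH] /=; first by rewrite icat0.
move=> h; have [|h1 h2 h3] := IH.
  by move=> i; have := h i.+1; rewrite !icat_consS.
have de : dom e = rng (icat w x 0) by have := h 0%N; rewrite icat_consS.
by rewrite eqxx /= de; split=> //; rewrite h3; case: (w) (de).
Qed.

Lemma cylinderP p xi : cylinder p xi <-> exists x, [/\ is_inf_path x,
  rng (x 0) = path_dom p & inf_edge xi = icat p.2 x].
Proof.
split=> [[x [x0 xiE]]|[x [xp x0 xiE]]].
  by exists (inf_edge x); split=> //; [exact: inf_edge_path|exact/funext].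
by have [y yx] := inf_path_of xp; exists y; rewrite /inf_rng yx; split=> // i; rewrite xiE.
Qed.

Definition inf_prefix n xi : prepath E := (inf_rng xi, mkseq (inf_edge xi) n).

Lemma icat_mkseq x n : icat (mkseq x n) (fun i => x (n + i)%N) = x.
Proof.
apply/funext => i; rewrite /icat size_mkseq; case: ltnP => ni.
  by rewrite nth_mkseq.
by rewrite subnKC.
Qed.

Lemma mkseq_icat w x : mkseq (icat w x) (size w) = w.
Proof.
apply: (@eq_from_nth _ (x 0%N)); rewrite size_mkseq // => i iw.
by rewrite nth_mkseq // /icat iw.
Qed.

Lemma inf_prefix_path n xi : is_path (inf_prefix n xi).1 (inf_prefix n xi).2.
Proof.
have := inf_edge_path xi; rewrite -{1}(icat_mkseq (inf_edge xi) n).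
by move=> /icat_is_inf_path[]; rewrite icat_mkseq.
Qed.

(** The working form of membership: among the paths of one length only the prefix of [xi] has a
    cylinder containing [xi], so the cylinders of a given length partition the space. *)
Lemma cylinder_prefix p xi : is_path p.1 p.2 ->
  cylinder p xi <-> p = inf_prefix (size p.2) xi.
Proof.
move=> pp; split=> [/cylinderP[x [xp x0 xiE]]|->].
  rewrite /inf_prefix /inf_rng xiE mkseq_icat.
  by have [_ ->] := is_inf_path_icat pp xp x0; case: (p).
apply/cylinderP; exists (fun i => inf_edge xi (size p.2 + i)%N).
have := inf_edge_path xi; rewrite -{1}(icat_mkseq (inf_edge xi) (size p.2)).
move=> /icat_is_inf_path[_ h1 h2]; split=> //=; last by rewrite icat_mkseq.
by rewrite h2 icat_mkseq.
Qed.

Lemma cylinder_catl p w xi : is_path p.1 (p.2 ++ w) ->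
  cylinder (p.1, p.2 ++ w) xi -> cylinder p xi.
Proof.
move=> /[dup] pw; rewrite is_path_cat => /andP[pp _] h.
apply/(cylinder_prefix _ pp); move: h => /[dup] /cylinderP[x [_ _ /= xiE]].
move=> /(cylinder_prefix xi (p := (p.1, p.2 ++ w)) pw) [p1 _].
by rewrite /inf_prefix -p1 xiE icat_cat mkseq_icat; case: (p).
Qed.

End InfinitePaths.

(** * Products of triples and composition of partial homeomorphisms *)

Section SgeProduct.
Context (G : groupType) (E : digraph) (phi : self_similar_action G E).
Local Notation edge := (edge E).
Local Notation triple := (triple phi).
Implicit Types (s t u : triple) (x y : nat -> edge) (xi eta zeta : inf_path E).

Lemma sge_mulP s t u : sge_mul (Some s) (Some t) = Some u <->
  triple_mul_val phi (val s) (val t) = Some (val u).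
Proof.
rewrite -sge_mulE; case: sge_mul => [v|//] /=.
by split=> [[->]//|[/val_inj ->]].
Qed.

Lemma triple_mul_val_ok s t v :
  triple_mul_val phi (val s) (val t) = Some v -> triple_ok phi v.
Proof. by have := triple_mul_ok s t => /[swap] ->. Qed.

Lemma tleft_path s : is_path (tleft s).1 (tleft s).2.
Proof. by have := valP s; rewrite /tleft; case: (val s) => -[a g] b /and3P[]. Qed.

Lemma tright_path s : is_path (tright s).1 (tright s).2.
Proof. by have := valP s; rewrite /tright; case: (val s) => -[a g] b /and3P[]. Qed.

Lemma tdom s : path_dom (tleft s) = actV phi (tmid s) (path_dom (tright s)).
Proof.
have := valP s; rewrite /tleft /tright /tmid; case: (val s) => -[a g] b.
by move=> /and3P[_ _ /eqP].
Qed.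

Lemma tripleE s : val s = (tleft s, tmid s, tright s).
Proof. by rewrite /tleft /tmid /tright; case: (val s) => -[]. Qed.

Lemma triple_eq s t : tleft s = tleft t -> tmid s = tmid t -> tright s = tright t ->
  s = t.
Proof. by move=> l m r; apply: val_inj; rewrite !tripleE l m r. Qed.

Lemma tstar_ok s : triple_ok phi (tright s, (tmid s)^-1%g, tleft s).
Proof.
by rewrite /triple_ok tleft_path tright_path tdom -actVM mulVg actV1 eqxx.
Qed.

Definition tstar s : triple := Triple (tstar_ok s).

Lemma tstarK s : tstar (tstar s) = s.
Proof. by apply: triple_eq => //; exact: invgK. Qed.

Lemma theta_graphP s xi eta : theta_graph s xi eta <-> exists x,
  [/\ is_inf_path x, rng (x 0) = path_dom (tright s),
      inf_edge xi = icat (tright s).2 x &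
      inf_edge eta = icat (tleft s).2 (act_inf phi (tmid s) x)].
Proof.
split=> [[x [x0 h1 h2]]|[x [xp x0 h1 h2]]].
  by exists (inf_edge x); split=> //; [exact: inf_edge_path|exact/funext|exact/funext].
have [z zx] := inf_path_of xp; exists z; rewrite /inf_rng zx.
by split=> // i; rewrite ?h1 ?h2.
Qed.

Lemma rng_act_inf g x : rng (act_inf phi g x 0) = actV phi g (rng (x 0)).
Proof. by rewrite act_inf0 act_rng. Qed.

Lemma theta_graph_left s xi eta : theta_graph s xi eta -> cylinder (tleft s) eta.
Proof.
move=> /theta_graphP[x [xp x0 _ h]]; apply/cylinderP; exists (act_inf phi (tmid s) x).
by split=> //; [exact: act_inf_path|rewrite rng_act_inf x0 tdom].
Qed.

Lemma theta_graph_star s xi eta : theta_graph s xi eta -> theta_graph (tstar s) eta xi.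
Proof.
move=> /theta_graphP[x [xp x0 h1 h2]]; apply/theta_graphP.
exists (act_inf phi (tmid s) x); split=> //; first exact: act_inf_path.
  by rewrite rng_act_inf x0 -tdom.
by rewrite -act_infM mulVg act_inf1.
Qed.

Lemma theta_graph_right s xi eta : theta_graph s xi eta -> cylinder (tright s) xi.
Proof. by move=> /theta_graph_star/theta_graph_left. Qed.

Lemma theta_graph_total s xi : cylinder (tright s) xi -> exists eta, theta_graph s xi eta.
Proof.
move=> /cylinderP[x [xp x0 h]].
have [|||hp _] := @is_inf_path_icat _ (tleft s) (act_inf phi (tmid s) x).
- exact: tleft_path.
- exact: act_inf_path.
- by rewrite rng_act_inf x0 tdom.
- have [eta etaE] := inf_path_of hp.
  by exists eta; apply/theta_graphP; exists x.
Qed.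

Lemma theta_graph_surj s eta : cylinder (tleft s) eta -> exists xi, theta_graph s xi eta.
Proof.
move=> h; have [xi /theta_graph_star] := @theta_graph_total (tstar s) eta h.
by rewrite tstarK; exists xi.
Qed.

Lemma theta_graph_fun s xi eta eta' :
  theta_graph s xi eta -> theta_graph s xi eta' -> eta = eta'.
Proof.
move=> /theta_graphP[x [_ _ h1 h2]] /theta_graphP[y [_ _ h3 h4]].
apply: inf_edge_inj; rewrite h2 h4.
by have -> : x = y by apply: (@icat_inj _ (tright s).2); rewrite -h1 -h3.
Qed.

Lemma theta_graph_id s xi eta : tleft s = tright s -> tmid s = 1%g ->
  theta_graph s xi eta -> xi = eta.
Proof.
move=> lr m1 /theta_graphP[x [_ _ h1 h2]]; apply: inf_edge_inj.
by rewrite h1 h2 m1 act_inf1 lr.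
Qed.

Lemma path_divideP (b c c' : prepath E) : path_divide b c = Some c' <->
  [/\ b.1 = c.1, c'.1 = path_dom b & c.2 = b.2 ++ c'.2].
Proof.
rewrite /path_divide; case: c' => v w; split=> /=.
  case: andP => // -[/eqP -> /prefixP[u ->]] [<- <-].
  by rewrite drop_size_cat.
by move=> [-> -> ->]; rewrite eqxx prefix_prefix /= drop_size_cat.
Qed.

(** The left path of [t] and the right path of [s] are both prefixes of [xi], hence comparable. This
    excludes the zero product, and the two orders are the two cases of its definition. *)
Lemma theta_graph_comp s t zeta xi eta : theta_graph t zeta xi ->
  theta_graph s xi eta ->
  exists u, sge_mul (Some s) (Some t) = Some u /\ theta_graph u zeta eta.
Proof.
move=> tzx sxe; have ct := theta_graph_left tzx; have cs := theta_graph_right sxe.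
have rt : (tleft t).1 = inf_rng xi.
  by move: ct => /(cylinder_prefix _ (tleft_path t)) ->.
have rs : (tright s).1 = inf_rng xi.
  by move: cs => /(cylinder_prefix _ (tright_path s)) ->.
move: tzx => /theta_graphP[y [yp y0 zE xE]].
move: sxe => /theta_graphP[x [xp x0 xE' eE]].
have [le|/ltnW le] := leqP (size (tright s).2) (size (tleft t).2).
  have [|w bw xw] := @icat_split _ _ _ x (act_inf phi (tmid t) y) le.
    by rewrite -xE' -xE.
  have d : path_divide (tright s) (tleft t) = Some (path_dom (tright s), w).
    by apply/path_divideP; rewrite rs rt bw.
  have uE : triple_mul_val phi (val s) (val t) =
     Some (path_cat (tleft s) (act_path phi (tmid s) (path_dom (tright s), w)),
     cocycle_path phi (tmid s) (path_dom (tright s), w) * tmid t, tright t)%g.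
    by rewrite !tripleE /triple_mul_val d.
  have uok := triple_mul_val_ok uE.
  exists (Triple uok); split; first exact/sge_mulP.
  apply/theta_graphP; exists y; split=> //.
  by rewrite eE /= icat_cat xw act_inf_icat act_infM.
have [|w bw yw] := @icat_split _ _ _ (act_inf phi (tmid t) y) x le.
  by rewrite -xE' -xE.
(* Only the weak inequality is left, and the product tests the other divisibility first; if that
   succeeds as well, the two paths coincide and [w] is empty. *)
have [d|] := eqVneq (path_divide (tright s) (tleft t)) None; last first.
  case d: (path_divide _ _) => [[v u]|//] _.
  have /path_divideP[_ /= v1 e] := d; rewrite e in bw.
  have [u0 w0] : u = [::] /\ w = [::].
    move: bw => /(congr1 size)/eqP; rewrite !size_cat -addnA -[X in X == _]addn0.
    rewrite eqn_add2l eq_sym addn_eq0 => /andP[/nilP -> /nilP ->] //.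
  subst u w; rewrite icat0 in yw.
  have uE : triple_mul_val phi (val s) (val t) =
     Some (path_cat (tleft s) (act_path phi (tmid s) (v, [::])),
     cocycle_path phi (tmid s) (v, [::]) * tmid t, tright t)%g.
    by rewrite !tripleE /triple_mul_val d.
  have uok := triple_mul_val_ok uE.
  exists (Triple uok); split; first exact/sge_mulP.
  apply/theta_graphP; exists y; split=> //.
  by rewrite eE /= cats0 -yw act_infM.
have d' : path_divide (tleft t) (tright s) = Some (path_dom (tleft t), w).
  by apply/path_divideP; rewrite rs rt bw.
have uE : triple_mul_val phi (val s) (val t) =
   Some (tleft s, tmid s * (cocycle_path phi (tmid t)^-1 (path_dom (tleft t), w))^-1,
   path_cat (tright t) (act_path phi (tmid t)^-1 (path_dom (tleft t), w)))%g.
  by rewrite !tripleE /triple_mul_val d d'.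
have uok := triple_mul_val_ok uE.
exists (Triple uok); split; first exact/sge_mulP.
have yE : y = icat (act_seq phi (tmid t)^-1%g w)
    (act_inf phi (cocycle_seq phi (tmid t)^-1%g w) x).
  by rewrite -act_inf_icat -yw -act_infM mulVg act_inf1.
apply/theta_graphP; exists (act_inf phi (cocycle_seq phi (tmid t)^-1%g w) x); split.
- exact: act_inf_path.
- rewrite rng_act_inf cocycle_seq_act x0 /path_dom /= map_cat last_cat.
  have := path_dom_act phi (tmid t)^-1%g (path_dom (tleft t), w).
  rewrite {1}/path_dom /= tdom -actVM mulVg actV1 -tdom.
  rewrite /path_dom /= => ->; congr actV; rewrite bw map_cat last_cat.
  by rewrite rs rt.
- by rewrite zE /= icat_cat -yE.
- by rewrite eE /= -act_infM mulgVK.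
Qed.

(** It suffices to place the middle point in the domain of [s]: composition then produces a point
    related to [zeta] by the same [u], which must be [eta]. *)
Lemma theta_graph_mul s t u zeta eta : sge_mul (Some s) (Some t) = Some u ->
  theta_graph u zeta eta ->
  exists2 xi, theta_graph t zeta xi & theta_graph s xi eta.
Proof.
move=> stu uze; have uE := (sge_mulP _ _ _).1 stu.
suff [xi tzx cs] : exists2 xi, theta_graph t zeta xi & cylinder (tright s) xi.
  exists xi => //; have [eta' sxe] := theta_graph_total cs.
  have [u' []] := theta_graph_comp tzx sxe; rewrite stu => -[<-] uze'.
  by rewrite (theta_graph_fun uze uze').
have ct := theta_graph_right uze; have pu := tright_path u.
move: uE; rewrite !tripleE /triple_mul_val.
case st: (path_divide (tright s) (tleft t)) => [c'|].
  have /path_divideP[b1 _ b2] := st.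
  move=> [_ _ r]; rewrite -r in ct; have [xi tzx] := theta_graph_total ct.
  exists xi => //; have := theta_graph_left tzx; have := tleft_path t.
  by rewrite (surjective_pairing (tleft t)) b2 -b1; exact: cylinder_catl.
case ts: (path_divide (tleft t) (tright s)) => [b'|//].
have /path_divideP[b1 _ b2] := ts; move=> [_ _ r]; rewrite -r in ct pu.
have [xi tzx] := theta_graph_total (cylinder_catl (p := tright t) pu ct).
exists xi => //; have /theta_graphP[y [yp y0 zE xE]] := tzx.
have /cylinderP[x [xp x0]] := ct; rewrite zE icat_cat => /icat_inj yx.
apply/(cylinder_prefix _ (tright_path s)); rewrite /inf_prefix /inf_rng xE yx.
rewrite /= act_inf_icat -act_seqM mulgV act_seq1 -icat_cat -b2 mkseq_icat.
have /(cylinder_prefix _ (tleft_path t))/(congr1 fst) e := theta_graph_left tzx.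
rewrite [LHS]surjective_pairing -b1 e /= /inf_rng xE yx /= act_inf_icat.
by rewrite -act_seqM mulgV act_seq1 -icat_cat -b2.
Qed.

End SgeProduct.

(** * The partial homeomorphisms of the universal group *)

Section SgeSigma.
Context (G : groupType) (E : digraph) (phi : self_similar_action G E).
Local Notation edge := (edge E).
Local Notation triple := (triple phi).
Local Notation sigma := (@sge_sigma G E phi).
Implicit Types (s t u : triple) (p q : prepath E) (xi eta zeta : inf_path E).

Lemma sge_sigmaM s t u : sge_mul (Some s) (Some t) = Some u ->
  sigma u = (sigma s * sigma t)%g.
Proof.
move=> stu; apply/esym/pg_piE.
apply: WCtrans (WCcat (pg_reprK _ _) (pg_reprK _ _)) _.
by apply: WCrel; do 3!eexists; split; last by split; reflexivity.
Qed.

Lemma path_divide_id p : path_divide p p = Some (path_dom p, [::]).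
Proof. by apply/path_divideP; rewrite cats0. Qed.

Lemma sge_mul_match s t : tright s = tleft t -> exists u,
  [/\ sge_mul (Some s) (Some t) = Some u, tleft u = tleft s,
      tmid u = (tmid s * tmid t)%g & tright u = tright t].
Proof.
move=> st.
have h : triple_mul_val phi (val s) (val t) =
    Some (tleft s, (tmid s * tmid t)%g, tright t).
  rewrite !tripleE /triple_mul_val st path_divide_id /path_cat /= cats0.
  by rewrite -surjective_pairing.
exists (Triple (triple_mul_val_ok h)); split=> //.
by apply/sge_mulP; rewrite h.
Qed.

(** Such a triple is idempotent, and a group has no idempotent but 1. *)
Lemma sge_sigma1 s : tleft s = tright s -> tmid s = 1%g -> sigma s = 1%g.
Proof.
move=> lr m1; have [u [/sge_sigmaM us ul um ur]] := sge_mul_match (esym lr).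
have uE : u = s by apply: triple_eq; rewrite ?ul ?um ?ur // m1 mulg1.
by apply: (@mulgI _ (sigma s)); rewrite -us uE mulg1.
Qed.

Lemma sge_sigmaV s : sigma (tstar s) = (sigma s)^-1%g.
Proof.
have [|u [us ul um ur]] := @sge_mul_match s (tstar s); first by [].
apply: (@mulgI _ (sigma s)); rewrite mulgV -(sge_sigmaM us).
by apply: sge_sigma1; rewrite ?ul ?ur // um mulgV.
Qed.

Lemma pid_ok p : is_path p.1 p.2 -> triple_ok phi (p, 1%g, p).
Proof. by move=> h; rewrite /triple_ok h actV1 eqxx. Qed.

Definition pid p (pp : is_path p.1 p.2) : triple := Triple (pid_ok pp).

(** Any extension of the left path is reached by multiplying with an idempotent, which does not
    affect the image in the universal group: triples can be cut down to smaller cylinders over one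
    fixed [g]. *)
Lemma sge_mul_restrict s q (qq : is_path q.1 q.2) w :
  q = ((tleft s).1, (tleft s).2 ++ w) ->
  exists2 u, sge_mul (Some (pid qq)) (Some s) = Some u & tleft u = q.
Proof.
move=> qE.
have sq : path_divide (tleft s) q = Some (path_dom (tleft s), w).
  by apply/path_divideP; rewrite qE.
have [v [vE vl]] : exists v,
    triple_mul_val phi (val (pid qq)) (val s) = Some v /\ v.1.1 = q.
  rewrite [val s]tripleE /= sq; case qs: (path_divide q (tleft s)) => [c|].
    have /path_divideP[_ c1 c2] := qs; eexists; split; first reflexivity.
    have c0 : c.2 = [::].
      move: c2; rewrite qE /= -catA => /(congr1 size)/eqP; rewrite !size_cat.
      by rewrite -[X in X == _]addn0 eqn_add2l eq_sym addn_eq0 => /andP[_ /nilP].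
    by rewrite /path_cat /= c0 /= cats0 -surjective_pairing.
  by eexists; split; first reflexivity.
exists (Triple (triple_mul_val_ok vE)); last by rewrite /tleft /= vl.
by apply/sge_mulP; rewrite vE.
Qed.

Hypotheses (pf : pseudo_free phi) (Gcount : countable [set: G]).

(** Equal left paths make the product of [tstar s] and [t] a mere concatenation, and it lies over 1;
    being idempotent, it identifies the remaining entries. *)
Lemma sge_sigma_inj s t : sigma s = sigma t -> tleft s = tleft t -> s = t.
Proof.
move=> st lst; have [|u [us ul um ur]] := @sge_mul_match (tstar s) t; first by [].
have [] := @sge_sigma_idem _ _ _ pf Gcount u.
  by rewrite (sge_sigmaM us) sge_sigmaV st mulVg.
rewrite ul um ur => r m; apply: triple_eq => //.
by apply: (@mulgI _ (tmid s)^-1%g); rewrite m mulVg.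
Qed.

Definition sigma_graph (g : sge_group phi) xi eta :=
  exists2 s, sigma s = g & theta_graph s xi eta.
Local Notation Rel := sigma_graph.

Lemma sigma_graphV g xi eta : Rel g xi eta -> Rel g^-1%g eta xi.
Proof.
by move=> [s <- h]; exists (tstar s); [exact: sge_sigmaV|exact: theta_graph_star].
Qed.

Lemma sigma_graphM g h xi eta zeta :
  Rel h xi eta -> Rel g eta zeta -> Rel (g * h)%g xi zeta.
Proof.
move=> [t <- ht] [s <- hs]; have [u [us hu]] := theta_graph_comp ht hs.
by exists u => //; exact: sge_sigmaM.
Qed.

Lemma sigma_graph1 xi : Rel 1%g xi xi.
Proof.
have pp := inf_prefix_path 0 xi.
exists (pid pp); first exact: sge_sigma1.
have [eta h] : exists eta, theta_graph (pid pp) xi eta.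
  by apply: theta_graph_total; apply/(cylinder_prefix _ (tright_path _)).
have e : xi = eta by exact: theta_graph_id h.
by rewrite -e in h.
Qed.

(** Only idempotents lie over 1, and they act as identities. Single-valuedness and injectivity for
    every [g] reduce to this by composing with an inverse. *)
Lemma sigma_graph1_eq xi eta : Rel 1%g xi eta -> xi = eta.
Proof. by move=> [s /(sge_sigma_idem pf Gcount)[]]; exact: theta_graph_id. Qed.

Lemma sigma_graph_fun g xi eta eta' : Rel g xi eta -> Rel g xi eta' -> eta = eta'.
Proof.
move=> /sigma_graphV h h'; apply: sigma_graph1_eq.
by rewrite -(mulgV g); apply: sigma_graphM h h'.
Qed.

Lemma sigma_graph_inj g xi xi' eta : Rel g xi eta -> Rel g xi' eta -> xi = xi'.
Proof. by move=> /sigma_graphV h /sigma_graphV; exact: sigma_graph_fun h. Qed.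

Lemma FsetP (g : sge_group phi) eta : Fset g eta <-> exists xi, Rel g xi eta.
Proof.
split=> [[s /= sg /theta_graph_surj[xi h]]|[xi [s sg h]]]; first by exists xi, s.
by exists s => //; exact: theta_graph_left h.
Qed.

Lemma FsetVP (g : sge_group phi) xi : Fset g^-1%g xi <-> exists eta, Rel g xi eta.
Proof.
rewrite FsetP; split=> -[eta h]; exists eta; last exact: sigma_graphV.
by rewrite -(invgK g); exact: sigma_graphV.
Qed.

Lemma theta_invE (g : sge_group phi) xi eta : Rel g xi eta -> theta_inv g eta = xi.
Proof.
have thE a b : Rel g a b -> theta g a = b.
  move=> h; apply: sigma_graph_fun (h); rewrite /theta.
  case: xgetP => [z _ [s [sg hs]]|/(_ b)[]]; first by exists s.
  by have [s sg hs] := h; exists s.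
move=> h; rewrite /theta_inv; case: xgetP => [z _ [/FsetVP[eta' h'] e]|/(_ xi)[]].
  by apply: sigma_graph_inj h; rewrite -e (thE _ _ h').
by split; [apply/FsetVP; exists eta|exact: thE].
Qed.

Lemma theta_tildeE (R : realType) (g : sge_group phi) (f : inf_path E -> R[i]) xi eta :
  Rel g xi eta -> theta_tilde g f eta = f xi.
Proof.
move=> h; rewrite /theta_tilde (theta_invE h); case: asboolP => // -[].
by apply/FsetP; exists xi.
Qed.

Lemma theta_tilde0 (R : realType) (g : sge_group phi) (f : inf_path E -> R[i]) eta :
  ~ Fset g eta -> theta_tilde g f eta = 0.
Proof. by move=> h; rewrite /theta_tilde; case: asboolP. Qed.

End SgeSigma.

(** * The partial action on continuous functions *)

Section PathEnumeration.
Context (E : digraph).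
Local Notation edge := (edge E).
Local Notation inf_path := (inf_path E).
Implicit Types (p q : prepath E) (xi eta : inf_path).

Definition path_rcons p e : prepath E := (p.1, rcons p.2 e).

Lemma is_path_rcons p e : is_path (path_rcons p e).1 (path_rcons p e).2 =
  is_path p.1 p.2 && (rng e == path_dom p).
Proof. by case: p => v w; rewrite /= -cats1 is_path_cat /= andbT. Qed.

Fixpoint paths n : seq (prepath E) :=
  if n is n'.+1 then
    [seq path_rcons p e | p <- paths n', e <- [seq e <- enum edge | rng e == path_dom p]]
  else [seq (x, [::]) | x <- enum (vert E)].

Lemma mem_paths n p : (p \in paths n) = (size p.2 == n) && is_path p.1 p.2.
Proof.
elim: n p => [|n IH] [v w] /=.
  case: w => [|e w]; first by rewrite mem_map ?mem_enum // => x y [].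
  by apply/mapP => -[x _].
apply/allpairsPdep/idP => [[p [e [pn]]]|].
  rewrite mem_filter mem_enum andbT => he [-> ->].
  have := is_path_rcons p e; rewrite /= => ->.
  by move: pn; rewrite IH he andbT size_rcons eqSS.
case: w / (lastP w) => [//|w e].
rewrite size_rcons eqSS (is_path_rcons (v, w)) => /andP[sw /andP[pw he]].
exists (v, w), e; split=> //; first by rewrite IH sw.
by rewrite mem_filter mem_enum he.
Qed.

Lemma uniq_paths n : uniq (paths n).
Proof.
elim: n => [|n IH] /=; first by rewrite map_inj_uniq ?enum_uniq // => x y [].
apply: allpairs_uniq_dep => // [p _|]; first by rewrite filter_uniq ?enum_uniq.
move=> [[v w] e] [[v' w'] e'] _ _ [-> /eqP].
by rewrite eqseq_rcons => /andP[/eqP -> /eqP ->].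
Qed.

Lemma paths_path n p : p \in paths n -> is_path p.1 p.2.
Proof. by rewrite mem_paths => /andP[]. Qed.

Lemma paths_size n p : p \in paths n -> size p.2 = n.
Proof. by rewrite mem_paths => /andP[/eqP]. Qed.

Lemma big_paths0 (V : nmodType) (F : prepath E -> V) :
  \sum_(p <- paths 0) F p = \sum_x F (x, [::]).
Proof. by rewrite /= big_map enumT. Qed.

Lemma big_pathsS (V : nmodType) n (F : prepath E -> V) :
  \sum_(p <- paths n.+1) F p =
  \sum_(p <- paths n) \sum_(e | rng e == path_dom p) F (path_rcons p e).
Proof.
rewrite /= big_allpairs_dep; apply: eq_bigr => p _.
by rewrite big_filter enumT.
Qed.

Lemma inf_prefix_paths n xi : inf_prefix n xi \in paths n.
Proof. by rewrite mem_paths inf_prefix_path size_mkseq eqxx. Qed.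

Lemma inf_prefixS n xi : inf_prefix n.+1 xi = path_rcons (inf_prefix n xi) (inf_edge xi n).
Proof. by rewrite /inf_prefix /path_rcons mkseqS. Qed.

Lemma cylinder_rcons p e xi : is_path (path_rcons p e).1 (path_rcons p e).2 ->
  cylinder (path_rcons p e) xi -> cylinder p xi.
Proof. by rewrite /path_rcons -cats1; exact: cylinder_catl. Qed.

Lemma cylinder_inf_prefix n xi : cylinder (inf_prefix n xi) xi.
Proof.
by apply/(cylinder_prefix _ (inf_prefix_path n xi)); rewrite /= size_mkseq.
Qed.

Lemma cylinder_pathsP n p xi : p \in paths n -> cylinder p xi <-> p = inf_prefix n xi.
Proof.
move=> pn; rewrite -(paths_size pn).
exact/cylinder_prefix/(paths_path pn).
Qed.

Lemma near_inf_prefix n xi : \forall eta \near xi, inf_prefix n eta = inf_prefix n xi.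
Proof.
pose K := fun _ : nat => discrete_topology edge.
have ce i : \forall eta \near xi, inf_edge eta i = inf_edge xi i.
  have cv : \forall y \near (sval xi : prod_topology K), y i = sval xi i.
    exact: (@proj_continuous nat K i (sval xi) _ (discrete_set1 (sval xi i))).
  exact: (@initial_continuous _ _ (sval : inf_path -> prod_topology K) xi _ cv).
have cn : \forall eta \near xi, forall i, (i <= n)%N -> inf_edge eta i = inf_edge xi i.
  elim: n => [|n IH].
    by apply: filterS (ce 0%N) => eta h i; rewrite leqn0 => /eqP ->.
  near=> eta; move=> i; rewrite leq_eqVlt => /orP[/eqP ->|].
    by near: eta; exact: ce.
  by move: i; near: eta; exact: IH.
apply: filterS cn => eta h; rewrite /inf_prefix /inf_rng h //; congr pair.
by apply/eq_in_map => i; rewrite mem_iota => /andP[_ /ltnW]; exact: h.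
Unshelve. all: by end_near. Qed.

Lemma inf_prefix_le m n xi eta : (m <= n)%N ->
  inf_prefix n eta = inf_prefix n xi -> inf_prefix m eta = inf_prefix m xi.
Proof.
move=> mn [h1 h2]; rewrite /inf_prefix h1; congr pair.
have tk x : mkseq (inf_edge x) m = take m (mkseq (inf_edge x) n).
  by rewrite /mkseq -map_take take_iota (minn_idPl mn).
by rewrite !tk h2.
Qed.

Lemma inf_prefix_edge n i xi eta : (i < n)%N ->
  inf_prefix n eta = inf_prefix n xi -> inf_edge eta i = inf_edge xi i.
Proof.
move=> iltn [_ /(congr1 (fun s => nth (inf_edge xi 0) s i))].
by rewrite !nth_mkseq.
Qed.

(** Compactness takes the place of unfolding the topology: near any other point a long prefix
    already differs from that of [xi], near [xi] the set [A] holds, and one length serves for all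
    points. *)
Lemma inf_prefix_basis xi (A : set inf_path) : (\forall eta \near xi, A eta) ->
  exists n, forall eta, inf_prefix n eta = inf_prefix n xi -> A eta.
Proof.
move=> nA; have /compact_near_coveringP nc := @compact_inf_path E.
have [eta _|n _ hn] :=
    nc nat \oo (fun n eta => inf_prefix n eta = inf_prefix n xi -> A eta) _.
  have [->|] := pselect (eta = xi).
    exists (A, [set: nat]) => [|[zeta n] [Az _] _]; last exact: Az.
    by split; [exact: nA|exact: filterT].
  move=> ne; have [i hi] : exists i, inf_edge eta i <> inf_edge xi i.
    by apply/existsNP => h; apply: ne; apply/inf_edge_inj/funext.
  exists ([set zeta | inf_prefix i.+1 zeta = inf_prefix i.+1 eta],
      [set n | (i < n)%N]).
    by split; [exact: near_inf_prefix|exact: nbhs_infty_gt].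
  move=> [zeta n] [/= h1 h2] h; exfalso; apply: hi.
  by rewrite -(inf_prefix_edge (ltnSn i) h1); exact: inf_prefix_edge h2 h.
by exists n => eta; exact: hn (leqnn n) eta I.
Qed.

(** Koenig's lemma: the length that works for a path works near it, by heredity every larger one
    does too, and compactness yields a common bound. *)
Lemma inf_path_fan (Q : prepath E -> Prop) :
  (forall p e, is_path (path_rcons p e).1 (path_rcons p e).2 ->
     Q p -> Q (path_rcons p e)) ->
  (forall xi, exists n, Q (inf_prefix n xi)) ->
  exists N, forall n xi, (N <= n)%N -> Q (inf_prefix n xi).
Proof.
move=> Qmono Qex.
have Qle m n xi : (m <= n)%N -> Q (inf_prefix m xi) -> Q (inf_prefix n xi).
  move=> /subnK <-; elim: (n - m)%N => // k IH h.
  rewrite addSn inf_prefixS; apply: Qmono; last exact: IH.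
  by rewrite -inf_prefixS; exact: inf_prefix_path.
have /compact_near_coveringP nc := @compact_inf_path E.
have [xi _|N _ hN] := nc nat \oo (fun n xi => Q (inf_prefix n xi)) _.
  have [n hn] := Qex xi.
  exists ([set eta | inf_prefix n eta = inf_prefix n xi], [set m | (n <= m)%N]).
    by split; [exact: near_inf_prefix|exact: nbhs_infty_ge].
  by move=> [eta m] [/= h1 h2]; apply: (Qle n) => //; rewrite h1.
by exists N => n xi Nn; exact: (hN n Nn xi I).
Qed.

(** Paths grow at their domain end, where the next edge must have the last domain as its range; the
    absence of sources supplies it. *)
Lemma inf_path_cylinder p : no_sources E -> is_path p.1 p.2 -> exists xi, cylinder p xi.
Proof.
move=> /choice[nxt hn] pp.
pose x n := iter n (fun e => nxt (dom e)) (nxt (path_dom p)).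
have xp : is_inf_path x by move=> i; rewrite /x /= hn.
have [hp _] := is_inf_path_icat pp xp (hn _).
have [xi xiE] := inf_path_of hp; exists xi; apply/cylinderP; exists x; split=> //.
exact: hn.
Qed.

Definition cylinder_point p : option inf_path :=
  if pselect (exists xi, cylinder p xi) is left h then Some (projT1 (cid h)) else None.

Lemma cylinder_pointP p : no_sources E -> is_path p.1 p.2 ->
  exists2 xi, cylinder_point p = Some xi & cylinder p xi.
Proof.
move=> ns /(inf_path_cylinder ns) h; rewrite /cylinder_point; case: pselect => // h'.
by eexists; first reflexivity; exact: (projT2 (cid h')).
Qed.

End PathEnumeration.

(** * Locally constant functions on the path space *)

Section LocallyConstant.
Context (R : realType) (E : digraph).
Local Notation inf_path := (inf_path E).
Local Notation cfun := (cfun R (compact_inf_path (E := E))).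
Local Notation normc := Normc.normc.
Implicit Types (p q : prepath E) (xi eta : inf_path) (f : cfun).

Lemma locally_constant_continuous (f : inf_path -> R[i]) n :
  (forall xi eta, inf_prefix n eta = inf_prefix n xi -> f eta = f xi) ->
  continuous (f : inf_path -> R[i]^o).
Proof.
move=> h; apply/cont_normcP => xi e e0.
by apply: filterS (near_inf_prefix n xi) => eta /h ->; rewrite subrr Normc.normc0.
Qed.

Lemma cind_cont p : continuous
  ((fun xi => (p == inf_prefix (size p.2) xi)%:R) : inf_path -> R[i]^o).
Proof. by apply: (@locally_constant_continuous _ (size p.2)) => xi eta ->. Qed.

Definition cind p : cfun := CFun (compact_inf_path (E := E)) (@cind_cont p).

Lemma cindE p xi : is_path p.1 p.2 -> cind p xi = (`[< cylinder p xi >])%:R.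
Proof.
move=> pp /=; congr (_%:R); congr nat_of_bool; apply/eqP/asboolP.
  by move=> /(cylinder_prefix _ pp).
by move=> /(cylinder_prefix _ pp).
Qed.

Lemma cfun_sumE (I : Type) (r : seq I) (P : pred I) (F : I -> cfun) xi :
  (\sum_(i <- r | P i) F i) xi = \sum_(i <- r | P i) F i xi.
Proof. by elim/big_rec2: _ => [//|i y z _ <-]. Qed.

(** A sample of [f] on the cylinder of [p]; the default 0 occurs only for an empty cylinder. *)
Definition cylinder_value (f : cfun) p : R[i] :=
  if cylinder_point p is Some xi then f xi else 0.

Lemma cylinder_valueD f f1 p :
  cylinder_value (f + f1) p = cylinder_value f p + cylinder_value f1 p.
Proof. by rewrite /cylinder_value; case: cylinder_point; rewrite ?addr0. Qed.

Lemma cylinder_valueZ k f p :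
  cylinder_value (cscale k f) p = k * cylinder_value f p.
Proof. by rewrite /cylinder_value; case: cylinder_point; rewrite ?mulr0. Qed.

Lemma cylinder_value_le f p : normc (cylinder_value f p) <= cnorm f.
Proof.
rewrite /cylinder_value; case: cylinder_point => [xi|]; first exact: cfun_norm_ub.
by rewrite Normc.normc0 cnorm_ge0.
Qed.

Lemma cylinder_valueP f p : no_sources E -> is_path p.1 p.2 ->
  exists2 xi, cylinder p xi & cylinder_value f p = f xi.
Proof.
move=> ns /(cylinder_pointP ns)[xi h c]; exists xi => //.
by rewrite /cylinder_value h.
Qed.

Lemma sum_paths_prefix n (P : pred (prepath E)) (c : prepath E -> R[i]) xi :
  \sum_(p <- paths E n | P p) c p * cind p xi =
  if P (inf_prefix n xi) then c (inf_prefix n xi) else 0.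
Proof.
rewrite big_mkcond (bigD1_seq _ (inf_prefix_paths n xi) (uniq_paths E n)) /=.
rewrite big1_seq ?addr0 => [|p /andP[/negPf pn pp]].
  by rewrite size_mkseq eqxx mulr1.
by rewrite (paths_size pp) pn mulr0 if_same.
Qed.

End LocallyConstant.

(** * Approximation in the ideals by indicators of cylinders *)

Section Density.
Context (R : realType) (G : groupType) (E : digraph) (phi : self_similar_action G E).
Local Notation inf_path := (inf_path E).
Local Notation cfun := (cfun R (compact_inf_path (E := E))).
Local Notation normc := Normc.normc.
Local Notation sigma := (@sge_sigma G E phi).
Implicit Types (p q : prepath E) (xi eta : inf_path) (f : cfun) (g : sge_group phi).

Definition ideal_of g : set cfun := [set f | forall xi, ~ Fset g xi -> f xi = 0].

(** Good cylinders lie in [F_g] and exhaust it. Goodness passes to extensions, but a bad path may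
    have good extensions. *)
Definition good_path g p := exists2 s, sigma s = g & tleft s = p.

Lemma good_path_rcons g p e : is_path (path_rcons p e).1 (path_rcons p e).2 ->
  good_path g p -> good_path g (path_rcons p e).
Proof.
move=> pp [s sg sp].
have [|u us ul] := @sge_mul_restrict _ _ _ s _ pp [:: e].
  by rewrite /path_rcons cats1 sp.
exists u => //; by rewrite (sge_sigmaM us) sge_sigma1 // mul1g.
Qed.

Lemma good_path_le g m n xi : (m <= n)%N ->
  good_path g (inf_prefix m xi) -> good_path g (inf_prefix n xi).
Proof.
move=> /subnK <-; elim: (n - m)%N => // k IH h.
rewrite addSn inf_prefixS; apply: good_path_rcons; last exact: IH.
by rewrite -inf_prefixS; exact: inf_prefix_path.
Qed.

Lemma Fset_good g xi : Fset g xi <-> exists n, good_path g (inf_prefix n xi).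
Proof.
split=> [[s /= sg /(cylinder_prefix _ (tleft_path s)) h]|[n [s sg sp]]].
  by exists (size (tleft s).2), s.
by exists s => //=; rewrite sp; exact: cylinder_inf_prefix.
Qed.

Lemma ideal_cind s : ideal_of (sigma s) (cind R (tleft s)).
Proof.
move=> xi h; rewrite cindE ?tleft_path //; case: asboolP => // c.
by case: h; exists s.
Qed.

(** Uniform continuity together with vanishing towards the boundary of [F_g]. A point of [F_g] has a
    good prefix; at any other point [f] is 0, hence small nearby. [inf_path_fan] makes the length
    uniform. *)
Lemma ideal_oscillation g f (e : R) : ideal_of g f -> 0 < e ->
  exists N, forall n p, (N <= n)%N -> p \in paths E n ->
    (forall xi eta, cylinder p xi -> cylinder p eta -> normc (f xi - f eta) <= e) /\
    (good_path g p \/ forall xi, cylinder p xi -> normc (f xi) <= e).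
Proof.
move=> fg e0.
pose Q p := (forall xi eta, cylinder p xi -> cylinder p eta -> normc (f xi - f eta) <= e) /\
    (good_path g p \/ forall xi, cylinder p xi -> normc (f xi) <= e).
have [p x pp [h1 h2]|xi|N hN] := @inf_path_fan E Q.
- split=> [xi eta /(cylinder_rcons pp) c1 /(cylinder_rcons pp)|]; first exact: h1.
  case: h2 => [h|h]; [left; exact: good_path_rcons|right].
  by move=> xi /(cylinder_rcons pp)/h.
- have e2 : 0 < e / 2 by rewrite divr_gt0.
  have [n1 hn1] := inf_prefix_basis (cfun_near f xi e2).
  have osc n : (n1 <= n)%N -> forall zeta, cylinder (inf_prefix n xi) zeta ->
      normc (f xi - f zeta) < e / 2.
    move=> nn zeta /(cylinder_pathsP _ (inf_prefix_paths n xi)) pz; apply: hn1.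
    by apply: inf_prefix_le nn _; rewrite -pz.
  have osc2 n : (n1 <= n)%N -> forall zeta eta, cylinder (inf_prefix n xi) zeta ->
      cylinder (inf_prefix n xi) eta -> normc (f zeta - f eta) <= e.
    move=> nn zeta eta /(osc n nn) h1 /(osc n nn) h2.
    have -> : f zeta - f eta = - (f xi - f zeta) + (f xi - f eta) by ring.
    by rewrite (le_trans (le_normcD _ _)) // normcN [leRHS]splitr lerD // ltW.
  have [/Fset_good[n2 h2]|h] := pselect (Fset g xi).
    exists (maxn n1 n2); split; first exact/osc2/leq_maxl.
    by left; exact: good_path_le (leq_maxr _ _) h2.
  exists n1; split; first exact: osc2.
  right=> zeta /(osc n1 (leqnn _)); rewrite (fg _ h) sub0r normcN => h1.
  by apply: le_trans (ltW h1) _; lra.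
- exists N => n p Nn pn.
  have [[xi c]|h] := pselect (exists xi, cylinder p xi).
    by have /(cylinder_pathsP _ pn) -> := c; exact: hN.
  split=> [xi eta c|]; first by case: h; exists xi.
  by right=> xi c; case: h; exists xi.
Qed.

(** Bad cylinders are dropped so that the step function stays in the ideal; by [ideal_oscillation]
    this costs at most [e]. *)
Definition locst g n f : cfun :=
  \sum_(p <- paths E n | `[< good_path g p >]) cscale (cylinder_value f p) (cind R p).

Lemma locst_val g n f xi : locst g n f xi =
  if `[< good_path g (inf_prefix n xi) >] then cylinder_value f (inf_prefix n xi) else 0.
Proof.
rewrite cfun_sumE.
exact: (sum_paths_prefix _ (fun p => `[< good_path g p >]) (cylinder_value f)).
Qed.

Hypothesis ns : no_sources E.

Lemma locst_approx g f (e : R) : ideal_of g f -> 0 < e ->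
  exists N, forall n, (N <= n)%N -> cnorm (locst g n f - f) <= e.
Proof.
move=> fg e0; have [N hN] := ideal_oscillation fg e0; exists N => n Nn.
apply: cfun_norm_le => [|xi]; first exact: ltW.
have -> : (locst g n f - f) xi = locst g n f xi - f xi by rewrite /= mulN1r.
rewrite locst_val; have [h1 h2] := hN n _ Nn (inf_prefix_paths n xi).
have [zeta c ->] := cylinder_valueP f ns (inf_prefix_path n xi).
case: asboolP => gp; first exact: h1 (cylinder_inf_prefix n xi).
by case: h2 => // h; rewrite sub0r normcN; exact/h/cylinder_inf_prefix.
Qed.

Lemma locst_cvg g f : ideal_of g f -> seq_cvg (fun n => locst g n f) f.
Proof. by move=> fg e /(locst_approx fg). Qed.

Lemma ideal0 g : ideal_of g 0. Proof. by []. Qed.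

Lemma idealD g f f1 : ideal_of g f -> ideal_of g f1 -> ideal_of g (f + f1).
Proof. by move=> h h1 xi /[dup] /h e /h1 e1; rewrite /= e e1 addr0. Qed.

Lemma idealZ g k f : ideal_of g f -> ideal_of g (cscale k f).
Proof. by move=> h xi /h e; rewrite /= e mulr0. Qed.

(** The step functions [locst] stay inside the ideal, so a property stable under linear combinations
    and norm limits need only be checked on cylinders. Continuity, products and adjoints are all
    handled in this way. *)
Lemma ideal_ind g (Q : cfun -> Prop) :
  Q 0 ->
  (forall f f1, ideal_of g f -> ideal_of g f1 -> Q f -> Q f1 -> Q (f + f1)) ->
  (forall k f, ideal_of g f -> Q f -> Q (cscale k f)) ->
  (forall (u : nat -> cfun) f, (forall n, ideal_of g (u n)) -> ideal_of g f ->
     seq_cvg u f -> (forall n, Q (u n)) -> Q f) ->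
  (forall s, sigma s = g -> Q (cind R (tleft s))) ->
  forall f, ideal_of g f -> Q f.
Proof.
move=> Q0 QD QZ Qlim Qc f fg.
have h n : ideal_of g (locst g n f) /\ Q (locst g n f).
  rewrite /locst; elim/big_rec: _ => [|p f1 /asboolP [s sg <-] [i1 q1]].
    by split; [exact: ideal0|].
  have i2 : ideal_of g (cscale (cylinder_value f (tleft s)) (cind R (tleft s))).
    by apply: idealZ; rewrite -sg; exact: ideal_cind.
  split; first exact: idealD.
  by apply: QD => //; apply: QZ; [rewrite -sg; exact: ideal_cind|exact: Qc].
by apply: (Qlim _ _ (fun n => (h n).1) fg (locst_cvg fg)) => n; exact: (h n).2.
Qed.

End Density.

(** * The partial action as a partial C*-dynamical system *)

Section CanonicalPartialAction.
Context (R : realType) (G : groupType) (E : digraph) (phi : self_similar_action G E).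
Local Notation inf_path := (inf_path E).
Local Notation cfun := (cfun R (compact_inf_path (E := E))).
Local Notation normc := Normc.normc.
Local Notation sigma := (@sge_sigma G E phi).
Local Notation Rel := (@sigma_graph G E phi).
Implicit Types (p q : prepath E) (xi eta : inf_path) (f : cfun) (g h : sge_group phi).
Hypotheses (Gcount : countable [set: G]) (ns : no_sources E) (pf : pseudo_free phi).
Let tildeE := @theta_tildeE G E phi pf Gcount R.

(** The point [xi] does not depend on the function, so that algebraic identities may be compared
    pointwise. *)
Lemma theta_tilde_cases g (eta : inf_path) :
  (exists2 xi, Rel g xi eta & forall f, theta_tilde g f eta = f xi) \/
  (~ Fset g eta /\ forall f, theta_tilde g f eta = 0).
Proof.
have [/FsetP[xi h]|h] := pselect (Fset g eta).
  by left; exists xi => // f; exact: tildeE.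
by right; split=> // f; exact: theta_tilde0.
Qed.

(** By single-valuedness and injectivity, a pair in the graph of [sigma s] that touches either
    cylinder of [s] is realised by [s] itself. *)
Lemma theta_tilde_cind s eta :
  theta_tilde (sigma s) (cind R (tright s)) eta = cind R (tleft s) eta.
Proof.
have [[xi h]|[nF ->]] := theta_tilde_cases (sigma s) eta; last first.
  by rewrite (ideal_cind R nF).
move=> ->; rewrite !cindE ?tleft_path ?tright_path //.
congr (_%:R); congr nat_of_bool; apply/asboolP/asboolP => c.
  have [eta' h'] := theta_graph_total c.
  rewrite (sigma_graph_fun pf Gcount h (_ : Rel _ xi eta')); last by exists s.
  exact: theta_graph_left h'.
have [xi' h'] := theta_graph_surj c.
rewrite (sigma_graph_inj pf Gcount h (_ : Rel _ xi' eta)); last by exists s.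
exact: theta_graph_right h'.
Qed.

(** On a cylinder the result is again an indicator, and continuity survives uniform limits because
    transporting values does not increase sup distances. *)
Lemma theta_tilde_cont g f : ideal_of g^-1%g f ->
  continuous (theta_tilde g f : inf_path -> R[i]^o).
Proof.
move: f; apply: (ideal_ind ns).
- apply: (@locally_constant_continuous _ _ _ 0) => xi eta _.
  have tt0 (x : inf_path) : theta_tilde g (0 : cfun) x = 0.
    by have [[? _ ->]|[_ ->]] := theta_tilde_cases g x.
  by rewrite !tt0.
- move=> f f1 _ _ cf cf1.
  have -> : theta_tilde g (f + f1) = (CFun (compact_inf_path (E := E)) cf +
      CFun (compact_inf_path (E := E)) cf1 : cfun).
    apply/funext => x; rewrite [RHS]/=.
    by have [[? _ e]|[_ e]] := theta_tilde_cases g x; rewrite !e ?addr0.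
  exact: cfun_cont.
- move=> k f _ cf.
  have -> : theta_tilde g (cscale k f) =
      cscale k (CFun (compact_inf_path (E := E)) cf : cfun).
    apply/funext => x; rewrite [RHS]/=.
    by have [[? _ e]|[_ e]] := theta_tilde_cases g x; rewrite !e ?mulr0.
  exact: cfun_cont.
- move=> u f _ _ uf cu; apply/cont_normcP => x e e0.
  have e3 : 0 < e / 3 by rewrite divr_gt0.
  have [N hN] := uf _ e3.
  have uN y : normc (theta_tilde g f y - theta_tilde g (u N) y) <= e / 3.
    have [[z _ h]|[_ h]] := theta_tilde_cases g y; rewrite !h; last first.
      by rewrite subrr Normc.normc0 ltW.
    apply: le_trans (hN N (leqnn N)); rewrite -normcN opprB.
    by have := cfun_norm_ub (u N - f) z; rewrite /= mulN1r.
  apply: filterS ((cont_normcP _).1 (cu N) x _ e3) => y hy.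
  have -> : theta_tilde g f x - theta_tilde g f y =
    (theta_tilde g f x - theta_tilde g (u N) x) +
    ((theta_tilde g (u N) x - theta_tilde g (u N) y) -
     (theta_tilde g f y - theta_tilde g (u N) y)) by ring.
  have -> : e = e / 3 + (e / 3 + e / 3) by lra.
  rewrite (le_lt_trans (le_normcD _ _)) // ler_ltD //.
  by rewrite (le_lt_trans (le_normcD _ _)) // normcN ltr_leD.
- move=> s sg.
  have -> : theta_tilde g (cind R (tleft s)) = cind R (tright s).
    apply/funext => x; have := theta_tilde_cind (tstar s) x.
    by rewrite sge_sigmaV sg invgK.
  exact: cfun_cont.
Qed.

Definition canonical_act g f : cfun :=
  if pselect (ideal_of g^-1%g f) is left h then
    CFun (compact_inf_path (E := E)) (theta_tilde_cont h)
  else f.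

Lemma canonical_actE g f : ideal_of g^-1%g f -> canonical_act g f =1 theta_tilde g f.
Proof. by move=> h x; rewrite /canonical_act; case: pselect. Qed.

Lemma canonical_act_rel g f xi eta : ideal_of g^-1%g f -> Rel g xi eta ->
  canonical_act g f eta = f xi.
Proof. by move=> h r; rewrite canonical_actE // (tildeE _ r). Qed.

Lemma canonical_act_in g f : ideal_of g^-1%g f -> ideal_of g (canonical_act g f).
Proof. by move=> h x nF; rewrite canonical_actE // theta_tilde0. Qed.

Lemma canonical_act_cases g eta :
  (exists2 xi, Rel g xi eta &
     forall f, ideal_of g^-1%g f -> canonical_act g f eta = f xi) \/
  (~ Fset g eta /\ forall f, ideal_of g^-1%g f -> canonical_act g f eta = 0).
Proof.
have [[xi h e]|[nF e]] := theta_tilde_cases g eta.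
  by left; exists xi => // f /canonical_actE ->.
by right; split=> // f /canonical_actE ->.
Qed.

Lemma ideal1 f : ideal_of (1%g : sge_group phi) f.
Proof. by move=> x []; apply/FsetP; exists x; exact: sigma_graph1. Qed.

Lemma idealMl g f f1 : ideal_of g f1 -> ideal_of g (f * f1).
Proof. by move=> h x /h e; rewrite /= e mulr0. Qed.

Lemma idealMr g f f1 : ideal_of g f -> ideal_of g (f * f1).
Proof. by move=> h x /h e; rewrite /= e mul0r. Qed.

Lemma ideal_closed g : seq_closed (@ideal_of R G E phi g).
Proof.
move=> u f hu uf x nF; apply/Normc.eq0_normc/le_anti; rewrite normc_ge0 andbT.
apply/ler_addgt0Pr => e e0; rewrite add0r; have [N /(_ N (leqnn N)) hN] := uf _ e0.
apply: le_trans hN; have := cfun_norm_ub (u N - f) x.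
by rewrite /= (hu N x nF) add0r mulN1r normcN.
Qed.

Lemma ideal_star g f : ideal_of g f -> ideal_of g (star f).
Proof. by move=> h x /h e; rewrite /= e conjc0. Qed.

Lemma canonical_act_inj g f f1 : ideal_of g^-1%g f -> ideal_of g^-1%g f1 ->
  canonical_act g f = canonical_act g f1 -> f = f1.
Proof.
move=> hf hf1 e; apply: cfunP => x.
have [/FsetVP[y r]|nF] := pselect (Fset g^-1%g x); last by rewrite hf ?hf1.
by rewrite -(canonical_act_rel hf r) -(canonical_act_rel hf1 r) e.
Qed.

Lemma canonical_act_surj g f : ideal_of g f ->
  exists2 f1, ideal_of g^-1%g f1 & canonical_act g f1 = f.
Proof.
move=> hf; have hf' : ideal_of (g^-1)^-1%g f by rewrite invgK.
have h1 := canonical_act_in hf'; exists (canonical_act g^-1%g f) => //.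
apply: cfunP => y; have [[x r ->]//|[nF ->]//] := canonical_act_cases g y.
  by rewrite (canonical_act_rel hf' (sigma_graphV r)).
by rewrite hf.
Qed.

Lemma canonical_act_add g f f1 : ideal_of g^-1%g f -> ideal_of g^-1%g f1 ->
  canonical_act g (f + f1) = canonical_act g f + canonical_act g f1.
Proof.
move=> h h1; apply: cfunP => y /=.
have [[x r e]|[nF e]] := canonical_act_cases g y; rewrite !e ?addr0 //;
  exact: idealD.
Qed.

Lemma canonical_act_scale g k f : ideal_of g^-1%g f ->
  canonical_act g (cscale k f) = cscale k (canonical_act g f).
Proof.
move=> h; apply: cfunP => y /=.
have [[x r e]|[nF e]] := canonical_act_cases g y; rewrite !e ?mulr0 //;
  exact: idealZ.
Qed.

Lemma canonical_act_mul g f f1 : ideal_of g^-1%g f -> ideal_of g^-1%g f1 ->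
  canonical_act g (f * f1) = canonical_act g f * canonical_act g f1.
Proof.
move=> h h1; apply: cfunP => y /=.
have [[x r e]|[nF e]] := canonical_act_cases g y; rewrite !e ?mulr0 //;
  exact: idealMr.
Qed.

Lemma canonical_act_star g f : ideal_of g^-1%g f ->
  canonical_act g (star f) = star (canonical_act g f).
Proof.
move=> h; apply: cfunP => y /=.
have [[x r e]|[nF e]] := canonical_act_cases g y; rewrite !e ?conjc0 //;
  exact: ideal_star.
Qed.

Lemma canonical_act1 f : canonical_act 1%g f = f.
Proof.
apply: cfunP => x; apply: canonical_act_rel; last exact: sigma_graph1.
by rewrite invg1; exact: ideal1.
Qed.

Lemma canonical_act_comp g h f : ideal_of h^-1%g f ->
  ideal_of g^-1%g (canonical_act h f) ->
  ideal_of (g * h)^-1%g f /\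
  canonical_act (g * h)%g f = canonical_act g (canonical_act h f).
Proof.
move=> hf hg.
(* Where [f] is nonzero, [h] is defined and takes the point into the domain of [g]; hence [g h] is
   defined there. *)
have nz x : f x <> 0 -> exists y z, Rel h x y /\ Rel g y z.
  move=> fx; have [/FsetVP[y r]|/hf//] := pselect (Fset h^-1%g x).
  have [/FsetVP[z r']|/hg] := pselect (Fset g^-1%g y); first by exists y, z.
  by rewrite (canonical_act_rel hf r).
have fgh : ideal_of (g * h)^-1%g f.
  move=> x nF; apply: contrapT => /nz[y [z [r r']]]; apply: nF.
  by apply/FsetVP; exists z; exact: sigma_graphM r r'.
split=> //; apply: cfunP => z.
have [[x r ->//]|[nF ->//]] := canonical_act_cases (g * h)%g z.
  (* If [f x = 0], the right side must vanish as well: a passage through [h] and [g] that ends at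
     [z] starts at [x] by injectivity. *)
  have [fx|/nz[y' [z' [r1 r2]]]] := pselect (f x = 0); last first.
    have e := sigma_graph_fun pf Gcount (sigma_graphM r1 r2) r; subst z'.
    by rewrite (canonical_act_rel hg r2) (canonical_act_rel hf r1).
  have [[y r1 ->//]|[nF ->//]] := canonical_act_cases g z.
  have [[x' r2 ->//]|[nF ->//]] := canonical_act_cases h y.
  by rewrite (sigma_graph_inj pf Gcount (sigma_graphM r2 r1) r).
have [[y r1 ->//]|[_ ->//]] := canonical_act_cases g z.
have [[x' r2 _]|[_ ->//]] := canonical_act_cases h y.
by case: nF; apply/FsetP; exists x'; exact: sigma_graphM r2 r1.
Qed.

Definition canonical_system : partial_system cfun (sge_group phi) :=
  PartialSystem (@ideal0 R G E phi) (@idealD R G E phi) (@idealZ R G E phi)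
    idealMl idealMr ideal_closed ideal_star canonical_act_in canonical_act_inj
    canonical_act_surj canonical_act_add canonical_act_scale canonical_act_mul
    canonical_act_star (funext (fun f => propext (conj (fun=> I) (fun=> @ideal1 f))))
    canonical_act1 canonical_act_comp.

Lemma canonical_systemP : is_canonical_partial_action canonical_system.
Proof. by split=> // g f; exact: canonical_actE. Qed.

End CanonicalPartialAction.

(** * Norm estimates in C*-algebras *)

Section CStarElementary.
Context (R : realType) (A : cstarAlgType R).
Implicit Types (a b c p q u x y : A).
Local Notation normc := Normc.normc.

Lemma normc_real (r : R) : normc r%:C = `|r|.
Proof. by rewrite /= expr0n /= addr0 sqrtr_sqr. Qed.

Lemma cscale_real_norm (r : R) a : 0 <= r -> cnorm (cscale r%:C a) = r * cnorm a.
Proof. by move=> r0; rewrite cnormZ normc_real ger0_norm. Qed.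

Lemma cscale_nat n a : cscale n%:R a = a *+ n.
Proof.
elim: n => [|n IH]; first by rewrite cscale0l.
by rewrite -natr1 cscaleDl cscale1 IH mulrSr.
Qed.

Lemma cnorm_mulrn a n : cnorm (a *+ n) = n%:R * cnorm a.
Proof. by rewrite -cscale_nat -(rmorph_nat (real_complex R)) cscale_real_norm. Qed.

Lemma cnorm_proj p : star p = p -> p * p = p -> cnorm p <= 1.
Proof.
move=> ps pp; have := cnormX p; rewrite ps pp => h.
have [->|n0] := eqVneq (cnorm p) 0; first exact: ler01.
by rewrite -(ler_pM2r (_ : 0 < cnorm p)) ?mul1r -?expr2 -?h // lt0r n0 cnorm_ge0.
Qed.

Lemma cnorm_one : cnorm (1 : A) <= 1.
Proof. by apply: cnorm_proj; rewrite ?star1 ?mulr1. Qed.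

Lemma cnorm_isometry u : star u * u = 1 -> cnorm u <= 1.
Proof.
by move=> uu; rewrite -(@expr_le1 _ 2) ?cnorm_ge0 // -cnormX uu cnorm_one.
Qed.

Lemma cnorm_sum_le (I : Type) (r : seq I) (P : pred I) (F : I -> A) :
  cnorm (\sum_(i <- r | P i) F i) <= \sum_(i <- r | P i) cnorm (F i).
Proof.
elim/big_rec2: _ => [|i s a _ h]; first by rewrite cnorm0.
by apply: le_trans (cnormD _ _) _; rewrite lerD2l.
Qed.

(* [x] is the average of the unitaries [x + iy] and [x - iy]. *)
Lemma cnorm_cos x y : star x = x -> star y = y -> x * y = y * x ->
  x * x + y * y = 1 -> cnorm x <= 1.
Proof.
move=> xs ys xy xxyy; pose i : R[i] := 0 +i* 1.
have ii : i * i = - 1 by rewrite /i; simpc.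
pose z := cscale i y; pose u := x + z; pose v := x - z.
have zs : star z = - z.
  by rewrite /z starZ ys -cscaleN1 cscaleA; congr cscale; rewrite /i /=; simpc.
have xz : x * z = z * x by rewrite /z -cscaleAr -cscaleAl xy.
have zz : z * z = - (y * y).
  by rewrite /z -cscaleAr -cscaleAl cscaleA ii cscaleN1.
have us : star u = v by rewrite /u starD xs zs.
have vs : star v = u by rewrite -us starK.
have vu : v * u = 1.
  by rewrite mulrBl !mulrDr xz opprD addrA addrK zz opprK.
have uv : u * v = 1.
  by rewrite mulrDl !mulrBr xz addrA subrK zz opprK.
have nu : cnorm u <= 1 by apply: cnorm_isometry; rewrite us.
have nv : cnorm v <= 1 by apply: cnorm_isometry; rewrite vs.
rewrite -(ler_pM2l (_ : 0 < 2)) // -(cnorm_mulrn x 2) mulr2n.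
have -> : x + x = u + v by rewrite /u /v addrACA addrN addr0.
by rewrite mulr1 (le_trans (cnormD _ _)) // -[2]/(1 + 1) lerD.
Qed.

(** * The unit of a corner is an extreme point of its unit ball *)

Section Corner.
Variable q : A.
Hypotheses (qs : star q = q) (qq : q * q = q).

Lemma corner_sqr x : q * x = x -> x * q = x ->
  (q + x) * (q + x) = q + x *+ 2 + x * x.
Proof. by move=> qx xq; rewrite mulrDl !mulrDr qq qx xq mulr2n !addrA. Qed.

Lemma corner_cube x : q * x = x -> x * q = x ->
  (q + x) * (q + x) * (q + x) = q + x *+ 3 + (x * x) *+ 3 + x * x * x.
Proof.
move=> qx xq; have xxq : x * x * q = x * x by rewrite -mulrA xq.
rewrite corner_sqr // mulr2n mulrDr !mulrDl qq qx !xq xxq !mulrS !mulr0n !addr0.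
by rewrite (AC (((1*2)*1)*((1*2)*1)) (((1*(2*(3*5)))*(4*(6*7)))*8)).
Qed.

Lemma corner_cubeN x : q * x = x -> x * q = x ->
  (q - x) * (q - x) * (q - x) = q - x *+ 3 + (x * x) *+ 3 - x * x * x.
Proof.
move=> qx xq; rewrite corner_cube; [|by rewrite mulrN qx|by rewrite mulNr xq].
by rewrite mulrNN mulrN mulNrn.
Qed.

Lemma sub_even (V : zmodType) (e x y : V) : (e + x + y) - (e - x + y) = x *+ 2.
Proof. by rewrite opprD addrACA subrr addr0 opprD opprK addrACA subrr add0r. Qed.

Lemma add_even (V : zmodType) (e x y : V) : (e + x + y) + (e - x + y) = (e + y) *+ 2.
Proof. by rewrite addrACA [X in X + _]addrACA subrr addr0 mulr2n addrACA. Qed.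

(** The directions in which [q] could fail to be extreme: the segment from [q - a] to [q + a] stays
    in the unit ball. *)
Let radial a := [/\ star a = a, q * a = a, a * q = a,
  cnorm (q + a) <= 1 & cnorm (q - a) <= 1].

Lemma radialN a : radial a -> radial (- a).
Proof.
move=> [h1 h2 h3 h4 h5].
by split; rewrite ?starN ?h1 ?mulrN ?mulNr ?h2 ?h3 ?opprK.
Qed.

Lemma le_mul1 a b : cnorm a <= 1 -> cnorm b <= 1 -> cnorm (a * b) <= 1.
Proof.
move=> ha hb; apply: le_trans (cnormM _ _) _.
by rewrite -[leRHS]mulr1 ler_pM ?cnorm_ge0.
Qed.

(** [4a] is the difference of the squares of [q + a] and [q - a], both in the unit ball. *)
Lemma radial_half a : radial a -> cnorm a <= 1 / 2.
Proof.
move=> [_ qa aq h1 h2].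
have e : a *+ 4 = (q + a) * (q + a) - (q - a) * (q - a).
  rewrite !corner_sqr ?mulrN ?mulNr ?qa ?aq // opprK mulNrn sub_even.
  by rewrite -mulrnA.
have : cnorm (a *+ 4) <= 1 + 1.
  by rewrite e (le_trans (cnormB _ _)) // lerD // le_mul1.
rewrite cnorm_mulrn; lra.
Qed.

(* A convex combination of products of elements [q + ia], [q - ia], [q + a] of
   the unit ball has linear coefficient > 1. *)
Lemma radial_cube_ball a : radial a ->
  cnorm (q *+ 4 + a *+ 6 + (a * a * a) *+ 2) <= 4.
Proof.
move=> [sa qa aq h1 h2]; pose i : R[i] := 0 +i* 1.
have ii : i * i = - 1 by rewrite /i; simpc.
pose z := cscale i a.
have zs : star z = - z.
  by rewrite /z starZ sa -cscaleN1 cscaleA; congr cscale; rewrite /i /=; simpc.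
have qz : q * z = z by rewrite /z -cscaleAr qa.
have zq : z * q = z by rewrite /z -cscaleAl aq.
have zz : z * z = - (a * a).
  by rewrite /z -cscaleAr -cscaleAl cscaleA ii cscaleN1.
(* [q + a a] is the average of the squares of [q + a] and [q - a]; by the C*-identity it controls
   [q + ia] and [q - ia]. *)
have qaa : cnorm (q + a * a) <= 1.
  have e : (q + a * a) *+ 2 = (q + a) * (q + a) + (q - a) * (q - a).
    by rewrite !corner_sqr ?mulrN ?mulNr ?qa ?aq // opprK mulNrn add_even.
  have : cnorm ((q + a * a) *+ 2) <= 1 + 1.
    by rewrite e (le_trans (cnormD _ _)) // lerD // le_mul1.
  rewrite cnorm_mulrn; lra.
have hz : (q - z) * (q + z) = q + a * a.
  by rewrite mulrBl !mulrDr qq qz zq zz opprD addrA addrK opprK.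
have hz' : (q + z) * (q - z) = q + a * a.
  by rewrite mulrDl !mulrBr qq qz zq zz addrA subrK opprK.
have nz1 : cnorm (q + z) <= 1.
  by rewrite -(@expr_le1 _ 2) ?cnorm_ge0 // -cnormX starD zs qs hz.
have nz2 : cnorm (q - z) <= 1.
  by rewrite -(@expr_le1 _ 2) ?cnorm_ge0 // -cnormX starB zs qs opprK hz'.
(* The odd parts of the cubes of [q + z] and [q - z] cancel, and together they contribute [-6 a a],
   which removes the quadratic part of [2 (q + a)^3]. *)
have e : q *+ 4 + a *+ 6 + (a * a * a) *+ 2 =
    ((q + a) * (q + a) * (q + a)) *+ 2 +
    ((q + z) * (q + z) * (q + z) + (q - z) * (q - z) * (q - z)).
  rewrite corner_cubeN // !corner_cube //.
  rewrite [X in _ = _ + X]addrACA subrr addr0 add_even -mulrnDl.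
  rewrite zz mulNrn (addrAC _ (a * a *+ 3)) [X in _ = X *+ 2]addrACA subrr addr0.
  rewrite (addrAC _ _ q) (addrAC _ _ q) -mulr2n mulrnDl.
  by rewrite [(_ + a *+ 3) *+ 2]mulrnDl -!mulrnA.
rewrite e (le_trans (cnormD _ _)) // cnorm_mulrn.
have n3 b : cnorm b <= 1 -> cnorm (b * b * b) <= 1 by move=> ?; rewrite !le_mul1.
have h3 := n3 _ h1.
apply: (@le_trans _ _ (2 * 1 + (1 + 1))); last lra.
by rewrite lerD ?ler_pM2l // (le_trans (cnormD _ _)) // lerD // n3.
Qed.

(** The cubic bound makes [d = (3b + b^3)/2] radial along with [b]. As the norm of [b] is at most
    1/2, that of [b^3] is at most a quarter of it, and [3b = 2d - b^3] bounds 11/4 of the norm of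
    [b] by twice the supremum over radial elements: this is the factor 8/11. Being less than 1, it
    forces the supremum to vanish. *)
Lemma radial_eq0 a : radial a -> a = 0.
Proof.
pose S := [set r | exists2 b, radial b & r = cnorm b].
have Sub : has_ubound S by exists (1 / 2) => _ [b /radial_half hb ->].
have grow b : radial b -> cnorm b <= 8 / 11 * sup S.
  move=> /[dup] rb [sb qb bq _ _].
  pose d := cscale (2^-1)%:C (b *+ 3 + b * b * b).
  have d2 : d *+ 2 = b *+ 3 + b * b * b.
    rewrite -[LHS]cscale_nat /d cscaleA -(rmorph_nat (real_complex R)) -rmorphM.
    by rewrite divff ?pnatr_eq0 // rmorph1 cscale1.
  have dball c : q * c = c -> c * q = c -> radial c ->
      cnorm (q + cscale (2^-1)%:C (c *+ 3 + c * c * c)) <= 1.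
    move=> qc cq rc; have := radial_cube_ball rc.
    have -> : q *+ 4 + c *+ 6 + (c * c * c) *+ 2 =
        (q + cscale (2^-1)%:C (c *+ 3 + c * c * c)) *+ 4.
      rewrite mulrnDl -addrA; congr (_ + _).
      rewrite -[RHS]cscale_nat cscaleA.
      have -> : 4%:R * (2^-1)%:C = 2%:R :> R[i].
        by rewrite -!(rmorph_nat (real_complex R)) -rmorphM; congr (_%:C); lra.
      by rewrite cscale_nat mulrnDl -mulrnA.
    rewrite cnorm_mulrn; lra.
  have rd : radial d.
    split; last 2 first.
    - exact: dball.
    - have [_ qb' bq' _ _] := radialN rb.
      have := dball _ qb' bq' (radialN rb); rewrite mulrNN mulrN mulNrn -opprD.
      by rewrite -cscaleN1 cscaleA mulrC -cscaleA cscaleN1.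
    - rewrite /d starZ starD !starM sb -!cscale_nat starZ sb mulrA conjc_real.
      by rewrite -(rmorph_nat (real_complex R)) conjc_real.
    - by rewrite /d -cscaleAr mulrDr -!cscale_nat -cscaleAr !mulrA qb.
    - by rewrite /d -cscaleAl mulrDl -!cscale_nat -cscaleAl -!mulrA bq.
  have dS : cnorm d <= sup S by apply: ub_le_sup => //; exists d.
  have h3 : cnorm (b *+ 3) <= cnorm (d *+ 2) + cnorm (b * b * b).
    by have := cnormB (d *+ 2) (b * b * b); rewrite {1}d2 addrK.
  have hb := radial_half rb.
  have hbbb : cnorm (b * b * b) <= 1 / 4 * cnorm b.
    apply: le_trans (cnormM _ _) _; rewrite ler_wpM2r ?cnorm_ge0 //.
    apply: le_trans (cnormM _ _) _.
    by apply: (@le_trans _ _ (1 / 2 * (1 / 2))); [rewrite ler_pM ?cnorm_ge0|lra].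
  rewrite !cnorm_mulrn in h3; lra.
move=> ra; apply: cnorm_eq0; apply/le_anti; rewrite cnorm_ge0 andbT.
have s0 : sup S <= 8 / 11 * sup S.
  by apply: ge_sup => [|_ [b rb ->]]; [exists (cnorm a), a|exact: grow].
have := grow a ra; lra.
Qed.

End Corner.
End CStarElementary.

(** * Orthogonality of projections and contractivity on C(X) *)

Section OrthogonalProjections.
Context (R : realType) (A : cstarAlgType R).
Local Notation normc := Normc.normc.

(** The compressions [c k] of the [q k] to the corner of [q i], over [k != i], sum to 0. In place of
    positivity: [n q i + c j] is a sum of [n] contractions [q i (1 - q k) q i], which makes
    [c j / n] radial in the corner, hence 0. *)
Lemma sum_proj1_orthogonal (I : finType) (q : I -> A) :
  (forall i, star (q i) = q i) -> (forall i, q i * q i = q i) ->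
  \sum_i q i = 1 -> forall i j, i != j -> q i * q j = 0.
Proof.
move=> qs qq q1.
have qn i : cnorm (q i) <= 1 by exact: cnorm_proj.
have n3 i b : cnorm b <= 1 -> cnorm (q i * b * q i) <= 1.
  by move=> hb; rewrite !le_mul1.
suff h i j : i != j -> q i * q j * q i = 0.
  move=> i j ij; apply/cnorm_eq0/eqP; rewrite -sqrf_eq0 -cnormX starM !qs.
  have -> : q j * q i * (q i * q j) = q j * q i * q j.
    by rewrite mulrA -(mulrA (q j)) qq.
  by rewrite h ?cnorm0 // eq_sym.
move=> ij; pose c k := q i * q k * q i.
have cE : \sum_(k | (k != i) && (k != j)) c k = - c j.
  apply/eqP; rewrite -addr_eq0 addrC; apply/eqP.
  have -> : c j + \sum_(k | (k != i) && (k != j)) c k = \sum_(k | k != i) c k.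
    by rewrite [RHS](bigD1 j) // eq_sym.
  apply: (addrI (c i)); have -> : c i + \sum_(k | k != i) c k = \sum_k c k.
    by rewrite [RHS](bigD1 i).
  by rewrite addr0 /c -mulr_suml -mulr_sumr q1 mulr1 !qq.
have qi_c k : q i - c k = q i * (1 - q k) * q i.
  by rewrite mulrBr mulrBl mulr1 qq.
have cproj k : cnorm (1 - q k) <= 1.
  apply: cnorm_proj; first by rewrite starB star1 qs.
  by rewrite mulrBl mul1r mulrBr mulr1 qq subrr subr0.
have h1 k : cnorm (q i - c k) <= 1 by rewrite qi_c n3.
pose n := #|[pred k | (k != i) && (k != j)]|.
have h2 : cnorm (q i *+ n + c j) <= n%:R.
  have -> : q i *+ n + c j = \sum_(k | (k != i) && (k != j)) (q i - c k).
    by rewrite big_split /= sumr_const sumrN cE opprK.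
  apply: le_trans (cnorm_sum_le _ _ _) _.
  apply: (@le_trans _ _ (\sum_(k | (k != i) && (k != j)) 1)); first exact: ler_sum.
  by rewrite sumr_const.
have [n0|n0] := posnP n.
  apply: cnorm_eq0; apply/le_anti; rewrite cnorm_ge0 andbT -/(c j).
  by move: h2; rewrite n0 add0r.
have nR : 0 < n%:R :> R by rewrite ltr0n.
pose a := cscale (n%:R^-1)%:C (c j).
have an : c j = a *+ n.
  rewrite -cscale_nat cscaleA -(rmorph_nat (real_complex R)) -rmorphM.
  by rewrite divff ?gt_eqF // rmorph1 cscale1.
suff a0 : a = 0 by rewrite -/(c j) an a0 mul0rn.
apply: (radial_eq0 (qs i) (qq i)); split.
- by rewrite /a starZ /c !starM !qs mulrA conjc_real.
- by rewrite /a -cscaleAr /c !mulrA qq.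
- by rewrite /a -cscaleAl /c -!mulrA qq.
- by rewrite -(ler_pM2l nR) mulr1 -cnorm_mulrn mulrnDl -an.
(* [n q i - c j] consists of [n - 1] copies of [q i] and the contraction [q i - c j]. *)
- rewrite -(ler_pM2l nR) mulr1 -cnorm_mulrn mulrnBl -an.
  rewrite -(prednK n0) mulrSr -addrA -natr1.
  apply: le_trans (cnormD _ _) _; apply: lerD => //.
  by rewrite cnorm_mulrn ler_piMr.
Qed.

Section OrthogonalSum.
Context (I : eqType) (r : seq I) (e : I -> A).
Hypotheses (ru : uniq r) (es : forall i, star (e i) = e i)
  (ee : {in r, forall i, e i * e i = e i})
  (eo : {in r &, forall i j, i != j -> e i * e j = 0}).

Lemma orth_sumM (c d : I -> R[i]) :
  (\sum_(i <- r) cscale (c i) (e i)) * (\sum_(i <- r) cscale (d i) (e i)) =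
  \sum_(i <- r) cscale (c i * d i) (e i).
Proof.
rewrite mulr_suml; apply: eq_big_seq => i ir; rewrite mulr_sumr.
rewrite (bigD1_seq i) //= big1_seq ?addr0 => [|j /andP[ij jr]].
  by rewrite -cscaleAl -cscaleAr ee // cscaleA.
by rewrite -cscaleAl -cscaleAr eo ?cscale0r // eq_sym.
Qed.

Lemma orth_sum_norm_real (c : I -> R) : {in r, forall i, 0 <= c i <= 1} ->
  cnorm (\sum_(i <- r) cscale (c i)%:C (e i)) <= 1.
Proof.
(* The [e i] need not sum to 1, and off their sum the partner of [x] has to be 1; it is therefore
   written [1 + y], which accounts for the [- 1]. *)
move=> c01; pose s i := Num.sqrt (1 - c i ^+ 2) - 1.
pose x := \sum_(i <- r) cscale (c i)%:C (e i).
pose y := \sum_(i <- r) cscale (s i)%:C (e i).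
have sS (d : I -> R) : star (\sum_(i <- r) cscale (d i)%:C (e i)) =
    \sum_(i <- r) cscale (d i)%:C (e i).
  rewrite (big_morph _ (@starD _ _) (@star0 _ _)); apply: eq_bigr => i _.
  by rewrite starZ es conjc_real.
have xy : x * y = y * x.
  by rewrite !orth_sumM; apply: eq_bigr => i _; rewrite mulrC.
have yy : y * y + y *+ 2 = - (x * x).
  rewrite !orth_sumM mulr2n -!big_split -sumrN; apply: eq_big_seq => i ir /=.
  rewrite -!cscaleDl -cscaleN1 cscaleA; congr cscale.
  rewrite -!rmorphM -!rmorphD mulN1r -rmorphN; congr (_%:C).
  have /andP[c0 c1] := c01 i ir.
  have h : Num.sqrt (1 - c i ^+ 2) ^+ 2 = 1 - c i ^+ 2.
    by rewrite sqr_sqrtr // subr_ge0 expr_le1.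
  rewrite /s; move: h; rewrite !expr2; lra.
apply: (@cnorm_cos _ _ x (1 + y)) => //.
- exact: sS.
- by rewrite starD star1; congr (_ + _); exact: sS.
- by rewrite mulrDr mulrDl mulr1 mul1r xy.
- rewrite mulrDl !mulrDr !mul1r mulr1 -(addrA 1) (addrA y y) -mulr2n (addrC (y *+ 2)) yy.
  by rewrite addrCA subrr addr0.
Qed.

Lemma orth_sum_norm (c : I -> R) (M : R) : {in r, forall i, 0 <= c i <= M} ->
  0 <= M -> cnorm (\sum_(i <- r) cscale (c i)%:C (e i)) <= M.
Proof.
move=> cM; rewrite le_eqVlt => /orP[/eqP M0|M0].
  rewrite big1_seq ?cnorm0 -?M0 // => i /andP[_ /cM]; rewrite -M0 => /le_anti <-.
  by rewrite cscale0l.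
have -> : \sum_(i <- r) cscale (c i)%:C (e i) =
    cscale M%:C (\sum_(i <- r) cscale (c i / M)%:C (e i)).
  rewrite (big_morph _ (@cscaleDr _ _ _) (@cscale0r _ _ _)); apply: eq_bigr => i _.
  by rewrite cscaleA -rmorphM mulrC divfK // gt_eqF.
rewrite (cscale_real_norm _ (ltW M0)) (ler_piMr (ltW M0)) //; apply: orth_sum_norm_real.
move=> i /cM /andP[c0 c1]; rewrite (divr_ge0 c0 (ltW M0)) /=.
by rewrite ler_pdivrMr // mul1r.
Qed.

End OrthogonalSum.

(** By the C*-identity it is enough to treat [star f * f], rescaled to a function [k] with values in
    [0, 1]; its partner, the square root of [1 - k^2], is again continuous, so [cnorm_cos] applies
    to the images. *)
Lemma cfun_hom_contractive (X : topologicalType) (cX : compact [set: X])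
    (h : cfun R cX -> A) : is_star_hom h -> forall f, cnorm (h f) <= cnorm f.
Proof.
move=> sh f; have h0 : h 0 = 0.
  by apply: (addrI (h 0)); rewrite -(sh_add sh) !addr0.
have [->|f0] := eqVneq f 0; first by rewrite h0 !cnorm0.
have nf : 0 < cnorm f.
  by rewrite lt0r cnorm_ge0 andbT; apply: contra_neq f0 => /cnorm_eq0.
pose M := cnorm f; pose k x : R := (normc (f x) / M) ^+ 2.
have k01 x : 0 <= k x <= 1.
  have fM0 : 0 <= normc (f x) / M by rewrite (divr_ge0 (normc_ge0 _) (ltW nf)).
  by rewrite /k sqr_ge0 expr_le1 // ler_pdivrMr // mul1r cfun_norm_ub.
have real_cont (u : X -> R) : continuous u ->
    continuous ((fun x => (u x)%:C) : X -> R[i]^o).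
  move=> cu; apply/cont_normcP => x e e0; have /cvgrPdist_lt/(_ e e0) := cu x.
  by apply: filterS => y; rewrite -rmorphB normc_real.
have ckf : continuous (fun x => normc (f x)).
  move=> x; apply/cvgrPdist_lt => e e0; apply: filterS (cfun_near f x e0) => y.
  apply: le_lt_trans.
  have tri (a b : R[i]) : normc a - normc b <= normc (a - b).
    by rewrite lerBlDr -[in leLHS](subrK b a) le_normcD.
  rewrite ler_norml tri andbT lerNl opprB (le_trans (tri _ _)) //.
  by rewrite -normcN opprB.
have ck : continuous k.
  move=> x; rewrite /k; under eq_fun do rewrite expr2.
  by apply: cvgM; (apply: cvgM; [exact: ckf|exact: cvg_cst]).
have cs : continuous (fun x => Num.sqrt (1 - k x ^+ 2)).
  move=> x; apply: continuous_comp; last exact: sqrt_continuous.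
  apply: cvgB; first exact: cvg_cst.
  under eq_fun do rewrite expr2.
  by apply: cvgM; exact: ck.
pose g := CFun cX (real_cont _ ck); pose s := CFun cX (real_cont _ cs).
have gs : star g = g by apply: cfunP => x /=; rewrite oppr0.
have ss : star s = s by apply: cfunP => x /=; rewrite oppr0.
have gE : cscale (M ^+ 2)%:C g = star f * f.
  apply: cfunP => x /=; rewrite -rmorphM /k exprMn exprVn mulrC divfK; last first.
    by rewrite sqrf_eq0 gt_eqF.
  case: (f x) => a b /=; rewrite sqr_sqrtr ?addr_ge0 ?sqr_ge0 //.
  by simpc; rewrite !expr2 mulrC; congr (_ +i* _); ring.
have hg : cnorm (h g) <= 1.
  apply: (@cnorm_cos _ _ (h g) (h s)).
  - by rewrite -(sh_star sh) gs.
  - by rewrite -(sh_star sh) ss.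
  - by rewrite -!(sh_mul sh); congr h; apply: cfunP => x /=; rewrite mulrC.
  - rewrite -!(sh_mul sh) -(sh_add sh) -(sh_one sh); congr h; apply: cfunP => x.
    have /andP[k0 k1] := k01 x.
    rewrite [LHS]/= -!rmorphM -rmorphD -!expr2 sqr_sqrtr; last first.
      by rewrite subr_ge0 expr_le1.
    by rewrite addrC subrK.
rewrite -(ler_pXn2r (_ : 0 < 2)%N) ?nnegrE ?cnorm_ge0 //.
rewrite -[leLHS]cnormX -(sh_star sh) -(sh_mul sh) -gE (sh_scale sh).
by rewrite (cscale_real_norm _ (sqr_ge0 _)) (ler_piMr (sqr_ge0 _)).
Qed.

End OrthogonalProjections.

(** * Universal C*-algebras and formal sums *)

Section UniversalHom.
Context (R : realType) (X : Type) (rel : forall B : cstarAlgType R, (X -> B) -> Prop).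
Hypothesis gen_bounded : forall x, cbounded rel (CGen x).
Local Notation U := (univ_cstar rel).
Local Notation gen := (@univ_gen R X rel).

Lemma star_hom_ceval (A B : cstarAlgType R) (f : A -> B) (rho : X -> A) t :
  is_star_hom f -> f (ceval rho t) = ceval (f \o rho) t.
Proof.
move=> sh; elim: t => [x||s IHs t IHt|s IHs t IHt|k t IH|t IH] //=.
- exact: sh_one.
- by rewrite (sh_add sh) IHs IHt.
- by rewrite (sh_mul sh) IHs IHt.
- by rewrite (sh_scale sh) IH.
- by rewrite (sh_star sh) IH.
Qed.

Lemma univ_hom_ceval (B : cstarAlgType R) (rho : X -> B) t : rel rho ->
  univ_hom rho (ceval gen t : U) = ceval rho t.
Proof.
move=> rr; rewrite (star_hom_ceval _ _ (univ_hom_is_star_hom rr)).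
by congr ceval; apply/funext => x /=; apply: univ_hom_gen.
Qed.

Lemma univ_dense (a : U) (e : R) : 0 < e -> exists t, cnorm (a - ceval gen t) <= e.
Proof.
move=> e0; have [t [_ ht]] := univ_hom_approx a e0; exists t.
apply: univ_norm_le => [|B rho rr]; first exact: ltW.
rewrite univ_homD // univ_homN // univ_hom_ceval //.
exact: ht.
Qed.

Lemma star_hom0 (A B : cstarAlgType R) (f : A -> B) : is_star_hom f -> f 0 = 0.
Proof. by move=> sh; apply: (addrI (f 0)); rewrite -(sh_add sh) !addr0. Qed.

Lemma star_homB (A B : cstarAlgType R) (f : A -> B) a b :
  is_star_hom f -> f (a - b) = f a - f b.
Proof. by move=> sh; rewrite (sh_add sh) -cscaleN1 (sh_scale sh) cscaleN1. Qed.

(** Terms in the generators are dense, and contractivity carries equality to the limit. For maps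
    given by the universal property it is built into the norm. *)
Lemma univ_star_hom_eq (B : cstarAlgType R) (f f' : U -> B) :
  is_star_hom f -> is_star_hom f' ->
  (forall a, cnorm (f a) <= cnorm a) -> (forall a, cnorm (f' a) <= cnorm a) ->
  (forall x, f (gen x) = f' (gen x)) -> f =1 f'.
Proof.
move=> sh sh' cf cf' fg a; apply/eqP; rewrite -subr_eq0; apply/eqP/cnorm_eq0/le_anti.
rewrite cnorm_ge0 andbT; apply/ler_addgt0Pr => e e0; rewrite add0r.
have e2 : 0 < e / 2 by rewrite divr_gt0.
have [t ht] := univ_dense a e2.
have ft : f (ceval gen t) = f' (ceval gen t).
  rewrite (star_hom_ceval _ _ sh) (star_hom_ceval _ _ sh').
  by congr ceval; apply/funext => x /=.
rewrite (splitr e); apply: le_trans (cnorm_tri (f (ceval gen t)) _ _) _.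
rewrite {2}ft -(star_homB _ _ sh) -(star_homB _ _ sh') lerD //.
  exact: le_trans (cf _) ht.
by apply: le_trans (cf' _) _; rewrite cnorm_dist.
Qed.

End UniversalHom.

Lemma fsbigT_split (I : choiceType) (V : nmodType) (u v : I -> V) :
  finite_set [set i | u i != 0] -> finite_set [set i | v i != 0] ->
  \sum_(i \in [set: I]) (u i + v i) =
  \sum_(i \in [set: I]) u i + \sum_(i \in [set: I]) v i.
Proof.
move=> fu fv; have fuv : finite_set ([set i | u i != 0] `|` [set i | v i != 0]).
  by rewrite finite_setU.
pose A := fset_set ([set i | u i != 0] `|` [set i | v i != 0]).
have out i : i \notin A -> u i = 0 /\ v i = 0.
  rewrite in_fset_set // notin_setE => /not_orP[] /negP.
  by rewrite negbK => /eqP -> /negP; rewrite negbK => /eqP ->.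
rewrite !(fsbigTE A) -?big_split //; by move=> i /out[eu ev]; rewrite ?eu ?ev ?addr0.
Qed.

(** * Homomorphisms on formal sums *)

Section FormalSums.
Context (R : realType) (A : cstarAlgType R) (H : groupType).
Variable P : partial_system A H.
Local Notation D := (pdom P).
Local Notation theta := (pact P).
Local Notation fsum := (fsum P).
Implicit Types (f : fsum).

Lemma fsum_delta_eq g g' a a' (Da : D g a) (Da' : D g' a') :
  g = g' -> a = a' -> fsum_delta Da = fsum_delta Da'.
Proof. by move=> gg aa; apply: fsumP => h /=; rewrite gg aa. Qed.

Lemma fsum_deltaD g a b (Da : D g a) (Db : D g b) (Dab : D g (a + b)) :
  fsum_delta Dab = fsum_add (fsum_delta Da) (fsum_delta Db).
Proof. by apply: fsumP => h /=; case: ifP; rewrite ?addr0. Qed.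

Lemma fsum_deltaZ g k a (Da : D g a) (Dka : D g (cscale k a)) :
  fsum_delta Dka = fsum_scale k (fsum_delta Da).
Proof. by apply: fsumP => h /=; case: ifP; rewrite ?cscale0r. Qed.

Lemma fsum_ind (Q : fsum -> Prop) :
  (forall g a (Da : D g a), Q (fsum_delta Da)) ->
  (forall f f', Q f -> Q f' -> Q (fsum_add f f')) -> forall f, Q f.
Proof.
move=> Qd Qa f.
suff h (r : seq H) f' : (forall g, g \notin r -> f' g = 0) -> Q f'.
  apply: (h (fset_set [set g | f g != 0])) => g.
  rewrite in_fset_set; last exact: fsum_finite.
  by rewrite notin_setE => /negP; rewrite negbK => /eqP.
elim: r f' => [|g r IH] f' f0.
  have -> : f' = fsum_delta (pdom0 P 1%g) by apply: fsumP => h /=; rewrite f0 // if_same.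
  exact: Qd.
have in' h : D h (if h == g then 0 else f' h).
  by case: ifP => _; [exact: pdom0|exact: fsum_in].
have fin' : finite_set [set h | (if h == g then 0 else f' h) != 0].
  apply: sub_finite_set (fsum_finite f') => h /=.
  by case: ifP => //; rewrite eqxx.
have -> : f' = fsum_add (fsum_delta (fsum_in f' g)) (FSum in' fin').
  by apply: fsumP => h /=; case: eqP => [->|_]; rewrite ?addr0 ?add0r.
apply: Qa; first exact: Qd.
apply: IH => h hr /=; case: eqP => // /eqP hg; apply: f0.
by rewrite inE negb_or hg.
Qed.

Lemma pact_inD g a b : D g a -> D g b ->
  theta g^-1%g (a + b) = theta g^-1%g a + theta g^-1%g b.
Proof. by move=> Da Db; apply: pactD; rewrite invgK. Qed.

Lemma pact_inV g a : D g a -> D g^-1%g (theta g^-1%g a).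
Proof. by move=> Da; apply: pact_in; rewrite invgK. Qed.

Lemma fsum_mul_term_finite f f' k : finite_set [set g | fsum_mul_term f f' k g != 0].
Proof.
by apply: sub_finite_set (fsum_finite f) => g /= /fsum_mul_term_neq0[].
Qed.

Lemma fsum_mulDl f1 f2 f' : fsum_mul (fsum_add f1 f2) f' =
  fsum_add (fsum_mul f1 f') (fsum_mul f2 f').
Proof.
apply: fsumP => k /=; rewrite /fsum_mul_coef -fsbigT_split;
  try exact: fsum_mul_term_finite.
apply: eq_fsbigr => g _; rewrite /fsum_mul_term /= pact_inD; try exact: fsum_in.
by rewrite mulrDl pactD //; apply/pdomMr/pact_inV/fsum_in.
Qed.

Lemma fsum_mulDr f f1 f2 : fsum_mul f (fsum_add f1 f2) =
  fsum_add (fsum_mul f f1) (fsum_mul f f2).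
Proof.
apply: fsumP => k /=; rewrite /fsum_mul_coef -fsbigT_split;
  try exact: fsum_mul_term_finite.
apply: eq_fsbigr => g _; rewrite /fsum_mul_term /=.
by rewrite mulrDr pactD //; apply/pdomMr/pact_inV/fsum_in.
Qed.

Lemma fsum_starD f1 f2 : fsum_star (fsum_add f1 f2) =
  fsum_add (fsum_star f1) (fsum_star f2).
Proof.
apply: fsumP => k /=; rewrite starD pactD //; exact/pdom_star/fsum_in.
Qed.

Lemma fsum_scaleD k f1 f2 : fsum_scale k (fsum_add f1 f2) =
  fsum_add (fsum_scale k f1) (fsum_scale k f2).
Proof. by apply: fsumP => h /=; rewrite cscaleDr. Qed.

(** Each relation is additive in every argument, so that formal sums with a single term suffice. *)
Lemma fsum_hom_of_fibres (B : cstarAlgType R) (T : H -> A -> B) :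
  (forall g a b, D g a -> D g b -> T g (a + b) = T g a + T g b) ->
  (forall g k a, D g a -> T g (cscale k a) = cscale k (T g a)) ->
  (forall g h a b, D g a -> D h b ->
     T (g * h)%g (theta g (theta g^-1%g a * b)) = T g a * T h b) ->
  T 1%g 1 = 1 ->
  (forall g a, D g a -> T g^-1%g (theta g^-1%g (star a)) = star (T g a)) ->
  exists2 pi : fsum -> B, is_fsum_hom pi &
    forall g a (Da : D g a), pi (fsum_delta Da) = T g a.
Proof.
move=> TD TZ TM T1 TS.
have T0 g : T g 0 = 0.
  by apply: (addrI (T g 0)); rewrite -TD ?addr0 //; exact: pdom0.
pose pi f := \sum_(g \in [set: H]) T g (f g).
have fT f : finite_set [set g | T g (f g) != 0].
  apply: sub_finite_set (fsum_finite f) => g /=.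
  by apply: contra_neq => ->; exact: T0.
have piA f f' : pi (fsum_add f f') = pi f + pi f'.
  rewrite /pi -fsbigT_split //; apply: eq_fsbigr => g _ /=.
  by apply: TD; exact: fsum_in.
have piE g a (Da : D g a) : pi (fsum_delta Da) = T g a.
  rewrite /pi -(@fsbig_widen _ _ _ _ [set g]) //; last first.
    by move=> x /= [_ /eqP xg]; rewrite (negbTE xg) T0.
  by rewrite fsbig_set1 /= eqxx.
exists pi => //; split=> //.
- move=> k; elim/fsum_ind => [g a Da|f f' IH IH'].
    by rewrite -(fsum_deltaZ _ (pdomZ k Da)) !piE TZ.
  by rewrite fsum_scaleD !piA IH IH' cscaleDr.
- elim/fsum_ind => [g a Da|f1 f2 IH1 IH2] f'; last first.
    by rewrite fsum_mulDl !piA IH1 IH2 mulrDl.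
  elim/fsum_ind: f' => [h b Db|f1 f2 IH1 IH2]; last first.
    by rewrite fsum_mulDr !piA IH1 IH2 mulrDr.
  have Dab : D (g * h)%g (theta g (theta g^-1%g a * b)).
    by apply: pact_mul_in => //; rewrite mulKg.
  by rewrite (fsum_mul_delta Da Db Dab) !piE TM.
- by rewrite piE.
- elim/fsum_ind => [g a Da|f f' IH IH'].
    have Da' : D g^-1%g (theta g^-1%g (star a)) by exact/pact_inV/pdom_star.
    by rewrite (fsum_star_delta Da Da') !piE TS.
  by rewrite fsum_starD !piA IH IH' starD.
Qed.

End FormalSums.

(** * Bounds for the generators of the crossed product *)

Section CrossedProductGenerators.
Context (R : realType) (X : topologicalType) (cX : compact [set: X]) (H : groupType).
Local Notation A := (cfun R cX).
Variable P : partial_system A H.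
Local Notation D := (pdom P).
Local Notation theta := (pact P).

(** On the fibre over 1 [pi] is a star homomorphism on C(X), hence contractive, and [a delta_g]
    times its adjoint is [a * star a] in that fibre. *)
Lemma fsum_hom_delta_le (B : cstarAlgType R) (pi : fsum P -> B) g a (Da : D g a) :
  is_fsum_hom pi -> cnorm (pi (fsum_delta Da)) <= cnorm a.
Proof.
move=> hpi; have in1 b : D 1%g b by rewrite pdom1.
pose h b := pi (fsum_delta (in1 b)).
have sh : is_star_hom h.
  split.
  - by move=> b c; rewrite /h -(fh_add hpi); congr pi; exact: fsum_deltaD.
  - by move=> k b; rewrite /h -(fh_scale hpi); congr pi; exact: fsum_deltaZ.
  - move=> b c; rewrite /h -(fh_mul hpi); congr pi.
    have Dbc : D (1 * 1)%g (theta 1%g (theta 1^-1%g b * c)).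
      by rewrite mulg1; exact: in1.
    rewrite (fsum_mul_delta _ _ Dbc); apply: fsum_delta_eq; rewrite ?mulg1 //.
    by rewrite invg1 !pact1.
  - by rewrite /h -(fh_one hpi); congr pi; exact: fsum_delta_eq.
  - move=> b; rewrite /h -(fh_star hpi); congr pi.
    have Db' : D 1^-1%g (theta 1^-1%g (star b)) by rewrite invg1; exact: in1.
    by rewrite (fsum_star_delta _ Db'); apply: fsum_delta_eq; rewrite invg1 ?pact1.
have Da' : D g^-1%g (theta g^-1%g (star a)) by exact/pact_inV/pdom_star.
have [a0 D0 a0a] := pact_surj Da.
have aE : theta g^-1%g a = a0.
  have := @pact_comp _ _ _ P g^-1%g g a0 D0.
  by rewrite a0a invgK mulVg pact1 => /(_ Da)[_ <-].
have asE : theta g^-1%g (star a) = star a0.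
  by rewrite pact_star ?aE // invgK.
have Dm : D (g * g^-1)%g (theta g (theta g^-1%g a * theta g^-1%g (star a))).
  by rewrite mulgV; exact: in1.
rewrite -(ler_pXn2r (_ : 0 < 2)%N) ?nnegrE ?cnorm_ge0 //.
rewrite -[X in X ^+ 2 <= _]cnorm_star -cnormX starK -(fh_star hpi).
rewrite (fsum_star_delta Da Da') -(fh_mul hpi) (fsum_mul_delta Da Da' Dm).
rewrite (fsum_delta_eq Dm (in1 (a * star a))) ?mulgV //; last first.
  by rewrite aE asE pactM ?pact_star ?a0a //; exact: pdom_star.
apply: le_trans (cfun_hom_contractive sh _) _.
by rewrite -{1}(starK a) cnormX cnorm_star.
Qed.

(** The bound does not depend on the representation; this keeps [univ_gen] from taking its default
    value 0. *)
Lemma fsum_gen_bounded f : cbounded (@is_fsum_hom R A H P) (CGen f).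
Proof.
elim/fsum_ind: f => [g a Da|f f' [M hM] [M' hM']].
  by exists (cnorm a) => B rho rr; exact: fsum_hom_delta_le.
exists (M + M') => B rho rr /=; rewrite (fh_add rr).
by apply: le_trans (cnormD _ _) _; apply: lerD; [exact: hM|exact: hM'].
Qed.

Local Notation gen := (@univ_gen R (fsum P) (@is_fsum_hom R A H P)).

Lemma fsum_gen_hom : is_fsum_hom (gen : fsum P -> crossed_product P).
Proof.
have genE (B : cstarAlgType R) (rho : fsum P -> B) t :
    is_fsum_hom rho -> univ_hom rho (gen t) = rho t.
  by move=> rr; apply: univ_hom_gen => //; exact: fsum_gen_bounded.
split=> *; apply: univ_ext => B rho rr; have sh := univ_hom_is_star_hom rr;
  rewrite ?(sh_add sh, sh_scale sh, sh_mul sh, sh_star sh, sh_one sh, genE) //.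
- exact: fh_add rr _ _.
- exact: fh_scale rr _ _.
- exact: fh_mul rr _ _.
- exact: fh_one rr.
- exact: fh_star rr _.
Qed.

End CrossedProductGenerators.

(** * Tight representations *)

Section TightRepresentation.
Context (R : realType) (G : groupType) (E : digraph) (phi : self_similar_action G E).
Context (B : cstarAlgType R).
Local Notation edge := (edge E).
Local Notation triple := (triple phi).
Local Notation sge := (sge phi).
Local Notation inf_path := (inf_path E).
Local Notation cfun := (cfun R (compact_inf_path (E := E))).
Local Notation normc := Normc.normc.
Local Notation sigma := (@sge_sigma G E phi).
Implicit Types (s t u : triple) (p q : prepath E) (xi eta zeta : inf_path)
  (f : cfun) (g h : sge_group phi).

Definition pidem p : sge := insub (p, 1%g, p).

Lemma pidemE p (pp : is_path p.1 p.2) : pidem p = Some (pid phi pp).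
Proof.
by rewrite /pidem (insubT (triple_ok phi) (pid_ok phi pp)); congr Some; apply: val_inj.
Qed.

(** [tr_tight] is the Cuntz-Krieger relation carried to every path; with [tr_unit] it makes the
    idempotents of each length a partition of 1. *)
Record tight_rep (w : sge -> B) : Prop := TightRep {
  tr_0 : w None = 0;
  tr_mul : forall s t, w (sge_mul (Some s) (Some t)) = w (Some s) * w (Some t);
  tr_star : forall s, w (Some (tstar s)) = star (w (Some s));
  tr_unit : \sum_x w (pidem (x, [::])) = 1;
  tr_tight : forall p, is_path p.1 p.2 ->
    w (pidem p) = \sum_(e | rng e == path_dom p) w (pidem (path_rcons p e))
}.

Lemma sge_mul_pid s (pp : is_path (tleft s).1 (tleft s).2) :
  sge_mul (Some (pid phi pp)) (Some s) = Some s.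
Proof.
have [|u [-> ul um ur]] := @sge_mul_match _ _ _ (pid phi pp) s; first by [].
by congr Some; apply: triple_eq; rewrite ?ul ?um ?ur ?mul1g.
Qed.

Variable w : sge -> B.
Hypotheses (wt : tight_rep w)
  (Gcount : countable [set: G]) (ns : no_sources E) (pf : pseudo_free phi).

(** By [sge_sigma_inj] at most one triple qualifies, so nothing depends on the choice. The zero
    element at bad paths makes their terms vanish. *)
Definition good_sge g p : sge :=
  if pselect (exists s, sigma s = g /\ tleft s = p) is left h
  then Some (projT1 (cid h)) else None.

Lemma good_sgeE g s : sigma s = g -> good_sge g (tleft s) = Some s.
Proof.
move=> sg; rewrite /good_sge; case: pselect => [h|[]]; last by exists s.
congr Some; have [h1 h2] := projT2 (cid h).
by apply: (sge_sigma_inj pf Gcount) => //; rewrite h1.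
Qed.

Lemma good_sge_bad g p : ~ good_path g p -> good_sge g p = None.
Proof.
by rewrite /good_sge; case: pselect => // -[s [sg sp]] []; exists s.
Qed.

Local Notation wg g p := (w (good_sge g p)).

(** The idempotent of the left path splits over its edges, and each piece cuts the triple down to a
    longer left path over the same [g]. *)
Lemma w_good_split g p : good_path g p ->
  wg g p = \sum_(e | rng e == path_dom p) wg g (path_rcons p e).
Proof.
move=> [s sg <-]; have pp := tleft_path s.
rewrite good_sgeE // -[in LHS](sge_mul_pid pp) (tr_mul wt) -pidemE (tr_tight wt) //.
rewrite mulr_suml; apply: eq_bigr => e re.
have qq : is_path (path_rcons (tleft s) e).1 (path_rcons (tleft s) e).2.
  by rewrite is_path_rcons pp.
rewrite (pidemE qq) -(tr_mul wt).
have [|u us ul] := @sge_mul_restrict _ _ _ s _ qq [:: e].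
  by rewrite /path_rcons cats1.
rewrite us -ul good_sgeE // (sge_sigmaM us) sge_sigma1 //.
by rewrite mul1g.
Qed.

Lemma triple_theta_ex u : exists xi eta, theta_graph u xi eta.
Proof.
have [xi c] := inf_path_cylinder ns (tright_path u).
by have [eta h] := theta_graph_total c; exists xi, eta.
Qed.

(** A nonzero product would act on some point. In the first case the intermediate point would have
    both [p] and [q] as prefixes. The second product lies over 1, so it fixes the point, which again
    would have both prefixes. *)
Lemma w_good_orth g n p q : p \in paths E n -> q \in paths E n -> p != q ->
  star (wg g p) * wg g q = 0 /\ wg g p * star (wg g q) = 0.
Proof.
move=> pn qn pq.
have [[s sg sp]|/good_sge_bad ->] := pselect (good_path g p); last first.
  by rewrite (tr_0 wt) star0 !mul0r.
have [[t tg tq]|/good_sge_bad ->] := pselect (good_path g q); last first.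
  by rewrite (tr_0 wt) star0 !mulr0.
subst p q; rewrite !good_sgeE // -!(tr_star wt) -!(tr_mul wt).
split.
  case st: (sge_mul (Some (tstar s)) (Some t)) => [u|]; last by rewrite (tr_0 wt).
  have [xi [eta /(theta_graph_mul st)[zeta h1 h2]]] := triple_theta_ex u.
  have /(cylinder_pathsP _ qn) e1 := theta_graph_left h1.
  have /(cylinder_pathsP _ pn) e2 := theta_graph_right h2.
  by move: pq; rewrite e1 e2 eqxx.
case st: (sge_mul (Some s) (Some (tstar t))) => [u|]; last by rewrite (tr_0 wt).
have [xi [eta h]] := triple_theta_ex u.
have [zeta h1 h2] := theta_graph_mul st h.
have e : xi = eta.
  apply: (sigma_graph1_eq pf Gcount); exists u => //.
  by rewrite (sge_sigmaM st) sge_sigmaV sg tg mulgV.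
have /(cylinder_pathsP _ qn) e1 := theta_graph_right h1.
have /(cylinder_pathsP _ pn) e2 := theta_graph_left h2.
by move: pq; rewrite e1 e2 e eqxx.
Qed.

Lemma w_good_piso g p : wg g p * star (wg g p) * wg g p = wg g p.
Proof.
have [[s sg sp]|/good_sge_bad ->] := pselect (good_path g p); last first.
  by rewrite (tr_0 wt) mulr0.
subst p; rewrite good_sgeE // -(tr_star wt) -(tr_mul wt).
have [|u [us ul um ur]] := @sge_mul_match _ _ _ s (tstar s); first by [].
have [|v [vs vl vm vr]] := @sge_mul_match _ _ _ u s; first by rewrite ur.
rewrite us -(tr_mul wt) vs; congr w; congr Some; apply: triple_eq => //.
- by rewrite vl ul.
- by rewrite vm um mulgVK.
Qed.

(** The [wg g p] are partial isometries with orthogonal ranges and orthogonal initial spaces, so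
    that [X] times its adjoint combines orthogonal projections with the squared moduli of the
    coefficients; [orth_sum_norm] bounds it. *)
Lemma w_good_sum_norm g n (c : prepath E -> R[i]) (M : R) : 0 <= M ->
  (forall p, p \in paths E n -> good_path g p -> normc (c p) <= M) ->
  cnorm (\sum_(p <- paths E n) cscale (c p) (wg g p)) <= M.
Proof.
move=> M0 cM; pose c' p := if `[< good_path g p >] then c p else 0.
have -> : \sum_(p <- paths E n) cscale (c p) (wg g p) =
    \sum_(p <- paths E n) cscale (c' p) (wg g p).
  apply: eq_bigr => p _; rewrite /c'; case: asboolP => // /good_sge_bad ->.
  by rewrite (tr_0 wt) !cscale0r.
have c'M p : p \in paths E n -> normc (c' p) <= M.
  rewrite /c' => pn; case: asboolP => [|_]; first exact: cM.
  by rewrite Normc.normc0.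
set X := \sum_(p <- _) _.
rewrite -(ler_pXn2r (_ : 0 < 2)%N) ?nnegrE ?cnorm_ge0 //.
rewrite -[X in X ^+ 2 <= _]cnorm_star -cnormX starK.
pose e p := wg g p * star (wg g p).
have -> : X * star X = \sum_(p <- paths E n) cscale (normc (c' p) ^+ 2)%:C (e p).
  rewrite (big_morph _ (@starD _ _) (@star0 _ _)) mulr_suml.
  apply: eq_big_seq => p pn; rewrite mulr_sumr (bigD1_seq p pn (uniq_paths E n)) /=.
  rewrite big1_seq ?addr0 => [|q /andP[qp qn]]; last first.
    rewrite starZ -cscaleAl -cscaleAr.
    by rewrite (w_good_orth g pn qn _).2 ?cscale0r // eq_sym.
  rewrite starZ -cscaleAl -cscaleAr cscaleA; congr cscale.
  case: (c' p) => a b; rewrite /= sqr_sqrtr ?addr_ge0 ?sqr_ge0 //.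
  by simpc; rewrite !expr2; congr (_ +i* _); ring.
apply: orth_sum_norm; first exact: uniq_paths.
- by move=> p; rewrite /e starM starK.
- by move=> p _; rewrite /e mulrA w_good_piso.
- move=> p q pn qn pq; rewrite /e mulrA -(mulrA (wg g p)).
  by rewrite (w_good_orth g pn qn pq).1 mulr0 mul0r.
- move=> p pn; rewrite sqr_ge0 /= lerXn2r ?nnegrE ?normc_ge0 //; exact: c'M.
- exact: sqr_ge0.
Qed.

Definition path_take n p : prepath E := (p.1, take n p.2).

Lemma path_take_paths m n p : (n <= m)%N -> p \in paths E m ->
  path_take n p \in paths E n.
Proof.
move=> nm; rewrite !mem_paths /= => /andP[/eqP sp pp].
rewrite size_take_min sp (minn_idPl nm) eqxx /=.
by move: pp; rewrite -{1}(cat_take_drop n p.2) is_path_cat => /andP[].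
Qed.

Lemma cylinder_path_take n p xi : is_path p.1 p.2 -> cylinder p xi ->
  cylinder (path_take n p) xi.
Proof.
case: p => v s pp c.
by apply: (@cylinder_catl _ _ (drop n s)); rewrite /= cat_take_drop.
Qed.

(** Good terms split by [w_good_split]. A bad path contributes 0 but may have good extensions, which
    the refined sum contains; hence the condition on [c]. *)
Lemma good_sum_refine g m n (c : prepath E -> R[i]) : (n <= m)%N ->
  (forall p, p \in paths E n -> ~ good_path g p -> c p = 0) ->
  \sum_(p <- paths E n) cscale (c p) (wg g p) =
  \sum_(p <- paths E m) cscale (c (path_take n p)) (wg g p).
Proof.
move=> /subnK <- c0; elim: (m - n)%N => [|k IH].
  apply: eq_big_seq => p pn; congr (cscale (c _) _).
  by rewrite /path_take take_oversize ?(paths_size pn) //; case: (p).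
rewrite addSn big_pathsS IH; apply: eq_big_seq => p pk.
have tk e : path_take n (path_rcons p e) = path_take n p.
  by rewrite /path_take /= -cats1 takel_cat // (paths_size pk) leq_addl.
under eq_bigr do rewrite tk.
have [gp|ngp] := pselect (good_path g p).
  by rewrite {1}w_good_split // (big_morph _ (@cscaleDr _ _ _) (@cscale0r _ _ _)).
rewrite (good_sge_bad ngp) (tr_0 wt) cscale0r.
rewrite c0 ?big1 //; [by move=> *; rewrite cscale0l| |].
  by apply: path_take_paths pk; exact: leq_addl.
move=> gt; apply: ngp.
have [xi cx] := inf_path_cylinder ns (paths_path pk).
have /(cylinder_pathsP _ pk) -> := cx.
apply: (@good_path_le _ _ _ _ n); first exact: leq_addl.
have := cylinder_path_take n (paths_path pk) cx.
by move=> /(cylinder_pathsP _ (path_take_paths (leq_addl k n) pk)) <-.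
Qed.

Definition fibre_approx g n f : B :=
  \sum_(p <- paths E n) cscale (cylinder_value f p) (wg g p).

Definition fibre_map g f : B := xget 0 [set l | seq_cvg (fun n => fibre_approx g n f) l].

(** After refinement to the longer length both sums run over the same paths, with coefficients at
    most [e] apart at good ones: by the oscillation of [f] if the shorter prefix is good, by the
    smallness of [f] if it is bad. *)
Lemma fibre_approx_cauchy g f : ideal_of g f -> seq_cauchy (fun n => fibre_approx g n f).
Proof.
move=> fg e e0; have [N hN] := ideal_oscillation fg e0.
have h m n : (N <= n)%N -> (n <= m)%N ->
    cnorm (fibre_approx g m f - fibre_approx g n f) <= e.
  move=> Nn nm; pose c p := if `[< good_path g p >] then cylinder_value f p else 0.
  have -> : fibre_approx g n f = \sum_(p <- paths E n) cscale (c p) (wg g p).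
    apply: eq_bigr => p _; rewrite /c; case: asboolP => // /good_sge_bad ->.
    by rewrite (tr_0 wt) !cscale0r.
  rewrite (@good_sum_refine g m n c nm); last by move=> p _; rewrite /c; case: asboolP.
  rewrite -sumrB.
  have -> : \sum_(p <- paths E m) (cscale (cylinder_value f p) (wg g p) -
        cscale (c (path_take n p)) (wg g p)) =
      \sum_(p <- paths E m) cscale (cylinder_value f p - c (path_take n p)) (wg g p).
    apply: eq_bigr => p _; rewrite cscaleDl -(cscaleN1 (cscale _ _)) cscaleA.
    by rewrite mulN1r.
  apply: w_good_sum_norm; first exact: ltW.
  move=> p pm gp; have tn := path_take_paths nm pm.
  have [h1 h2] := hN n _ Nn tn.
  have [xi cx ->] := cylinder_valueP f ns (paths_path pm).
  have cx' := cylinder_path_take n (paths_path pm) cx.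
  rewrite /c; case: asboolP => [gt|ngt].
    by have [zeta cz ->] := cylinder_valueP f ns (paths_path tn); exact: h1.
  by rewrite subr0; case: h2 => // h2; exact: h2.
exists N => m n Nm Nn; have [nm|/ltnW mn] := leqP n m; first exact: h.
by rewrite cnorm_dist; exact: h.
Qed.

Lemma fibre_map_cvg g f : ideal_of g f ->
  seq_cvg (fun n => fibre_approx g n f) (fibre_map g f).
Proof.
move=> fg; have [l hl] := cnorm_complete _ (fibre_approx_cauchy fg).
by rewrite /fibre_map; case: xgetP => [//|/(_ l)].
Qed.

Lemma fibre_map_eq g f l : ideal_of g f ->
  seq_cvg (fun n => fibre_approx g n f) l -> fibre_map g f = l.
Proof. by move=> fg; apply: seq_cvg_unique; exact: fibre_map_cvg. Qed.

Lemma fibre_mapD g f f1 : ideal_of g f -> ideal_of g f1 ->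
  fibre_map g (f + f1) = fibre_map g f + fibre_map g f1.
Proof.
move=> h h1; apply: fibre_map_eq; first exact: idealD.
have -> : (fun n => fibre_approx g n (f + f1)) =
    (fun n => fibre_approx g n f + fibre_approx g n f1).
  apply/funext => n; rewrite -big_split; apply: eq_bigr => p _ /=.
  by rewrite cylinder_valueD cscaleDl.
by apply: seq_cvgD; exact: fibre_map_cvg.
Qed.

Lemma fibre_mapZ g k f : ideal_of g f ->
  fibre_map g (cscale k f) = cscale k (fibre_map g f).
Proof.
move=> h; apply: fibre_map_eq; first exact: idealZ.
have -> : (fun n => fibre_approx g n (cscale k f)) =
    (fun n => cscale k (fibre_approx g n f)).
  apply/funext => n; rewrite /fibre_approx.
  rewrite (big_morph _ (@cscaleDr _ _ _) (@cscale0r _ _ _)); apply: eq_bigr => p _ /=.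
  by rewrite cylinder_valueZ cscaleA.
by apply: seq_cvgZ; exact: fibre_map_cvg.
Qed.

Lemma fibre_map_le g f : ideal_of g f -> cnorm (fibre_map g f) <= cnorm f.
Proof.
move=> fg; apply: seq_cvg_norm (fibre_map_cvg fg); exists 0%N => n _.
apply: w_good_sum_norm => [|p _ _]; first exact: cnorm_ge0.
exact: cylinder_value_le.
Qed.

(** From the length of the left path on, the approximations are constant: they refine the single
    term at that path. *)
Lemma fibre_map_cind s : fibre_map (sigma s) (cind R (tleft s)) = w (Some s).
Proof.
set g := sigma s; set p := tleft s; have pp := tleft_path s.
apply: fibre_map_eq; first exact: ideal_cind.
have pn : p \in paths E (size p.2) by rewrite mem_paths eqxx.
move=> e e0; exists (size p.2) => m nm.
suff -> : fibre_approx g m (cind R p) = w (Some s).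
  by rewrite subrr cnorm0 ltW.
have -> : fibre_approx g m (cind R p) = \sum_(q <- paths E m)
    cscale ((path_take (size p.2) q == p)%:R) (wg g q).
  apply: eq_big_seq => q qm; congr cscale.
  have [xi cx ->] := cylinder_valueP (cind R p) ns (paths_path qm).
  rewrite /= eq_sym; congr ((_ == _)%:R).
  apply/esym/(cylinder_pathsP _ (path_take_paths nm qm)).
  exact: cylinder_path_take (paths_path qm) cx.
rewrite -(@good_sum_refine g m (size p.2) (fun q => (q == p)%:R)) //; last first.
  by move=> q _ nq; case: eqP => // qp; case: nq; exists s.
rewrite (bigD1_seq p pn (uniq_paths E _)) /= eqxx cscale1 good_sgeE //.
by rewrite big1 ?addr0 // => q /negPf ->; rewrite cscale0l.
Qed.

Local Notation act := (@canonical_act R G E phi Gcount ns pf).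

Lemma canonical_act_le g f : ideal_of g^-1%g f -> cnorm (act g f) <= cnorm f.
Proof.
move=> h; apply: cfun_norm_le => [|x]; first exact: cnorm_ge0.
have [[xi _ ->//]|[_ ->//]] := @canonical_act_cases R _ _ _ Gcount ns pf g x.
  exact: cfun_norm_ub.
by rewrite Normc.normc0 cnorm_ge0.
Qed.

Lemma canonical_act_cind s : act (sigma s) (cind R (tright s)) = cind R (tleft s).
Proof.
apply: cfunP => x; rewrite canonical_actE; first exact: theta_tilde_cind.
by rewrite -sge_sigmaV; exact: (@ideal_cind R G E phi (tstar s)).
Qed.

(** The transported intersection of the right cylinder of [s] with the left cylinder of [t] is the
    set that the product reaches; a zero product means that the two cylinders are disjoint. *)
Lemma canonical_act_prod s t : act (sigma s)
    (act (sigma s)^-1%g (cind R (tleft s)) * cind R (tleft t)) =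
  if sge_mul (Some s) (Some t) is Some u then cind R (tleft u) else 0.
Proof.
rewrite -sge_sigmaV (canonical_act_cind (tstar s)) -[tleft (tstar s)]/(tright s).
have hi : ideal_of (sigma s)^-1%g (cind R (tright s) * cind R (tleft t)).
  by apply: idealMr; rewrite -sge_sigmaV; exact: (@ideal_cind R G E phi (tstar s)).
apply: cfunP => y.
have [[x [s' s'g h] ->//]|[nF ->//]] :=
  @canonical_act_cases R _ _ _ Gcount ns pf (sigma s) y; last first.
  case st: (sge_mul (Some s) (Some t)) => [u|//]; rewrite cindE ?tleft_path //.
  case: asboolP => // c; case: nF.
  have [xi hu] := theta_graph_surj c; have [zeta _ h2] := theta_graph_mul st hu.
  by exists s => //; exact: theta_graph_left h2.
have mulE (a b : cfun) z : (a * b) z = a z * b z by [].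
rewrite mulE !cindE ?tright_path ?tleft_path //.
have r : sigma_graph (sigma s) x y by exists s'.
have sxy : cylinder (tright s) x -> theta_graph s x y.
  move=> c; have [y' h'] := theta_graph_total c.
  by rewrite (sigma_graph_fun pf Gcount r (_ : sigma_graph _ x y')) //; exists s.
case st: (sge_mul (Some s) (Some t)) => [u|].
  rewrite cindE ?tleft_path // -natrM mulnb; congr (_%:R); congr nat_of_bool.
  apply/andP/asboolP => [[/asboolP c1 /asboolP c2]|c].
    have [z hz] := theta_graph_surj c2.
    have [v [sv hv]] := theta_graph_comp hz (sxy c1).
    by move: sv; rewrite st => -[->]; exact: theta_graph_left hv.
  have [z hu] := theta_graph_surj c; have [x' h1 h2] := theta_graph_mul st hu.
  have xx' : x = x' by apply: (sigma_graph_inj pf Gcount r); exists s.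
  by subst x'; split; apply/asboolP; [exact: theta_graph_right h2|exact: theta_graph_left h1].
case: asboolP => [c1|_]; last by rewrite mul0r.
case: asboolP => [c2|_]; last by rewrite mulr0.
have [z hz] := theta_graph_surj c2.
by have [v [sv hv]] := theta_graph_comp hz (sxy c1); move: sv; rewrite st.
Qed.

Lemma fibre_map_seq g (u : nat -> cfun) f : (forall n, ideal_of g (u n)) ->
  ideal_of g f -> seq_cvg u f -> seq_cvg (fun n => fibre_map g (u n)) (fibre_map g f).
Proof.
move=> hu hf uf e /uf[N hN]; exists N => n /hN; apply: le_trans.
have hf' : ideal_of g (- f) by rewrite -cscaleN1; exact: idealZ.
have -> : fibre_map g (u n) - fibre_map g f = fibre_map g (u n - f).
  by rewrite fibre_mapD // -(cscaleN1 f) fibre_mapZ // cscaleN1.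
by apply: fibre_map_le; exact: idealD.
Qed.

Lemma canonical_act_seq g (u : nat -> cfun) f : (forall n, ideal_of g^-1%g (u n)) ->
  ideal_of g^-1%g f -> seq_cvg u f -> seq_cvg (fun n => act g (u n)) (act g f).
Proof.
move=> hu hf uf e /uf[N hN]; exists N => n /hN; apply: le_trans.
have hf' : ideal_of g^-1%g (- f) by rewrite -cscaleN1; exact: idealZ.
have -> : act g (u n) - act g f = act g (u n - f).
  by rewrite canonical_act_add // -(cscaleN1 f) canonical_act_scale // cscaleN1.
by apply: canonical_act_le; exact: idealD.
Qed.

Lemma fibre_map1 : fibre_map 1%g 1 = 1.
Proof.
have idp x : is_path (x, [::] : seq edge).1 (x, [::] : seq edge).2 by [].
have -> : (1 : cfun) = \sum_(x <- enum (vert E)) cind R (x, [::]).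
  apply: cfunP => xi; rewrite cfun_sumE.
  have := @sum_paths_prefix R E 0 xpredT (fun=> 1) xi; rewrite big_map /=.
  by under eq_bigr do rewrite mul1r.
rewrite -(tr_unit wt).
have -> : \sum_x w (pidem (x, [::])) = \sum_(x <- enum (vert E)) w (pidem (x, [::])).
  by rewrite enumT.
have e x : fibre_map 1%g (cind R (x, [::])) = w (pidem (x, [::])).
  by rewrite (pidemE (idp x)) -fibre_map_cind sge_sigma1.
elim: (enum _) => [|x r IH]; last first.
  by rewrite !big_cons fibre_mapD ?IH ?e //; exact: ideal1.
rewrite !big_nil; apply: cnorm_eq0; apply/le_anti; rewrite cnorm_ge0 andbT.
by have := fibre_map_le (@ideal0 R G E phi 1%g); rewrite cnorm0.
Qed.

Lemma fibre_map_star g f : ideal_of g f ->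
  fibre_map g^-1%g (act g^-1%g (star f)) = star (fibre_map g f).
Proof.
have gi f1 : ideal_of g f1 -> ideal_of g^-1^-1%g f1 by rewrite invgK.
have gact f1 : ideal_of g f1 -> ideal_of g^-1%g (act g^-1%g f1).
  by move=> /gi; exact: canonical_act_in.
have T0 h : fibre_map h 0 = 0.
  apply: cnorm_eq0; apply/le_anti; rewrite cnorm_ge0 andbT.
  by have := fibre_map_le (@ideal0 R G E phi h); rewrite cnorm0.
move: f; apply: (ideal_ind ns).
- have e0 : act g^-1%g 0 = 0.
    have := canonical_act_le (gi _ (@ideal0 R G E phi g)); rewrite cnorm0 => h.
    by apply: cnorm_eq0; apply/le_anti; rewrite cnorm_ge0 h.
  by rewrite star0 e0 !T0 star0.
- move=> f f1 h h1 IH IH1; rewrite starD canonical_act_add; try exact/gi/ideal_star.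
  by rewrite fibre_mapD ?IH ?IH1 ?fibre_mapD ?starD //; exact/gact/ideal_star.
- move=> k f h IH; rewrite starZ canonical_act_scale; last exact/gi/ideal_star.
  by rewrite fibre_mapZ ?IH ?fibre_mapZ ?starZ //; exact/gact/ideal_star.
- move=> u f hu hf uf IH.
  apply: seq_cvg_unique (seq_cvg_star (fibre_map_seq hu hf uf)).
  have -> : (fun n => star (fibre_map g (u n))) =
     (fun n => fibre_map g^-1%g (act g^-1%g (star (u n)))).
    by apply/funext => n; rewrite IH.
  apply: fibre_map_seq => [n||]; try exact/gact/ideal_star.
  apply: canonical_act_seq => [n||]; try exact/gi/ideal_star.
  exact: seq_cvg_star.
- move=> s <-.
  have -> : star (cind R (tleft s)) = cind R (tleft s).
    by apply: cfunP => x /=; rewrite conjc_nat.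
  rewrite -sge_sigmaV (canonical_act_cind (tstar s)).
  by rewrite (fibre_map_cind (tstar s)) fibre_map_cind (tr_star wt).
Qed.

(** Two density inductions, in [f1] and then in [f], leave indicators of cylinders, where
    [canonical_act_prod] meets [tr_mul]. *)
Lemma fibre_map_mul g h f f1 : ideal_of g f -> ideal_of h f1 ->
  fibre_map (g * h)%g (act g (act g^-1%g f * f1)) = fibre_map g f * fibre_map h f1.
Proof.
pose P := canonical_system R Gcount ns pf.
have Pmul k l a b : ideal_of k a -> ideal_of l b ->
    ideal_of (k * l)%g (act k (act k^-1%g a * b)).
  by move=> ha hb; apply: (@pact_mul_in _ _ _ P) => //; rewrite mulKg.
have gi k f2 : ideal_of k f2 -> ideal_of k^-1^-1%g f2 by rewrite invgK.
have gact k f2 : ideal_of k f2 -> ideal_of k^-1%g (act k^-1%g f2).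
  by move=> /gi; exact: canonical_act_in.
have act0 k : act k 0 = 0 by exact: (pact0 P k).
have T0 k : fibre_map k 0 = 0.
  apply: cnorm_eq0; apply/le_anti; rewrite cnorm_ge0 andbT.
  by have := fibre_map_le (@ideal0 R G E phi k); rewrite cnorm0.
have seqM (u v : nat -> cfun) a b : seq_cvg u a -> seq_cvg v b ->
    seq_cvg (fun n => u n * v n) (a * b) by exact: seq_cvgM.
move=> hf; move: f1; apply: (ideal_ind ns).
- by rewrite mulr0 act0 !T0 mulr0.
- move=> a b ha hb IHa IHb; rewrite mulrDr canonical_act_add; try exact/idealMr/gact.
  by rewrite fibre_mapD ?IHa ?IHb ?(fibre_mapD ha hb) ?mulrDr //; exact: Pmul.
- move=> k a ha IH; rewrite -cscaleAr canonical_act_scale; last exact/idealMr/gact.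
  by rewrite fibre_mapZ ?IH ?(fibre_mapZ _ ha) ?cscaleAr //; exact: Pmul.
- move=> u a hu ha ua IH.
  apply: seq_cvg_unique (seq_cvgM (seq_cvg_cst _) (fibre_map_seq hu ha ua)).
  have -> : (fun n => fibre_map g f * fibre_map h (u n)) =
     (fun n => fibre_map (g * h)%g (act g (act g^-1%g f * u n))).
    by apply/funext => n; rewrite IH.
  apply: fibre_map_seq => [n||]; try exact: Pmul.
  apply: canonical_act_seq => [n||]; try exact/idealMr/gact.
  by apply: seqM => //; exact: seq_cvg_cst.
- move=> t <-; move: f hf; apply: (ideal_ind ns).
  + by rewrite act0 mul0r act0 !T0 mul0r.
  + move=> a b ha hb IHa IHb; rewrite canonical_act_add; try exact: gi.
    rewrite mulrDl canonical_act_add; try exact/idealMr/gact.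
    rewrite fibre_mapD ?IHa ?IHb ?(fibre_mapD ha hb) ?mulrDl //;
      exact/Pmul/ideal_cind.
  + move=> k a ha IH; rewrite canonical_act_scale; last exact: gi.
    rewrite -cscaleAl canonical_act_scale; last exact/idealMr/gact.
    by rewrite fibre_mapZ ?IH ?(fibre_mapZ _ ha) ?cscaleAl //; exact/Pmul/ideal_cind.
  + move=> u a hu ha ua IH.
    apply: seq_cvg_unique (seq_cvgM (fibre_map_seq hu ha ua) (seq_cvg_cst _)).
    have -> : (fun n => fibre_map g (u n) * fibre_map (sigma t) (cind R (tleft t))) =
       (fun n => fibre_map (g * sigma t)%g (act g (act g^-1%g (u n) * cind R (tleft t)))).
      by apply/funext => n; rewrite IH.
    apply: fibre_map_seq => [n||]; try exact/Pmul/ideal_cind.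
    apply: canonical_act_seq => [n||]; try exact/idealMr/gact.
    apply: seqM; last exact: seq_cvg_cst.
    by apply: canonical_act_seq => // [n|]; exact: gi.
  + move=> s <-; rewrite canonical_act_prod !fibre_map_cind -(tr_mul wt).
    case st: (sge_mul (Some s) (Some t)) => [u|]; last by rewrite T0 (tr_0 wt).
    by rewrite -(sge_sigmaM st) fibre_map_cind.
Qed.

Lemma tight_rep_fsum_hom : exists2 pi : fsum (canonical_system R Gcount ns pf) -> B,
  is_fsum_hom pi &
  forall s (Ds : pdom (canonical_system R Gcount ns pf) (sigma s) (cind R (tleft s))),
    pi (fsum_delta Ds) = w (Some s).
Proof.
have [pi hpi piE] := @fsum_hom_of_fibres _ _ _ (canonical_system R Gcount ns pf)
  B fibre_map fibre_mapD fibre_mapZ fibre_map_mul fibre_map1 fibre_map_star.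
by exists pi => // s Ds; rewrite piE fibre_map_cind.
Qed.

End TightRepresentation.

(** * Tight representations and the relations of the self-similar graph algebra *)

Section OgeTight.
Context (R : realType) (G : groupType) (E : digraph) (phi : self_similar_action G E).
Context (B : cstarAlgType R).
Local Notation edge := (edge E).
Local Notation triple := (triple phi).
Local Notation sge := (sge phi).
Implicit Types (s t u : triple) (p q : prepath E).
Hypothesis ns : no_sources E.

Definition sge_of (t : pretriple G E) : sge := insub t.

Lemma sge_ofE s : sge_of (val s) = Some s.
Proof. by rewrite /sge_of valK. Qed.

Lemma triple_mul_val_match (a b c : prepath E) (g h : G) :
  triple_mul_val phi (a, g, b) (b, h, c) = Some (a, g * h, c)%g.
Proof.
by rewrite /triple_mul_val path_divide_id /path_cat /= cats0 -surjective_pairing.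
Qed.

Section FromOge.
Variable rho : oge_gen G E -> B.
Hypothesis rr : oge_rel phi rho.
Local Notation P x := (rho (GenP G x)).
Local Notation S e := (rho (GenS G e)).
Local Notation U g := (rho (GenU E g)).

(** Without sources the Cuntz-Krieger relation holds at every vertex, and [oge_unit] adds the
    vertices up; this is the form that [sum_proj1_orthogonal] takes as input. *)
Lemma oge_sum_range : \sum_e S e * star (S e) = 1.
Proof.
rewrite -(oge_unit rr) (partition_big (@rng E) xpredT) //=; apply: eq_bigr => x _.
rewrite (oge_ck rr) //; have [e ex] := ns x; apply/card_gt0P.
by exists e; rewrite inE ex eqxx.
Qed.

Lemma oge_range_orth e f : e != f -> S e * star (S e) * (S f * star (S f)) = 0.
Proof.
move=> ef; apply: (sum_proj1_orthogonal _ _ oge_sum_range ef) => i.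
  by rewrite starM starK.
by rewrite mulrA (oge_s_piso rr).
Qed.

Lemma oge_ss_orth e f : e != f -> star (S e) * S f = 0.
Proof.
move=> ef; have h : star (S e) * (S e * star (S e)) = star (S e).
  by have := congr1 (@star R B) (oge_s_piso rr e); rewrite !starM starK.
rewrite -h -[S f](oge_s_piso rr f) -(mulrA (star (S e))) (mulrA (S e * star (S e))).
by rewrite oge_range_orth // mul0r mulr0.
Qed.

Lemma oge_ps e : P (rng e) * S e = S e.
Proof.
rewrite (oge_ck rr); last by apply/card_gt0P; exists e; rewrite inE eqxx.
rewrite mulr_suml (bigD1 e) //= (oge_s_piso rr) big1 ?addr0 // => f /andP[_ fe].
by rewrite -mulrA oge_ss_orth ?mulr0.
Qed.

Lemma oge_sp e : S e * P (dom e) = S e.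
Proof. by rewrite -(oge_ss rr) mulrA (oge_s_piso rr). Qed.

Lemma oge_u_star g : star (U g) = U g^-1%g.
Proof.
by rewrite -[LHS]mulr1 -(oge_u1 rr) -(mulgV g) (oge_uM rr) mulrA (oge_u_isom rr) mul1r.
Qed.

(** The vertex [x] matters only for the empty list. The final projection lets vertices and longer
    paths share one recursion; after an edge it is absorbed. *)
Fixpoint path_elem (x : vert E) (w : seq edge) : B :=
  if w is e :: w' then S e * path_elem (dom e) w' else P x.
Local Notation sp p := (path_elem p.1 p.2).

Lemma path_elem_l p : is_path p.1 p.2 -> P p.1 * sp p = sp p.
Proof.
case: p => x [|e w] /=; first by rewrite (oge_p_idem rr).
by move=> /andP[/eqP <- _]; rewrite mulrA oge_ps.
Qed.

Lemma path_elem_r p : sp p * P (path_dom p) = sp p.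
Proof.
case: p => x w; rewrite /path_dom /=; elim: w x => [|e w IH] x /=.
  exact: (oge_p_idem rr).
by rewrite -mulrA IH.
Qed.

Lemma path_elem_isom p : is_path p.1 p.2 -> star (sp p) * sp p = P (path_dom p).
Proof.
case: p => x w; rewrite /path_dom /=; elim: w x => [|e w IH] x /=.
  by rewrite (oge_p_star rr) (oge_p_idem rr).
move=> /andP[_ pw]; rewrite starM -mulrA (mulrA (star (S e))) (oge_ss rr).
by rewrite (path_elem_l (p := (dom e, w))) // IH.
Qed.

Lemma path_elem_cat p q : is_path q.1 q.2 -> q.1 = path_dom p ->
  sp (path_cat p q) = sp p * sp q.
Proof.
case: p q => x w [y v] /= qq; rewrite /path_dom /=; elim: w x => [|e w IH] x /= yx.
  by rewrite yx in qq *; rewrite (path_elem_l (p := (x, v))).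
by rewrite IH // mulrA.
Qed.

Lemma path_elem_act g p : U g * sp p = sp (act_path phi g p) * U (cocycle_path phi g p).
Proof.
case: p => x w; rewrite /cocycle_path /=; elim: w g x => [|e w IH] g x /=.
  exact: (oge_up rr).
by rewrite mulrA (oge_us rr) -!mulrA IH act_dom cocycle_act.
Qed.

Lemma path_elem_divide p q r : is_path p.1 p.2 -> is_path q.1 q.2 ->
  path_divide p q = Some r -> star (sp p) * sp q = sp r.
Proof.
move=> pp qq /path_divideP[pq1 r1 q2].
have rp : is_path r.1 r.2.
  by move: qq; rewrite q2 -pq1 is_path_cat r1 -surjective_pairing => /andP[].
have -> : q = path_cat p r by rewrite /path_cat pq1 -q2 -surjective_pairing.
by rewrite path_elem_cat // mulrA path_elem_isom // -r1 path_elem_l.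
Qed.

Lemma path_elem_orth p q : is_path p.1 p.2 -> is_path q.1 q.2 ->
  path_divide p q = None -> path_divide q p = None -> star (sp p) * sp q = 0.
Proof.
case: p q => x v [y w] /= pv pw.
have [<-|xy] := eqVneq x y; last first.
  move=> _ _; rewrite -(path_elem_l (p := (x, v))) // -(path_elem_l (p := (y, w))) //=.
  rewrite starM (oge_p_star rr) -mulrA (mulrA (P x)) (oge_p_orth rr) //.
  by rewrite mul0r mulr0.
have {pw} : is_path y w by [].
elim: v w x pv y => [|e v IH] [|f w] x //= pv y pw; rewrite /path_divide /= ?eqxx //=.
have [ef|ef] := eqVneq e f; last first.
  by rewrite starM -mulrA (mulrA (star (S e))) oge_ss_orth // mul0r mulr0.
subst f => /= h1 h2.
move: pv pw => /andP[_ pv] /andP[_ pw].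
rewrite starM -mulrA (mulrA (star (S e))) (oge_ss rr) (path_elem_l (p := (dom e, w))) //=.
by apply: (IH _ _ pv (dom e)) => //; rewrite /path_divide /= eqxx;
  [move: h1|move: h2]; case: ifP.
Qed.

Definition oge_tight (s : sge) : B :=
  if s is Some s then sp (tleft s) * U (tmid s) * star (sp (tright s)) else 0.

Lemma oge_tightP : tight_rep oge_tight.
Proof.
have UU g h : U g * U h = U (g * h)%g by rewrite (oge_uM rr).
split.
- by [].
- move=> s t /=; have := triple_mul_ok s t.
  rewrite !tripleE /triple_mul_val; have := tdom s; have := tdom t.
  have := tright_path t; have := tright_path s; have := tleft_path t; have := tleft_path s.
  move: (tleft s) (tmid s) (tright s) (tleft t) (tmid t) (tright t) => a g b c h n.
  move=> pa pc pb pn cn ab.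
  have -> : sp a * U g * star (sp b) * (sp c * U h * star (sp n)) =
      sp a * (U g * (star (sp b) * sp c) * U h) * star (sp n) by rewrite !mulrA.
  case bc: (path_divide b c) => [c'|].
    move=> ok; rewrite /= insubT /= /tleft /tmid /tright /=.
    have /path_divideP[b1 c'1 c2] := bc.
    have pc' : is_path c'.1 c'.2.
      by move: pc; rewrite c2 -b1 is_path_cat c'1 -surjective_pairing => /andP[].
    rewrite (path_elem_divide pb pc bc) path_elem_act.
    rewrite -(mulrA (sp (act_path phi g c'))) UU.
    rewrite mulrA -path_elem_cat //.
      exact: is_path_act.
    by rewrite /= c'1 ab.
  case cb: (path_divide c b) => [b'|] /=; last first.
    by rewrite path_elem_orth // mulr0 mul0r mulr0 mul0r.
  move=> ok; rewrite insubT /= /tleft /tmid /tright /=.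
  have /path_divideP[c1 b'1 b2] := cb.
  have pb' : is_path b'.1 b'.2.
    by move: pb; rewrite b2 -c1 is_path_cat b'1 -surjective_pairing => /andP[].
  have -> : star (sp b) * sp c = star (sp b').
    by rewrite -(path_elem_divide pc pb cb) starM starK.
  (* This case mirrors the previous one under the adjoint: [U h] enters the star as [U h^-1], where
     it can be moved past the path. *)
  have -> : U g * star (sp b') * U h = U g * star (U h^-1%g * sp b').
    by rewrite starM oge_u_star invgK mulrA.
  rewrite path_elem_act starM oge_u_star (mulrA (U g)) UU -!mulrA -starM -path_elem_cat.
  + by rewrite !mulrA.
  + exact: is_path_act.
  + by rewrite /= b'1 cn -actVM mulVg actV1.
- by move=> s /=; rewrite !starM starK oge_u_star mulrA.
- rewrite -(oge_unit rr); apply: eq_bigr => x _; rewrite (pidemE phi (p := (x, [::]))) //=.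
  by rewrite (oge_u1 rr) mulr1 (oge_p_star rr) (oge_p_idem rr).
- move=> p pp; rewrite (pidemE phi pp) /=.
  rewrite (oge_u1 rr) mulr1 -{1}(path_elem_r p) (oge_ck rr); last first.
    by have [e ex] := ns (path_dom p); apply/card_gt0P; exists e; rewrite inE ex.
  rewrite mulr_sumr mulr_suml; apply: eq_bigr => e re.
  have pe : is_path (path_rcons p e).1 (path_rcons p e).2 by rewrite is_path_rcons pp.
  rewrite (pidemE phi pe) /= (oge_u1 rr) mulr1.
  have -> : path_elem p.1 (rcons p.2 e) = sp p * S e.
    rewrite -cats1 (path_elem_cat (p := p) (q := (rng e, [:: e]))) /= ?eqxx ?oge_sp //.
    exact/eqP.
  by rewrite starM !mulrA.
Qed.

End FromOge.

Section ToOge.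
Variable w : sge -> B.
Hypothesis wt : tight_rep w.

Definition sge_edge (e : edge) : sge := sge_of ((rng e, [:: e]), 1%g, (dom e, [::])).
Definition sge_vert (g : G) (x : vert E) : sge :=
  sge_of ((actV phi g x, [::]), g, (x, [::])).

(** A group element is no triple by itself: [u_g] is assembled from its restrictions to the
    vertices. *)
Definition tight_oge (t : oge_gen G E) : B := match t with
  | GenP x => w (pidem phi (x, [::]))
  | GenS e => w (sge_edge e)
  | GenU g => \sum_x w (sge_vert g x)
  end.

Lemma sge_edge_ok e : triple_ok phi ((rng e, [:: e]), 1%g, (dom e, [::])).
Proof. by rewrite /triple_ok /= eqxx /path_dom /= actV1 eqxx. Qed.

Lemma sge_vert_ok g x : triple_ok phi ((actV phi g x, [::]), g, (x, [::])).
Proof. by rewrite /triple_ok /path_dom /= eqxx. Qed.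

Lemma w_mul (s t : pretriple G E) : triple_ok phi s -> triple_ok phi t ->
  w (sge_of s) * w (sge_of t) =
  if triple_mul_val phi s t is Some u then w (sge_of u) else 0.
Proof.
move=> sok tok; rewrite /sge_of !insubT -(tr_mul wt) /=.
by case: triple_mul_val => //=; rewrite (tr_0 wt).
Qed.

Lemma w_star (a b : prepath E) g : triple_ok phi (a, g, b) ->
  star (w (sge_of (a, g, b))) = w (sge_of (b, g^-1%g, a)).
Proof.
move=> ok; rewrite [sge_of (a, g, b)]/sge_of insubT -(tr_star wt) -sge_ofE.
by [].
Qed.

Lemma pidem_of p : pidem phi p = sge_of (p, 1%g, p). Proof. by []. Qed.

Lemma w_match (a b c : prepath E) g h : triple_ok phi (a, g, b) ->
  triple_ok phi (b, h, c) ->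
  w (sge_of (a, g, b)) * w (sge_of (b, h, c)) = w (sge_of (a, g * h, c)%g).
Proof. by move=> h1 h2; rewrite w_mul // triple_mul_val_match. Qed.

Lemma w_vert_orth (a c : prepath E) g h (x y : vert E) v :
  x != y -> triple_ok phi (a, g, (x, [::])) -> triple_ok phi ((y, v), h, c) ->
  w (sge_of (a, g, (x, [::]))) * w (sge_of ((y, v), h, c)) = 0.
Proof.
move=> xy h1 h2; rewrite w_mul // /triple_mul_val /path_divide /=.
by rewrite (negbTE xy) eq_sym (negbTE xy).
Qed.

Lemma w_orth_vert (a c : prepath E) g h (x y : vert E) v :
  x != y -> triple_ok phi (a, g, (x, v)) -> triple_ok phi ((y, [::]), h, c) ->
  w (sge_of (a, g, (x, v))) * w (sge_of ((y, [::]), h, c)) = 0.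
Proof.
move=> xy h1 h2; rewrite w_mul // /triple_mul_val /path_divide /=.
by rewrite (negbTE xy) eq_sym (negbTE xy).
Qed.

Lemma actV_inj g : injective (actV phi g).
Proof.
by apply: (can_inj (g := actV phi g^-1%g)) => x; rewrite -actVM mulVg actV1.
Qed.

Lemma vert_ok (x : vert E) : triple_ok phi ((x, [::]), 1%g, (x, [::])).
Proof. by rewrite /triple_ok /path_dom /= actV1 eqxx. Qed.

Lemma edge_star_ok e : triple_ok phi ((dom e, [::]), 1%g, (rng e, [:: e])).
Proof. by rewrite /triple_ok /path_dom /= eqxx actV1 eqxx. Qed.

Lemma w_edge_star e :
  star (w (sge_edge e)) = w (sge_of ((dom e, [::]), 1%g, (rng e, [:: e]))).
Proof. by rewrite w_star ?invg1 //; exact: sge_edge_ok. Qed.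

(** Of the sum defining [u_g] only the vertex at which the other path starts survives. *)
Lemma w_vert_mul g (x : vert E) v (c : prepath E) h : triple_ok phi ((x, v), h, c) ->
  (\sum_y w (sge_vert g y)) * w (sge_of ((x, v), h, c)) =
  w (sge_vert g x) * w (sge_of ((x, v), h, c)).
Proof.
move=> ok; rewrite mulr_suml (bigD1 x) //= big1 ?addr0 // => y yx.
by rewrite w_vert_orth //; exact: sge_vert_ok.
Qed.

Lemma w_mul_vert g (x : vert E) v (a : prepath E) h :
  triple_ok phi (a, h, (actV phi g x, v)) ->
  w (sge_of (a, h, (actV phi g x, v))) * (\sum_y w (sge_vert g y)) =
  w (sge_of (a, h, (actV phi g x, v))) * w (sge_vert g x).
Proof.
move=> ok; rewrite mulr_sumr (bigD1 x) //= big1 ?addr0 // => y yx.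
by rewrite w_orth_vert ?(inj_eq (@actV_inj g)) 1?eq_sym //; exact: sge_vert_ok.
Qed.

Lemma tight_ogeP : oge_rel phi tight_oge.
Proof.
have U1 : tight_oge (GenU E 1%g) = 1.
  rewrite /= -(tr_unit wt); apply: eq_bigr => x _.
  by rewrite /sge_vert actV1.
have UM g h : tight_oge (GenU E (g * h)%g) = tight_oge (GenU E g) * tight_oge (GenU E h).
  rewrite /= mulr_sumr; apply: eq_bigr => x _.
  rewrite [sge_vert h x]/sge_vert w_vert_mul; last exact: sge_vert_ok.
  by rewrite /sge_vert w_match ?actVM //; exact: sge_vert_ok.
have UV g : star (tight_oge (GenU E g)) = tight_oge (GenU E g^-1%g).
  rewrite /= (big_morph _ (@starD _ _) (@star0 _ _)).
  rewrite [RHS](reindex_inj (@actV_inj g)) /=; apply: eq_bigr => x _.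
  rewrite /sge_vert w_star; last exact: sge_vert_ok.
  by rewrite -actVM mulVg actV1.
split=> //=.
- by move=> x; rewrite pidem_of w_star ?invg1 //; exact: vert_ok.
- by move=> x; rewrite pidem_of w_match ?mulg1 //; exact: vert_ok.
- by move=> x y xy; rewrite !pidem_of w_vert_orth //; exact: vert_ok.
- move=> e; rewrite w_edge_star /sge_edge.
  rewrite w_match ?mulg1; [|exact: sge_edge_ok|exact: edge_star_ok].
  rewrite w_match ?mulg1 //; last exact: sge_edge_ok.
  by rewrite /triple_ok /path_dom /= eqxx actV1 eqxx.
- move=> e; rewrite w_edge_star /sge_edge.
  by rewrite w_match ?mulg1 //; [exact: edge_star_ok|exact: sge_edge_ok].
- move=> x _; rewrite (tr_tight wt) //; apply: eq_bigr => e /eqP re.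
  rewrite w_edge_star /sge_edge w_match ?mulg1; last 2 first.
  + exact: sge_edge_ok.
  + exact: edge_star_ok.
  by rewrite pidem_of /path_rcons /= re.
- exact: tr_unit.
- move=> g; have := UV g; rewrite /= => ->.
  by have := UM g^-1%g g; rewrite /= => <-; rewrite mulVg.
- move=> g; have := UV g; rewrite /= => ->.
  by have := UM g g^-1%g; rewrite /= => <-; rewrite mulgV.
- move=> g e; rewrite [sge_edge e]/sge_edge w_vert_mul; last exact: sge_edge_ok.
  have d : dom (actE phi g e) = actV phi (cocycle phi g e) (dom e).
    by rewrite act_dom cocycle_act.
  rewrite /sge_edge d w_mul_vert -?d; last exact: sge_edge_ok.
  rewrite /sge_vert -d w_match; [|exact: sge_edge_ok|by rewrite d; exact: sge_vert_ok].
  rewrite w_mul; [|exact: sge_vert_ok|exact: sge_edge_ok].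
  by rewrite /triple_mul_val /path_divide /= eqxx /path_cat /cocycle_path /= mul1g mulg1 act_rng.
- move=> g x; rewrite !pidem_of w_vert_mul; last exact: vert_ok.
  rewrite w_mul_vert; last exact: vert_ok.
  rewrite /sge_vert !w_match ?mul1g ?mulg1 //; try exact: vert_ok; exact: sge_vert_ok.
Qed.

Lemma tight_path_elem p : is_path p.1 p.2 ->
  path_elem tight_oge p.1 p.2 = w (sge_of (p, 1%g, (path_dom p, [::]))).
Proof.
case: p => x v; rewrite /path_dom /=; elim: v x => [|e v IH] x //= /andP[/eqP <- pv].
rewrite IH // /sge_edge w_mul; [|exact: sge_edge_ok|]; last first.
  by rewrite /triple_ok /path_dom /= pv actV1 eqxx.
rewrite /triple_mul_val /path_divide /= eqxx prefix0s /path_cat /cocycle_path /act_path /= drop0.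
by rewrite act_seq1 cocycle_seq1 mulg1.
Qed.

(** With [tight_ogeK] this identifies tight representations with the families satisfying
    [oge_rel]. *)
Lemma oge_tightK (s : sge) : oge_tight tight_oge s = w s.
Proof.
case: s => [s|] /=; last by rewrite (tr_0 wt).
have okl : triple_ok phi (tleft s, 1%g, (path_dom (tleft s), [::])).
  by rewrite /triple_ok tleft_path actV1 /path_dom /= eqxx.
have okr : triple_ok phi (tright s, 1%g, (path_dom (tright s), [::])).
  by rewrite /triple_ok tright_path actV1 /path_dom /= eqxx.
have okr' : triple_ok phi ((path_dom (tright s), [::]), 1%g, tright s).
  by rewrite /triple_ok tright_path actV1 /path_dom /= eqxx.
rewrite !tight_path_elem ?tleft_path ?tright_path // w_star // invg1.
rewrite tdom in okl *; rewrite w_mul_vert // /sge_vert.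
rewrite w_match //; last exact: sge_vert_ok.
rewrite w_match //; first by rewrite mul1g mulg1 -tripleE sge_ofE.
by apply/and3P; split; rewrite ?tleft_path // mul1g; apply/eqP; exact: tdom.
Qed.

End ToOge.

Lemma tight_ogeK (rho : oge_gen G E -> B) : oge_rel phi rho ->
  tight_oge (oge_tight rho) = rho.
Proof.
move=> rr; apply/funext => -[x|e|g] /=.
- rewrite (pidemE phi (p := (x, [::]))) //= (oge_u1 rr) mulr1 (oge_p_star rr).
  by rewrite (oge_p_idem rr).
- rewrite /sge_edge /sge_of insubT /=; first exact: sge_edge_ok.
  move=> ok; rewrite /tleft /tmid /tright /= (oge_u1 rr) mulr1 (oge_p_star rr).
  by rewrite !oge_sp.
- rewrite -[RHS]mulr1 -(oge_unit rr) mulr_sumr; apply: eq_bigr => x _.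
  rewrite /sge_vert /sge_of insubT /=; first exact: sge_vert_ok.
  move=> ok; rewrite /tleft /tmid /tright /= (oge_p_star rr) -(oge_up rr) -mulrA.
  by rewrite (oge_p_idem rr).
Qed.

End OgeTight.

(** * The isomorphism *)

Lemma path_rcons_eq (E : digraph) (p q : prepath E) e f :
  (path_rcons p e == path_rcons q f) = (p == q) && (e == f).
Proof.
rewrite /path_rcons [p in RHS]surjective_pairing [q in RHS]surjective_pairing.
by rewrite !xpair_eqE eqseq_rcons andbA.
Qed.

Lemma cind_split (R : realType) (E : digraph) (p : prepath E) (xi : inf_path E) :
  cind R p xi = \sum_(e | rng e == path_dom p) cind R (path_rcons p e) xi.
Proof.
have cE e : cind R (path_rcons p e) xi =
    ((p == inf_prefix (size p.2) xi) && (e == inf_edge xi (size p.2)))%:R.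
  by rewrite /= size_rcons inf_prefixS path_rcons_eq.
under eq_bigr do rewrite cE.
rewrite /=; have [pE|np] := eqVneq p (inf_prefix (size p.2) xi); last first.
  by rewrite big1.
rewrite (bigD1 (inf_edge xi (size p.2))) /=.
  by rewrite eqxx big1 ?addr0 // => e /andP[_ /negPf ->].
have := inf_prefix_path (size p.2).+1 xi.
by rewrite inf_prefixS is_path_rcons -pE => /andP[].
Qed.

Section Isomorphism.
Context (R : realType) (G : groupType) (E : digraph) (phi : self_similar_action G E).
Local Notation sge := (sge phi).
Local Notation cfun := (cfun R (compact_inf_path (E := E))).
Local Notation sigma := (@sge_sigma G E phi).
Implicit Types (s t u : triple phi) (p q : prepath E).
Hypotheses (Gcount : countable [set: G]) (ns : no_sources E) (pf : pseudo_free phi).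

Let P := canonical_system R Gcount ns pf.
Let CP := crossed_product P.
Let gen : fsum P -> CP := @univ_gen R (fsum P) (@is_fsum_hom R cfun _ P).
Let gen_hom : is_fsum_hom gen := fsum_gen_hom P.

Lemma cind_delta_in s : pdom P (sigma s) (cind R (tleft s)).
Proof. exact: ideal_cind. Qed.

Let delta s : fsum P := fsum_delta (@cind_delta_in s).

(** On each fibre such maps are contractive by [fsum_hom_delta_le], hence determined by the
    indicators of cylinders, whose span is dense. *)
Lemma fsum_hom_eq (B : cstarAlgType R) (pi pi' : fsum P -> B) :
  is_fsum_hom pi -> is_fsum_hom pi' -> (forall s, pi (delta s) = pi' (delta s)) ->
  pi =1 pi'.
Proof.
move=> h h' e; elim/fsum_ind => [g a Da|f f' IH IH']; last first.
  by rewrite (fh_add h) (fh_add h') IH IH'.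
(* The membership proof is quantified inside [Q], since it changes along the induction. *)
pose Q a := forall Da : pdom P g a, pi (fsum_delta Da) = pi' (fsum_delta Da).
suff : Q a by apply.
apply: (@ideal_ind R G E phi ns g Q) => //.
- move=> D0; have z (pi0 : fsum P -> B) : is_fsum_hom pi0 -> pi0 (fsum_delta D0) = 0.
    move=> h0; apply: cnorm_eq0; apply/le_anti; rewrite cnorm_ge0 andbT.
    by have := fsum_hom_delta_le D0 h0; rewrite cnorm0.
  by rewrite !z.
- move=> f f1 df df1 q q1 Dab; rewrite (fsum_deltaD (P := P) df df1).
  by rewrite (fh_add h) (fh_add h') q q1.
- move=> k f df q Dk; rewrite (fsum_deltaZ (P := P) df).
  by rewrite (fh_scale h) (fh_scale h') q.
- move=> u f du df uf q Df.
  have lim (pi0 : fsum P -> B) : is_fsum_hom pi0 ->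
      seq_cvg (fun n => pi0 (fsum_delta (P := P) (du n))) (pi0 (fsum_delta Df)).
    move=> h0 x /uf[N hN]; exists N => n /hN; apply: le_trans.
    have DN : pdom P g (- f) by rewrite -cscaleN1; exact: pdomZ.
    have -> : - pi0 (fsum_delta Df) = pi0 (fsum_delta DN).
      have -> : fsum_delta DN = fsum_scale (- 1) (fsum_delta Df).
        by apply: fsumP => k /=; case: ifP; rewrite ?cscale0r ?cscaleN1.
      by rewrite (fh_scale h0) cscaleN1.
    rewrite -(fh_add h0) -(fsum_deltaD (P := P) _ _ (pdomD (du n : pdom P g _) DN)).
    exact: fsum_hom_delta_le.
  apply: seq_cvg_unique (lim _ h) _.
  have -> : (fun n => pi (fsum_delta (P := P) (du n))) =
      (fun n => pi' (fsum_delta (P := P) (du n))) by apply/funext => n; rewrite q.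
  exact: lim.
- by move=> s sg D1; rewrite -!(fsum_delta_eq (@cind_delta_in s) D1 sg erefl) e.
Qed.

Definition crossed_rep (s : sge) : CP :=
  if s is Some s then gen (delta s) else 0.

Lemma gen_delta0 g (D0 : pdom P g 0) : gen (fsum_delta D0) = 0.
Proof.
apply: cnorm_eq0; apply/le_anti; rewrite cnorm_ge0 andbT.
by have := fsum_hom_delta_le D0 gen_hom; rewrite cnorm0.
Qed.

Let in1 f : pdom P 1%g f := @ideal1 R G E phi f.
Let gen1 f : CP := gen (fsum_delta (in1 f)).

Lemma gen1_sum (I : Type) (r : seq I) (Q : pred I) (F : I -> cfun) :
  gen1 (\sum_(i <- r | Q i) F i) = \sum_(i <- r | Q i) gen1 (F i).
Proof.
apply: (big_morph gen1) => [f f1|]; last exact: gen_delta0.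
by rewrite /gen1 (fsum_deltaD (in1 f) (in1 f1)) (fh_add gen_hom).
Qed.

Lemma crossed_rep_pidem p : is_path p.1 p.2 -> crossed_rep (pidem phi p) = gen1 (cind R p).
Proof.
move=> pp; rewrite (pidemE phi pp) /=; congr gen; apply: fsum_delta_eq => //.
exact: sge_sigma1.
Qed.

(** Products come from [canonical_act_prod]. The unit and tightness relations hold already in C(X):
    the cylinders of length 0 partition the space, and each cylinder is the disjoint union of its
    one-edge extensions. *)
Lemma crossed_rep_tight : tight_rep crossed_rep.
Proof.
split.
- by [].
- move=> s t; rewrite [crossed_rep (Some s)]/= [crossed_rep (Some t)]/=.
  rewrite -(fh_mul gen_hom).
  have Dab : pdom P (sigma s * sigma t)%g
      (pact P (sigma s) (pact P (sigma s)^-1%g (cind R (tleft s)) * cind R (tleft t))).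
    apply: pact_mul_in; rewrite ?mulKg; exact: cind_delta_in.
  rewrite (fsum_mul_delta (@cind_delta_in s) (@cind_delta_in t) Dab).
  have := canonical_act_prod R Gcount ns pf s t.
  case st: (sge_mul (Some s) (Some t)) => [u|] /= e.
    congr gen; apply: fsum_delta_eq; first exact: sge_sigmaM.
    by rewrite e.
  have D0 : pdom P (sigma s * sigma t)%g 0 by exact: pdom0.
  by rewrite (fsum_delta_eq Dab D0) // gen_delta0.
- move=> s; rewrite [crossed_rep (Some s)]/= -(fh_star gen_hom).
  have Da : pdom P (sigma s)^-1%g (pact P (sigma s)^-1%g (star (cind R (tleft s)))).
    exact/pact_inV/pdom_star/cind_delta_in.
  rewrite (fsum_star_delta (@cind_delta_in s) Da); congr gen.
  apply: fsum_delta_eq; first exact: sge_sigmaV.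
  have -> : star (cind R (tleft s)) = cind R (tleft s).
    by apply: cfunP => x /=; rewrite conjc_nat.
  by rewrite -sge_sigmaV [RHS]/(pact P _ _) /= (canonical_act_cind R Gcount ns pf (tstar s)).
- rewrite -(fh_one gen_hom).
  have -> : gen (fsum_one P) = gen1 1 by congr gen; exact: fsum_delta_eq.
  have -> : (1 : cfun) = \sum_x cind R (x, [::]).
    apply: cfunP => xi; rewrite cfun_sumE.
    have := @sum_paths_prefix R E 0 xpredT (fun=> 1) xi; rewrite big_paths0 => h.
    by apply: etrans (esym h) _; apply: eq_bigr => x _; rewrite mul1r.
  by rewrite gen1_sum; apply: eq_bigr => x _; rewrite crossed_rep_pidem.
- move=> p pp; rewrite crossed_rep_pidem //.
  have -> : cind R p = \sum_(e | rng e == path_dom p) cind R (path_rcons p e) :> cfun.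
    apply: cfunP => xi; rewrite cfun_sumE; exact: cind_split.
  rewrite gen1_sum; apply: eq_bigr => e re; rewrite crossed_rep_pidem //.
  by rewrite is_path_rcons pp.
Qed.

(** Each universal property gives one map, through the tight representation carried by the other
    algebra. The composites fix the generators: by [tight_ogeK] on one side, by [oge_tightK] on the
    elements [delta s] on the other. *)
Lemma oge_isomorphic : cstar_isomorphic (oge phi R) CP.
Proof.
pose rel := @oge_rel G E phi R.
pose ogen : oge_gen G E -> oge phi R := @univ_gen R _ rel.
have ogen_rel : oge_rel phi ogen := @oge_gen_rel G E phi R.
have wt := oge_tightP ns ogen_rel.
have [pi pih piE] := tight_rep_fsum_hom wt Gcount ns pf.
have rhoW := tight_ogeP crossed_rep_tight.
pose Psi : oge phi R -> CP := univ_hom (tight_oge crossed_rep).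
pose Phi : CP -> oge phi R := univ_hom pi.
have shPsi : is_star_hom Psi := univ_hom_is_star_hom rhoW.
have shPhi : is_star_hom Phi := univ_hom_is_star_hom pih.
have cPsi a : cnorm (Psi a) <= cnorm a := univ_norm_ub a rhoW.
have cPhi a : cnorm (Phi a) <= cnorm a := univ_norm_ub a pih.
have Psi_gen x : Psi (ogen x) = tight_oge crossed_rep x.
  by apply: univ_hom_gen => //; exact: oge_gen_bounded.
have Phi_gen f : Phi (gen f) = pi f.
  by apply: univ_hom_gen => //; exact: fsum_gen_bounded.
have sh_comp (A B C : cstarAlgType R) (f : A -> B) (g : B -> C) :
    is_star_hom f -> is_star_hom g -> is_star_hom (g \o f).
  move=> hf hg; split=> * /=;
    rewrite ?(sh_add hf, sh_scale hf, sh_mul hf, sh_one hf, sh_star hf)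
            ?(sh_add hg, sh_scale hg, sh_mul hg, sh_one hg, sh_star hg) //.
have sh_id (A : cstarAlgType R) : is_star_hom (id : A -> A) by split.
have Phi_W (s : sge) : Phi (crossed_rep s) = oge_tight ogen s.
  case: s => [s|] /=; last exact: star_hom0.
  by rewrite Phi_gen piE.
have PhiK : Phi \o Psi =1 id.
  apply: univ_star_hom_eq => //; [exact: oge_gen_bounded|exact: sh_comp| |].
    by move=> a; exact: le_trans (cPhi _) (cPsi _).
  move=> x; rewrite /= -/ogen Psi_gen.
  rewrite -[RHS](congr1 (@^~ x) (tight_ogeK ogen_rel)).
  case: x => [x|e|g] /=; rewrite ?Phi_W //.
  rewrite (big_morph Phi (sh_add shPhi) (star_hom0 shPhi)).
  by apply: eq_bigr => x _; rewrite Phi_W.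
have Psi_w (s : sge) : Psi (oge_tight ogen s) = crossed_rep s.
  rewrite -(oge_tightK crossed_rep_tight).
  case: s => [s|] /=; last exact: star_hom0.
  have Psi_path x v : Psi (path_elem ogen x v) = path_elem (tight_oge crossed_rep) x v.
    by elim: v x => [|e v IH] x /=; rewrite ?(sh_mul shPsi) ?IH Psi_gen.
  by rewrite !(sh_mul shPsi) (sh_star shPsi) !Psi_path Psi_gen.
have PsiK : Psi \o Phi =1 id.
  apply: univ_star_hom_eq => //; [exact: fsum_gen_bounded|exact: sh_comp| |].
    by move=> a; exact: le_trans (cPsi _) (cPhi _).
  move=> f; rewrite /= -/gen Phi_gen; move: f.
  apply: (@fsum_hom_eq CP (Psi \o pi) gen) => //.
    split=> * /=.
    - by rewrite (fh_add pih) (sh_add shPsi).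
    - by rewrite (fh_scale pih) (sh_scale shPsi).
    - by rewrite (fh_mul pih) (sh_mul shPsi).
    - by rewrite (fh_one pih) (sh_one shPsi).
    - by rewrite (fh_star pih) (sh_star shPsi).
  by move=> s; rewrite /= piE Psi_w.
by exists Psi; split=> //; exists Phi.
Qed.

End Isomorphism.

Theorem theorem4p4 (R : realType) (G : groupType) (E : digraph)
    (phi : self_similar_action G E) :
  countable [set: G] -> no_sources E -> no_sinks E -> pseudo_free phi ->
  exists P : partial_system (cfun R (compact_inf_path (E := E))) (sge_group phi),
    is_canonical_partial_action P /\
    cstar_isomorphic (oge phi R) (crossed_product P).
Proof.
move=> Gcount ns _ pf; exists (canonical_system R Gcount ns pf); split.
  exact: canonical_systemP.
exact: oge_isomorphic.
Qed.
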